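(* Let $\widetilde{\mathcal{A}}^\infty=(\{\widetilde f_i\},\{\widetilde a_i\},u)$ be a non-negative approximation system for a sequence $\{\widetilde g_i\}_{i=0}^\infty$, which dominates a proper approximation system $\mathcal{A}^\infty=(\{f_i\},\{a_i\},u)$ for a sequence $\{g_i\}_{i=0}^\infty$, where both approximation systems have domain $U$. Let $g:=g_0$ and let $g^{[n]}$ be the $n$-th order approximation of $\mathcal{A}^\infty$. If $B(u,R)\subset U$ for some $R>0$, then $g^{[n]}$ converges uniformly to $g$ on $B(u,R)$ as $n\to\infty$.
   Context: An approximation system (AS) of infinite order is a triple $\mathcal{A}^\infty=(\{f_i\}_{i=0}^{\infty},\{a_i\}_{i=0}^{\infty},u)$ consisting of: holomorphic functions $f_i\colon U\times V_i\to\mathbb{C}$ of two complex variables, where $U\subset\mathbb{C}$ is open, connected and simply connected (the domain of the AS), $V_i\subset\mathbb{C}$ is open (the $V_i$ may differ between different AS's), and $f_i(x,\cdot)$ is non-constant for every $x\in U$; complex constants $a_i$ with $a_{i+1}\in V_i$ for all $i\ge0$; and a base point $u\in U$. $\mathcal{A}^\infty$ is an AS for the sequence $\{g_i\}_{i=0}^\infty$ if the $g_i$ are holomorphic functions on $U$ with $g_{i+1}(U)\subset V_i$, $g_i(u)=a_i$, and $g_i'(x)=f_i(x,g_{i+1}(x))$ for $x\in U$, for all $i\ge0$. For an integer $n\ge0$ define recursively $g_n^{[n]}(x):=a_n$ and $g_i^{[n]}(x):=a_i+\int_u^x f_i(t,g_{i+1}^{[n]}(t))\,dt$ for $x\in U$,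 $i=n-1,\dots,0$. $\mathcal{A}^\infty$ is proper if for every $n\ge0$ the inclusions $g_{i+1}^{[n]}(U)\subset V_i$ ($i<n$) hold at each step of this construction; then $g^{[n]}:=g_0^{[n]}$ is the $n$-th order approximation. An AS $\mathcal{A}^\infty$ is non-negative if $a_i\ge0$ and $(D_1^kD_2^lf_i)(u,a_{i+1})\ge0$ for all $i,k,l\ge0$. A non-negative AS $\widetilde{\mathcal{A}}^\infty$ (with the same base point $u$) dominates $\mathcal{A}^\infty$ if $|a_i|\le\widetilde a_i$ and $|(D_1^kD_2^lf_i)(u,a_{i+1})|\le(D_1^kD_2^l\widetilde f_i)(u,\widetilde a_{i+1})$ for all $i,k,l\ge0$. Here $D_1,D_2$ denote the derivatives with respect to the first and second argument, and $B(u,R)$ is the open disk with center $u$ and radius $R$.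
   Formalization: Uniform convergence is proved on B(u,r) for every 0<r<R, not on B(u,R) itself, where it can fail: for U={Re x<1}, f_i=y^2, a_i=1, u=0, R=1, g=1/(1-x) is unbounded on B(0,1) while every g^[n] is a polynomial. *)

(* Defs.v *)
From Stdlib Require Import Reals.
From Coquelicot Require Export Coquelicot.

Open Scope R_scope.

(** * Plane topology *)

(* Nonemptiness is not required here; an approximation system has a base point. *)
Definition connected_set (U : C -> Prop) : Prop :=
  forall A B : C -> Prop,
    open A -> open B ->
    (forall z, U z -> A z \/ B z) ->
    (exists z, U z /\ A z) -> (exists z, U z /\ B z) ->
    exists z, U z /\ A z /\ B z.

Definition I01 (t : R) : Prop := 0 <= t <= 1.

(* Every loop in U is homotopic in U, relative to its endpoints, to a constant
   loop.  Path-connectedness is not included: it follows from [open] and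
   [connected_set]. *)
Definition simply_connected (U : C -> Prop) : Prop :=
  forall gamma : R -> C,
    continuous_on I01 gamma ->
    (forall t, I01 t -> U (gamma t)) ->
    gamma 0 = gamma 1 ->
    exists H : R * R -> C,
      continuous_on (fun p : R * R => I01 (fst p) /\ I01 (snd p)) H /\
      (forall s t, I01 s -> I01 t -> U (H (s, t))) /\
      (forall t, I01 t -> H (0, t) = gamma t) /\
      (forall t, I01 t -> H (1, t) = gamma 0) /\
      (forall s, I01 s -> H (s, 0) = gamma 0 /\ H (s, 1) = gamma 0).

Definition disk (u : C) (r : R) (z : C) : Prop := Cmod (z - u) < r.

(** * Holomorphic functions *)

(* Functions on a subset of C or of C^2 are represented by total functions whose
   values off the subset are irrelevant. *)

Definition holomorphic_on (U : C -> Prop) (g : C -> C) : Prop :=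
  forall x, U x -> ex_derive (K := C_AbsRing) (V := C_NormedModule) g x.

(* Joint (Frechet) complex differentiability at every point of U x V. *)
Definition holomorphic2_on (U V : C -> Prop) (f : C -> C -> C) : Prop :=
  forall x y, U x -> V y ->
    ex_filterdiff (K := C_AbsRing)
      (U := prod_NormedModule C_AbsRing C_NormedModule C_NormedModule)
      (V := C_NormedModule)
      (fun p => f (fst p) (snd p)) (locally (x, y)).

Definition D1 (f : C -> C -> C) : C -> C -> C :=
  fun x y => C_derive (fun t => f t y) x.

Definition D2 (f : C -> C -> C) : C -> C -> C :=
  fun x y => C_derive (fun t => f x t) y.

Definition D12 (k l : nat) (f : C -> C -> C) : C -> C -> C :=
  Nat.iter k D1 (Nat.iter l D2 f).

(** * Contour integrals *)

Definition C1_path (U : C -> Prop) (x y : C) (gamma dgamma : R -> C) : Prop :=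
  (forall t, I01 t ->
     U (gamma t) /\
     is_derive (K := R_AbsRing) (V := C_R_NormedModule) gamma t (dgamma t) /\
     continuous dgamma t) /\
  gamma 0 = x /\ gamma 1 = y.

(* [is_contour_int U h x y I]: I is the integral of h along some piecewise C^1
   path from x to y in U, given as a finite concatenation of C^1 paths. *)
Inductive is_contour_int (U : C -> Prop) (h : C -> C) : C -> C -> C -> Prop :=
| contour_nil x : U x -> is_contour_int U h x x 0
| contour_cons x y z gamma dgamma I J :
    is_contour_int U h x y I ->
    C1_path U y z gamma dgamma ->
    is_RInt (V := C_R_NormedModule)
      (fun t => Cmult (h (gamma t)) (dgamma t)) 0 1 J ->
    is_contour_int U h x z (I + J)%C.

(* The common value of the integrals of h along paths from x to y in U; it is
   meaningful when these integrals exist and are path independent, e.g. when h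
   is holomorphic and U is open, connected and simply connected. *)
Definition contour_int (U : C -> Prop) (h : C -> C) (x y : C) : C :=
  iota (T := C_R_CompleteNormedModule) (is_contour_int U h x y).

(** * Approximation systems of infinite order *)

Record approx_system := {
  dom : C -> Prop;
  rhs_dom : nat -> C -> Prop;
  rhs : nat -> C -> C -> C;
  cst : nat -> C;
  base : C;
  dom_open : open dom;
  dom_connected : connected_set dom;
  dom_simply_connected : simply_connected dom;
  rhs_dom_open : forall i, open (rhs_dom i);
  rhs_holomorphic : forall i, holomorphic2_on dom (rhs_dom i) (rhs i);
  rhs_nonconstant : forall i x, dom x ->
    exists y z, rhs_dom i y /\ rhs_dom i z /\ rhs i x y <> rhs i x z;
  cst_dom : forall i, rhs_dom i (cst (S i));
  base_dom : dom base
}.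

Definition is_AS_for (A : approx_system) (g : nat -> C -> C) : Prop :=
  forall i,
    holomorphic_on (dom A) (g i) /\
    (forall x, dom A x -> rhs_dom A i (g (S i) x)) /\
    g i (base A) = cst A i /\
    (forall x, dom A x -> C_derive (g i) x = rhs A i x (g (S i) x)).

(* [approx_rec A k i] is g_i^[i+k]. *)
Fixpoint approx_rec (A : approx_system) (k i : nat) : C -> C :=
  match k with
  | O => fun _ => cst A i
  | S k' => fun x =>
      (cst A i +
       contour_int (dom A) (fun t => rhs A i t (approx_rec A k' (S i) t))
         (base A) x)%C
  end.

(* g_i^[n], for i <= n. *)
Definition approx (A : approx_system) (n i : nat) : C -> C :=
  approx_rec A (n - i) i.

Definition proper (A : approx_system) : Prop :=
  forall n i, (i < n)%nat ->
    forall x, dom A x -> rhs_dom A i (approx A n (S i) x).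

(* w - z is a nonnegative real number. *)
Definition Cle (z w : C) : Prop := Re z <= Re w /\ Im z = Im w.

Definition nonnegative (A : approx_system) : Prop :=
  (forall i, Cle 0 (cst A i)) /\
  (forall i k l, Cle 0 (D12 k l (rhs A i) (base A) (cst A (S i)))).

Definition dominates (B A : approx_system) : Prop :=
  nonnegative B /\
  base B = base A /\
  (forall i, Cle (Cmod (cst A i)) (cst B i)) /\
  (forall i k l,
     Cle (Cmod (D12 k l (rhs A i) (base A) (cst A (S i))))
         (D12 k l (rhs B i) (base B) (cst B (S i)))).

(* For [S = disk u R] with R maximal this notion is too strong for the
   approximations of a dominated system: with f_i(x, y) = y^2, a_i = 1 and u = 0
   on the half-plane Re x < 1, one has g(x) = 1 / (1 - x), unbounded on
   [disk 0 1], while all the approximations are polynomials.  It is to be used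
   on the smaller disks [disk u r], r < R. *)
Definition converges_uniformly_on
    (S : C -> Prop) (s : nat -> C -> C) (g : C -> C) : Prop :=
  forall eps : R, 0 < eps ->
    exists N : nat, forall n, (N <= n)%nat ->
      forall x, S x -> Cmod (s n x - g x) < eps.

(* Main.v *)
(** Write c_k(f) for the k-th Taylor coefficient of f at the base point u. Since
    g_i' = f_i(x, g_{i+1}), the chain and product rules express (k+1) c_{k+1}(g_i)
    through sums and products of the c_j(g_{i+1}), j <= k, and of the derivatives of
    f_i at (u, a_{i+1}), with non-negative rational coefficients. Hence the coefficients
    of g, and likewise those of g^[n], are bounded in modulus by those of the
    dominating solution, while those of g^[n] and g agree up to order n. On |x - u| < r1
    the error of g^[n] is then at most the tail, from order n on, of a geometric series
    with ratio |x - u| / r1.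

    The c_k(f) are circle averages. Cauchy's formula follows from homotopy invariance,
    which also makes the contour integrals defining g_i^[n] independent of the path. *)
Require Import Defs.
From Stdlib Require Import Reals Lra Lia ClassicalEpsilon.
From Coquelicot Require Import Coquelicot.

(** No closed formula for a Taylor coefficient is ever written down. A relation between coefficients
    that is stable under sums, products and multiplication or division by positive integers passes
    from the derivatives of two functions to the functions themselves, and the chain rule turns a
    composition into compositions of the same shape. Since g_i to order n + 1 needs g_{i+1} only to
    order n, the induction runs on the order, for all indices i at once, and the infinite chain of
    equations causes no regress. The chain rule needs all mixed derivatives of f_i, while holomorphy
    provides one joint derivative: higher differentiability and D1 D2 = D2 D1 come from Taylor
    remainders that are uniform in the base point. Homotopies are merely continuous, so integrals
    are needed along continuous paths, by local primitives. The resulting invariance lets the base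
    point of a loop move, and so also covers the shrinking circles of Cauchy's formula. The size of
    the error comes from one number, the maximum of the dominating solution on the circle of radius
    r1 < R; it does not depend on n. *)

Notation is_Cderive f z l := (is_derive (K := C_AbsRing) (V := C_NormedModule) f z l).
Notation is_Rderive f t l := (is_derive (K := R_AbsRing) (V := C_R_NormedModule) f t l).
Notation is_CRInt f a b l := (is_RInt (V := C_R_NormedModule) f a b l).
Notation CRInt f a b := (RInt (V := C_R_CompleteNormedModule) f a b).
Notation ex_CRInt f a b := (ex_RInt (V := C_R_NormedModule) f a b).

(** * Derivatives and continuity in epsilon form *)

Lemma is_Cderive_eps (f : C -> C) (z l : C) :
  is_Cderive f z l <->
  forall eps, 0 < eps -> exists d, 0 < d /\ forall w, Cmod (w - z) < d ->
    Cmod (f w - f z - (w - z) * l) <= eps * Cmod (w - z).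
Proof.
  split.
  - intros [_ H] eps He.
    destruct (H z (fun P HP => HP) (mkposreal eps He)) as [d Hd].
    exists d; split; [apply cond_pos|]. intros w Hw. exact (Hd w Hw).
  - intros H; split.
    + exact (is_linear_scal_l (K := C_AbsRing) (V := C_NormedModule) l).
    + intros x Hx.
      assert (E : z = x) by exact (is_filter_lim_locally_unique (K := C_AbsRing) (V := AbsRing_NormedModule C_AbsRing) z x Hx).
      rewrite <- E. intros eps.
      destruct (H eps (cond_pos eps)) as [d [Hd0 Hd]].
      exists (mkposreal d Hd0). intros w Hw. exact (Hd w Hw).
Qed.

Lemma is_Rderive_eps (f : R -> C) (t : R) (l : C) :
  is_Rderive f t l <->
  forall eps, 0 < eps -> exists d, 0 < d /\ forall s, Rabs (s - t) < d ->
    Cmod (f s - f t - RtoC (s - t) * l) <= eps * Rabs (s - t).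
Proof.
  assert (E : forall s, Cmod (f s - f t - RtoC (s - t) * l) =
     norm (V := C_R_NormedModule) (minus (minus (f s) (f t)) (scal (minus s t) l))).
  { intros s. rewrite Cmod_norm. apply f_equal.
    apply injective_projections; unfold minus, scal, opp, plus; simpl;
      unfold minus, scal, opp, plus; simpl; unfold mult; simpl; ring. }
  split.
  - intros [_ H] eps He.
    destruct (H t (fun P HP => HP) (mkposreal eps He)) as [d Hd].
    exists d; split; [apply cond_pos|]. intros w Hw. rewrite E. exact (Hd w Hw).
  - intros H; split.
    + exact (is_linear_scal_l (K := R_AbsRing) (V := C_R_NormedModule) l).
    + intros x Hx.
      assert (E' : t = x) by exact (is_filter_lim_locally_unique (K := R_AbsRing) (V := AbsRing_NormedModule R_AbsRing) t x Hx).
      rewrite <- E'. intros eps.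
      destruct (H eps (cond_pos eps)) as [d [Hd0 Hd]].
      exists (mkposreal d Hd0). intros w Hw. pose proof (Hd w Hw) as K. rewrite E in K. exact K.
Qed.

Lemma continuous_C_eps {T : UniformSpace} (f : T -> C) (x : T) :
  continuous f x <-> forall eps, 0 < eps -> locally x (fun y => Cmod (f y - f x) < eps).
Proof.
  split.
  - intros H eps He.
    (* Balls of [C] are those of the product structure, that is, squares; half the radius suffices
       because sqrt 2 < 2. *)
    assert (He' : 0 < eps / 2) by lra.
    generalize (proj1 (filterlim_locally f (f x)) H (mkposreal _ He')).
    apply filter_imp. intros y [H1 H2].
    eapply Rle_lt_trans; [apply Cmod_2Rmax|].
    change (Rabs (fst (f y) - fst (f x)) < eps/2) in H1.
    change (Rabs (snd (f y) - snd (f x)) < eps/2) in H2.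
    assert (Hs : sqrt 2 < 2).
    { rewrite <- (sqrt_square 2) at 2 by lra. apply sqrt_lt_1; lra. }
    assert (Hm : Rmax (Rabs (fst (f y - f x)%C)) (Rabs (snd (f y - f x)%C)) < eps/2)
      by (apply Rmax_lub_lt; assumption).
    pose proof (Rabs_pos (fst (f y - f x)%C)).
    pose proof (Rmax_l (Rabs (fst (f y - f x)%C)) (Rabs (snd (f y - f x)%C))).
    pose proof (sqrt_pos 2). nra.
  - intros H. apply filterlim_locally. intros eps.
    generalize (H eps (cond_pos eps)). apply filter_imp. intros y Hy.
    exact (C_NormedModule_mixin_compat1 (f x) (f y) eps Hy).
Qed.

Lemma locally_C_eps (z : C) (P : C -> Prop) :
  locally z P <-> exists d, 0 < d /\ forall w, Cmod (w - z) < d -> P w.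
Proof.
  split.
  - intros [d Hd]. exists d; split; [apply cond_pos|]. intros w Hw. apply Hd.
    exact (C_NormedModule_mixin_compat1 z w d Hw).
  - intros [d [Hd0 Hd]].
    pose proof (proj1 (continuous_C_eps (fun w : C => w) z) (continuous_id z) d Hd0) as H.
    revert H. apply filter_imp. exact Hd.
Qed.

Lemma is_Cderive_continuous (f : C -> C) (z l : C) : is_Cderive f z l -> continuous f z.
Proof.
  intros H. apply continuous_C_eps. intros eps He.
  destruct (proj1 (is_Cderive_eps f z l) H 1 Rlt_0_1) as [d [Hd0 Hd]].
  pose proof (Cmod_ge_0 l) as Hl.
  apply locally_C_eps. exists (Rmin d (eps / (2 + Cmod l))). split.
  { apply Rmin_pos; [exact Hd0|]. apply Rdiv_lt_0_compat; lra. }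
  intros w Hw.
  assert (H1 := Hd w (Rlt_le_trans _ _ _ Hw (Rmin_l _ _))).
  assert (H2 := Rlt_le_trans _ _ _ Hw (Rmin_r _ _)).
  replace (f w - f z)%C with ((f w - f z - (w - z) * l) + (w - z) * l)%C by ring.
  eapply Rle_lt_trans; [apply Cmod_triangle|]. rewrite Cmod_mult.
  apply Rlt_div_r in H2; [|lra]. pose proof (Cmod_ge_0 (w - z)). nra.
Qed.

Section Continuity.
Context {T : UniformSpace}.
Implicit Types f g : T -> C.

Lemma continuous_Cplus f g x : continuous f x -> continuous g x ->
  continuous (fun y => f y + g y)%C x.
Proof. exact (continuous_plus (V := C_R_NormedModule) f g x). Qed.

Lemma continuous_Cminus f g x : continuous f x -> continuous g x ->
  continuous (fun y => f y - g y)%C x.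
Proof. exact (continuous_minus (V := C_R_NormedModule) f g x). Qed.

Lemma continuous_Cmult f g x : continuous f x -> continuous g x ->
  continuous (fun y => f y * g y)%C x.
Proof.
  intros Hf Hg. apply continuous_C_eps. intros eps He.
  set (M := 1 + Cmod (f x) + Cmod (g x)).
  pose proof (Cmod_ge_0 (f x)) as H1. pose proof (Cmod_ge_0 (g x)) as H2.
  assert (HM : 0 < M) by (unfold M; lra).
  assert (He' : 0 < Rmin 1 (eps / (2 * M))).
  { apply Rmin_pos; [lra|]. apply Rdiv_lt_0_compat; lra. }
  generalize (filter_and _ _ (proj1 (continuous_C_eps f x) Hf _ He')
    (proj1 (continuous_C_eps g x) Hg _ He')).
  apply filter_imp. intros y [A B].
  assert (A1 := Rlt_le_trans _ _ _ A (Rmin_l _ _)).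
  assert (A2 := Rlt_le_trans _ _ _ A (Rmin_r _ _)).
  assert (B2 := Rlt_le_trans _ _ _ B (Rmin_r _ _)).
  apply Rlt_div_r in A2; [|lra]. apply Rlt_div_r in B2; [|lra].
  replace (f y * g y - f x * g x)%C
    with ((f y - f x) * (g y - g x) + (f y - f x) * g x + f x * (g y - g x))%C by ring.
  eapply Rle_lt_trans; [apply Cmod_triangle|].
  eapply Rle_lt_trans; [apply Rplus_le_compat_r, Cmod_triangle|].
  rewrite !Cmod_mult. unfold M in *.
  pose proof (Cmod_ge_0 (f y - f x)). pose proof (Cmod_ge_0 (g y - g x)). nra.
Qed.

Lemma continuous_RtoC (f : T -> R) x : continuous f x -> continuous (fun y => RtoC (f y)) x.
Proof.
  intros Hf. apply continuous_C_eps. intros eps He.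
  generalize (proj1 (filterlim_locally f (f x)) Hf (mkposreal _ He)).
  apply filter_imp. intros y Hy. rewrite <- RtoC_minus, Cmod_R. exact Hy.
Qed.

Lemma continuous_Ccomp (h : C -> C) f x : continuous f x -> continuous h (f x) ->
  continuous (fun y => h (f y)) x.
Proof. exact (continuous_comp f h x). Qed.

End Continuity.

Lemma is_Rderive_continuous (f : R -> C) t l : is_Rderive f t l -> continuous f t.
Proof. intros H. apply (ex_derive_continuous (V := C_R_NormedModule)). now exists l. Qed.

(** [F] is differentiated over the complex numbers and [p] over the reals, so the two remainders are
    combined by hand, each contributing at most half of [eps]. *)
Lemma is_Rderive_comp (F : C -> C) (p : R -> C) (t : R) (l dp : C) :
  is_Cderive F (p t) l -> is_Rderive p t dp -> is_Rderive (fun s => F (p s)) t (l * dp)%C.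
Proof.
  intros HF Hp. apply is_Rderive_eps. intros eps He.
  pose proof (proj1 (is_Cderive_eps _ _ _) HF) as HF'.
  pose proof (proj1 (is_Rderive_eps _ _ _) Hp) as Hp'.
  pose proof (proj1 (continuous_C_eps p t) (is_Rderive_continuous _ _ _ Hp)) as Hc.
  pose proof (Cmod_ge_0 l) as Hl0. pose proof (Cmod_ge_0 dp) as Hdp0.
  destruct (HF' (eps / (2 * (1 + Cmod dp)))) as [d1 [Hd1 H1]];
    [apply Rdiv_lt_0_compat; lra|].
  destruct (Hp' (Rmin 1 (eps / (2 * (1 + Cmod l))))) as [d2 [Hd2 H2]].
  { apply Rmin_pos; [lra|apply Rdiv_lt_0_compat; lra]. }
  destruct (Hc d1 Hd1) as [d3 H3].
  exists (Rmin d2 d3). split; [apply Rmin_pos; [assumption|apply cond_pos]|].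
  intros s Hs.
  assert (K2 := H2 s (Rlt_le_trans _ _ _ Hs (Rmin_l _ _))).
  assert (K3 := H3 s (Rlt_le_trans _ _ _ Hs (Rmin_r _ _))).
  assert (K1 := H1 _ K3).
  replace (F (p s) - F (p t) - RtoC (s - t) * (l * dp))%C with
    ((F (p s) - F (p t) - (p s - p t) * l) + (p s - p t - RtoC (s - t) * dp) * l)%C by ring.
  eapply Rle_trans; [apply Cmod_triangle|]. rewrite Cmod_mult.
  assert (K4 : Cmod (p s - p t) <= (1 + Cmod dp) * Rabs (s - t)).
  { replace (p s - p t)%C with ((p s - p t - RtoC (s - t) * dp) + RtoC (s - t) * dp)%C by ring.
    eapply Rle_trans; [apply Cmod_triangle|]. rewrite Cmod_mult, Cmod_R.
    pose proof (Rmin_l 1 (eps / (2 * (1 + Cmod l)))). pose proof (Rabs_pos (s - t)). nra. }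
  pose proof (Rabs_pos (s - t)) as Ha.
  assert (K5 : Cmod (F (p s) - F (p t) - (p s - p t) * l) <= eps / 2 * Rabs (s - t)).
  { eapply Rle_trans; [apply K1|].
    replace (eps / 2 * Rabs (s - t)) with
      (eps / (2 * (1 + Cmod dp)) * ((1 + Cmod dp) * Rabs (s - t))) by (field; lra).
    apply Rmult_le_compat_l; [|exact K4]. apply Rlt_le, Rdiv_lt_0_compat; lra. }
  assert (K6 : Cmod (p s - p t - RtoC (s - t) * dp) * Cmod l <= eps / 2 * Rabs (s - t)).
  { replace (eps / 2 * Rabs (s - t)) with
      (eps / (2 * (1 + Cmod l)) * Rabs (s - t) * (1 + Cmod l)) by (field; lra).
    apply Rmult_le_compat; try apply Cmod_ge_0; [|lra].
    eapply Rle_trans; [apply K2|]. apply Rmult_le_compat_r; [assumption|apply Rmin_r]. }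
  lra.
Qed.

Lemma is_Rderive_line (a v : C) (t : R) : is_Rderive (fun s => a + RtoC s * v)%C t v.
Proof.
  apply is_Rderive_eps. intros eps He. exists 1. split; [lra|]. intros s _.
  replace (a + s * v - (a + t * v) - RtoC (s - t) * v)%C with (RtoC 0)
    by (rewrite RtoC_minus; ring).
  rewrite Cmod_R, Rabs_R0. pose proof (Rabs_pos (s - t)). nra.
Qed.

(** * Integrals of complex-valued functions *)

Lemma ex_CRInt_continuous (f : R -> C) a b : a <= b ->
  (forall t, a <= t <= b -> continuous f t) -> ex_CRInt f a b.
Proof.
  intros Hab H. apply (ex_RInt_continuous (V := C_R_CompleteNormedModule)).
  intros t Ht. rewrite Rmin_left, Rmax_right in Ht by assumption. now apply H.
Qed.

Lemma CRInt_correct (f : R -> C) a b : ex_CRInt f a b -> is_CRInt f a b (CRInt f a b).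
Proof. exact (RInt_correct (V := C_R_CompleteNormedModule) f a b). Qed.

Lemma is_CRInt_unique (f : R -> C) a b l : is_CRInt f a b l -> CRInt f a b = l.
Proof. exact (is_RInt_unique (V := C_R_CompleteNormedModule) f a b l). Qed.

Lemma is_CRInt_inj (f : R -> C) a b l m : is_CRInt f a b l -> is_CRInt f a b m -> l = m.
Proof. intros H K. rewrite <- (is_CRInt_unique _ _ _ _ H). now apply is_CRInt_unique. Qed.

Lemma is_CRInt_deriv (f df : R -> C) a b : a <= b ->
  (forall t, a <= t <= b -> is_Rderive f t (df t)) ->
  (forall t, a <= t <= b -> continuous df t) ->
  is_CRInt df a b (f b - f a)%C.
Proof.
  intros Hab H K. apply (is_RInt_derive (V := C_R_CompleteNormedModule) f df a b);
  intros t Ht; rewrite Rmin_left, Rmax_right in Ht by assumption; auto.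
Qed.

Lemma is_CRInt_bound (f : R -> C) a b l M : a <= b ->
  (forall t, a <= t <= b -> Cmod (f t) <= M) -> is_CRInt f a b l ->
  Cmod l <= (b - a) * M.
Proof.
  intros Hab HM Hf. rewrite Cmod_norm.
  apply (norm_RInt_le (V := C_R_NormedModule) f (fun _ => M) a b l _ Hab).
  - intros t Ht. rewrite <- Cmod_norm. now apply HM.
  - exact Hf.
  - apply (is_RInt_const (V := R_NormedModule) a b M).
Qed.

Lemma is_CRInt_plus (f g : R -> C) a b l m :
  is_CRInt f a b l -> is_CRInt g a b m -> is_CRInt (fun t => f t + g t)%C a b (l + m)%C.
Proof. exact (is_RInt_plus (V := C_R_NormedModule) f g a b l m). Qed.

Lemma is_CRInt_minus (f g : R -> C) a b l m :
  is_CRInt f a b l -> is_CRInt g a b m -> is_CRInt (fun t => f t - g t)%C a b (l - m)%C.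
Proof. exact (is_RInt_minus (V := C_R_NormedModule) f g a b l m). Qed.

Lemma is_CRInt_ext (f g : R -> C) a b l : a <= b -> (forall t, a <= t <= b -> f t = g t) ->
  is_CRInt f a b l -> is_CRInt g a b l.
Proof.
  intros Hab H. apply (is_RInt_ext (V := C_R_NormedModule)).
  intros t Ht. rewrite Rmin_left, Rmax_right in Ht by assumption. apply H. lra.
Qed.

(** A complex constant mixes the two components, so the integral is computed component by component
    from real linear combinations. *)
Lemma is_CRInt_Cmult (c : C) (f : R -> C) a b l :
  is_CRInt f a b l -> is_CRInt (fun t => c * f t)%C a b (c * l)%C.
Proof.
  intros H.
  pose proof (is_RInt_fct_extend_fst (U := R_NormedModule) (V := R_NormedModule) _ _ _ _ H) as H1.
  pose proof (is_RInt_fct_extend_snd (U := R_NormedModule) (V := R_NormedModule) _ _ _ _ H) as H2.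
  apply (is_RInt_fct_extend_pair (U := R_NormedModule) (V := R_NormedModule)).
  - apply (is_RInt_minus (V := R_NormedModule) (fun t => fst c * fst (f t)) (fun t => snd c * snd (f t)));
    now apply (is_RInt_scal (V := R_NormedModule)).
  - apply (is_RInt_plus (V := R_NormedModule) (fun t => fst c * snd (f t)) (fun t => snd c * fst (f t)));
    now apply (is_RInt_scal (V := R_NormedModule)).
Qed.

Lemma is_CRInt_const a b (c : C) : is_CRInt (fun _ => c) a b (RtoC (b - a) * c)%C.
Proof.
  replace (RtoC (b - a) * c)%C with (scal (V := C_R_NormedModule) (b - a)%R c).
  - apply (is_RInt_const (V := C_R_NormedModule)).
  - apply injective_projections; simpl; unfold scal; simpl; unfold mult; simpl; ring.
Qed.

Definition cdiff (h : C -> C) (z : C) : Prop := ex_derive (K := C_AbsRing) (V := C_NormedModule) h z.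

Lemma cdiff_continuous h z : cdiff h z -> continuous h z.
Proof. intros [l Hl]. exact (is_Cderive_continuous _ _ _ Hl). Qed.

(** * Integrals along segments *)

Definition seg (h : C -> C) (a b : C) : C :=
  CRInt (fun t => h (a + RtoC t * (b - a)) * (b - a))%C 0 1.

Definition convex (K : C -> Prop) : Prop :=
  forall a b t, K a -> K b -> 0 <= t <= 1 -> K (a + RtoC t * (b - a))%C.

Lemma continuous_line (a v : C) (t : R) : continuous (fun s => a + RtoC s * v)%C t.
Proof. exact (is_Rderive_continuous _ _ _ (is_Rderive_line a v t)). Qed.

Lemma seg_correct h a b : (forall t, 0 <= t <= 1 -> continuous h (a + RtoC t * (b - a))%C) ->
  is_CRInt (fun t => h (a + RtoC t * (b - a)) * (b - a))%C 0 1 (seg h a b).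
Proof.
  intros H. apply CRInt_correct, ex_CRInt_continuous; [lra|].
  intros t Ht. apply continuous_Cmult; [|apply continuous_const].
  apply (continuous_Ccomp h); [apply continuous_line|now apply H].
Qed.

(** Affine substitution, with [s] and [t] in any order: [s = 1], [t = 0] reverses a segment, and an
    intermediate parameter splits it. *)
Lemma seg_param h a v s t l :
  is_CRInt (fun x => h (a + RtoC x * v) * v)%C s t l ->
  seg h (a + RtoC s * v) (a + RtoC t * v) = l.
Proof.
  intros H. apply is_CRInt_unique.
  replace s with ((t - s) * 0 + s) in H at 1 by ring.
  replace t with ((t - s) * 1 + s) in H at 2 by ring.
  apply (is_RInt_comp_lin (V := C_R_NormedModule)) in H.
  revert H. apply is_CRInt_ext; [lra|]. intros x _.
  transitivity (RtoC (t - s) * (h (a + RtoC ((t - s) * x + s) * v) * v))%C.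
  { apply injective_projections; unfold scal; simpl; unfold scal; simpl; unfold mult; simpl; ring. }
  replace (a + RtoC ((t - s) * x + s) * v)%C with
    (a + s * v + x * (a + t * v - (a + s * v)))%C
    by (rewrite RtoC_plus, RtoC_mult, RtoC_minus; ring).
  rewrite RtoC_minus; ring.
Qed.

Section Convex.
Context (K : C -> Prop) (HK : convex K).

Lemma seg_rev h a b : (forall z, K z -> continuous h z) -> K a -> K b ->
  seg h b a = (- seg h a b)%C.
Proof.
  intros Hh Ha Hb.
  pose proof (seg_correct h a b (fun t Ht => Hh _ (HK a b t Ha Hb Ht))) as H.
  apply (is_RInt_swap (V := C_R_NormedModule)) in H. apply seg_param in H.
  replace (a + 1%R * (b - a))%C with b in H by ring.
  now replace (a + 0%R * (b - a))%C with a in H by ring.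
Qed.

Lemma seg_split h a b t : (forall z, K z -> continuous h z) -> K a -> K b -> 0 <= t <= 1 ->
  seg h a b = (seg h a (a + RtoC t * (b - a)) + seg h (a + RtoC t * (b - a)) b)%C.
Proof.
  intros Hh Ha Hb Ht.
  assert (Hc : forall s, 0 <= s <= 1 ->
     continuous (fun x => h (a + RtoC x * (b - a)) * (b - a))%C s).
  { intros s Hs. apply continuous_Cmult; [|apply continuous_const].
    apply (continuous_Ccomp h); [apply continuous_line|apply Hh, HK; assumption]. }
  assert (H1 : ex_CRInt (fun x => h (a + RtoC x * (b - a)) * (b - a))%C 0 t).
  { apply ex_CRInt_continuous; [lra|]. intros s Hs. apply Hc. lra. }
  assert (H2 : ex_CRInt (fun x => h (a + RtoC x * (b - a)) * (b - a))%C t 1).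
  { apply ex_CRInt_continuous; [lra|]. intros s Hs. apply Hc. lra. }
  apply CRInt_correct in H1. apply CRInt_correct in H2.
  pose proof (is_RInt_Chasles (V := C_R_NormedModule) _ _ _ _ _ _ H1 H2) as H3.
  apply seg_param in H1. apply seg_param in H2. apply seg_param in H3.
  replace (a + 1%R * (b - a))%C with b in * by ring.
  replace (a + 0%R * (b - a))%C with a in * by ring.
  rewrite H1, H2, H3. reflexivity.
Qed.

Lemma seg_bound h a b M : (forall z, K z -> continuous h z) -> K a -> K b ->
  (forall t, 0 <= t <= 1 -> Cmod (h (a + RtoC t * (b - a))%C) <= M) ->
  Cmod (seg h a b) <= M * Cmod (b - a).
Proof.
  intros Hh Ha Hb HM.
  pose proof (seg_correct h a b (fun t Ht => Hh _ (HK a b t Ha Hb Ht))) as H.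
  replace (M * Cmod (b - a)) with ((1 - 0) * (M * Cmod (b - a))) by ring.
  apply (is_CRInt_bound _ 0 1 _ _ ltac:(lra)) with (2 := H).
  intros t Ht. rewrite Cmod_mult. apply Rmult_le_compat_r; [apply Cmod_ge_0|auto].
Qed.

Lemma seg_minus f g a b : (forall z, K z -> continuous f z) ->
  (forall z, K z -> continuous g z) -> K a -> K b ->
  seg (fun z => f z - g z)%C a b = (seg f a b - seg g a b)%C.
Proof.
  intros Hf Hg Ha Hb. apply is_CRInt_unique.
  pose proof (seg_correct f a b (fun t Ht => Hf _ (HK a b t Ha Hb Ht))) as H1.
  pose proof (seg_correct g a b (fun t Ht => Hg _ (HK a b t Ha Hb Ht))) as H2.
  generalize (is_CRInt_minus _ _ _ _ _ _ H1 H2).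
  apply is_CRInt_ext; [lra|]. intros t _. ring.
Qed.

Lemma seg_primitive F h a b : (forall z, K z -> is_Cderive F z (h z)) ->
  (forall z, K z -> continuous h z) -> K a -> K b -> seg h a b = (F b - F a)%C.
Proof.
  intros HF Hh Ha Hb. apply is_CRInt_unique.
  pose proof (is_CRInt_deriv (fun t => F (a + RtoC t * (b - a))%C)
    (fun t => h (a + RtoC t * (b - a)) * (b - a))%C 0 1 ltac:(lra)) as H.
  cbv beta in H.
  replace (a + 1%R * (b - a))%C with b in H by ring.
  replace (a + 0%R * (b - a))%C with a in H by ring.
  apply H.
  - intros t Ht. apply is_Rderive_comp; [apply HF, HK; assumption|apply is_Rderive_line].
  - intros t Ht. apply continuous_Cmult; [|apply continuous_const].
    apply (continuous_Ccomp h); [apply continuous_line|apply Hh, HK; assumption].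
Qed.

End Convex.

Lemma convex_cdisk z r : convex (fun s => Cmod (s - z) <= r).
Proof.
  intros a b t Ha Hb Ht.
  replace (a + t * (b - a) - z)%C with (RtoC (1 - t) * (a - z) + RtoC t * (b - z))%C
    by (rewrite RtoC_minus; ring).
  eapply Rle_trans; [apply Cmod_triangle|].
  rewrite !Cmod_mult, !Cmod_R, !Rabs_pos_eq by lra. nra.
Qed.

Lemma convex_disk z r : convex (disk z r).
Proof.
  intros a b t Ha Hb Ht. unfold disk in *.
  pose proof (convex_cdisk z (Rmax (Cmod (a - z)) (Cmod (b - z))) a b t
    (Rmax_l _ _) (Rmax_r _ _) Ht) as H. cbv beta in H.
  eapply Rle_lt_trans; [exact H|]. now apply Rmax_lub_lt.
Qed.

(** A primitive of the affine function with value [c] and slope [l] at [p]; it makes the tangent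
    part of a function integrate to zero around a triangle. *)
Lemma is_Cderive_affine (p l c z : C) :
  is_Cderive (fun s => c * s + l * ((s - p) * (s - p) / 2))%C z (c + (z - p) * l)%C.
Proof.
  apply is_Cderive_eps. intros eps He. pose proof (Cmod_ge_0 l) as Hl.
  exists (eps / (1 + Cmod l)). split; [apply Rdiv_lt_0_compat; lra|].
  intros w Hw. apply Rlt_div_r in Hw; [|lra].
  replace (c * w + l * ((w - p) * (w - p) / 2) - (c * z + l * ((z - p) * (z - p) / 2)) -
    (w - z) * (c + (z - p) * l))%C with (RtoC (1 / 2) * l * ((w - z) * (w - z)))%C.
  - rewrite !Cmod_mult, Cmod_R, Rabs_pos_eq by lra. pose proof (Cmod_ge_0 (w - z)). nra.
  - rewrite RtoC_div by lra. field.
Qed.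

(** * Goursat's theorem for triangles *)

Definition tri (h : C -> C) (a b c : C) : C := (seg h a b + seg h b c + seg h c a)%C.

(** The affine approximation at [p] has a primitive and drops out. What remains is at most [eps * D]
    on each of three sides of length at most [2 * D], whence the factor 6. *)
Lemma tri_small (h : C -> C) (p l : C) K : convex K -> (forall z, K z -> continuous h z) -> is_Cderive h p l ->
  forall eps, 0 < eps -> exists d, 0 < d /\ forall a b c D, K a -> K b -> K c ->
    Cmod (a - p) <= D -> Cmod (b - p) <= D -> Cmod (c - p) <= D -> D < d ->
    Cmod (tri h a b c) <= 6 * eps * D * D.
Proof.
  intros HK Hh Hp eps He.
  destruct (proj1 (is_Cderive_eps _ _ _) Hp eps He) as [d [Hd0 Hd]].
  exists d. split; [exact Hd0|]. intros a b c D Ka Kb Kc Da Db Dc HD.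
  set (g := (fun s => h p + (s - p) * l)%C).
  set (G := (fun s => h p * s + l * ((s - p) * (s - p) / 2))%C).
  assert (HG : forall z, K z -> is_Cderive G z (g z)) by (intros z _; apply is_Cderive_affine).
  assert (Hg : forall z, K z -> continuous g z).
  { intros z _. unfold g. apply continuous_Cplus; [apply continuous_const|].
    apply continuous_Cmult; [|apply continuous_const].
    apply continuous_Cminus; [apply continuous_id|apply continuous_const]. }
  assert (Hhg : forall z, K z -> continuous (fun z => h z - g z)%C z).
  { intros z Hz. apply continuous_Cminus; auto. }
  assert (E : tri h a b c = tri (fun z => h z - g z)%C a b c).
  { unfold tri. rewrite !(seg_minus K HK h g) by assumption.
    rewrite !(seg_primitive K HK G g) by assumption. ring. }
  assert (B : forall x y, K x -> K y -> Cmod (x - p) <= D -> Cmod (y - p) <= D ->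
     Cmod (seg (fun z => h z - g z)%C x y) <= 2 * eps * D * D).
  { intros x y Kx Ky Dx Dy.
    eapply Rle_trans; [apply (seg_bound K HK _ x y (eps * D) Hhg Kx Ky)|].
    - intros t Ht.
      pose proof (convex_cdisk p D x y t Dx Dy Ht) as Hs. cbv beta in Hs.
      unfold g. eapply Rle_trans; [|apply Rmult_le_compat_l; [lra|exact Hs]].
      replace (h (x + t * (y - x)) - (h p + (x + t * (y - x) - p) * l))%C with
        (h (x + t * (y - x)) - h p - (x + t * (y - x) - p) * l)%C by ring.
      apply Hd. lra.
    - assert (Cmod (y - x) <= 2 * D).
      { replace (y - x)%C with ((y - p) + - (x - p))%C by ring.
        eapply Rle_trans; [apply Cmod_triangle|]. rewrite Cmod_opp. lra. }
      replace (2 * eps * D * D) with (eps * D * (2 * D)) by ring.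
      apply Rmult_le_compat_l; [|assumption].
      pose proof (Cmod_ge_0 (x - p)). nra. }
  rewrite E. unfold tri.
  eapply Rle_trans; [apply Cmod_triangle|].
  eapply Rle_trans; [apply Rplus_le_compat_r, Cmod_triangle|].
  pose proof (B a b Ka Kb Da Db). pose proof (B b c Kb Kc Db Dc). pose proof (B c a Kc Ka Dc Da).
  lra.
Qed.

(** Any two of the intervals of radius [2 * d / 2 ^ n] around [u n] meet, so the supremum of their
    left ends lies in all of them. *)
Lemma geometric_limit (u : nat -> R) d :
  (forall n, Rabs (u (S n) - u n) <= d / 2 ^ n) ->
  exists l, forall n, Rabs (u n - l) <= 2 * d / 2 ^ n.
Proof.
  intros H.
  assert (Hp : forall n, 0 < 2 ^ n) by (intros n; apply pow_lt; lra).
  assert (Hs : forall n, d / 2 ^ S n = d / 2 ^ n / 2).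
  { intros n. simpl. pose proof (Hp n). field. lra. }
  assert (Hd : 0 <= d).
  { pose proof (H 0%nat). pose proof (Rabs_pos (u 1%nat - u 0%nat)). simpl in *. lra. }
  assert (H0 : forall n, 0 <= d / 2 ^ n).
  { intros n. apply Rmult_le_pos; [exact Hd|]. apply Rlt_le, Rinv_0_lt_compat, Hp. }
  assert (Hk : forall n k, Rabs (u (n + k)%nat - u n) <= 2 * (d / 2 ^ n) - 2 * (d / 2 ^ (n + k))).
  { intros n k. induction k as [|k IH].
    - rewrite Nat.add_0_r, Rminus_diag, Rabs_R0. lra.
    - rewrite Nat.add_succ_r, Hs. pose proof (H (n + k)%nat).
      replace (u (S (n + k)) - u n) with (u (S (n + k)) - u (n + k)%nat + (u (n + k)%nat - u n)) by ring.
      eapply Rle_trans; [apply Rabs_triang|]. lra. }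
  assert (Hle : forall n m, u n - 2 * (d / 2 ^ n) <= u m + 2 * (d / 2 ^ m)).
  { intros n m. pose proof (H0 n). pose proof (H0 m). destruct (Nat.le_ge_cases n m) as [L|L].
    - pose proof (Hk n (m - n)%nat) as K. replace (n + (m - n))%nat with m in K by lia.
      apply Rabs_le_between in K. lra.
    - pose proof (Hk m (n - m)%nat) as K. replace (m + (n - m))%nat with n in K by lia.
      apply Rabs_le_between in K. lra. }
  destruct (completeness (fun x => exists n, x = u n - 2 * (d / 2 ^ n))) as [l [Hl1 Hl2]].
  - exists (u 0%nat + 2 * (d / 2 ^ 0)). intros x [n ->]. apply Hle.
  - now exists (u 0%nat - 2 * (d / 2 ^ 0)), 0%nat.
  - exists l. intros n. replace (2 * d / 2 ^ n) with (2 * (d / 2 ^ n)) by (unfold Rdiv; ring).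
    apply Rabs_le. split.
    + assert (l <= u n + 2 * (d / 2 ^ n)); [|lra]. apply Hl2. intros x [m ->]. apply Hle.
    + assert (u n - 2 * (d / 2 ^ n) <= l); [|lra]. apply Hl1. now exists n.
Qed.

Lemma Cmod_le_sum (z : C) : Cmod z <= Rabs (fst z) + Rabs (snd z).
Proof.
  replace z with (RtoC (fst z) + RtoC (snd z) * Ci)%C at 1
    by (apply injective_projections; simpl; ring).
  eapply Rle_trans; [apply Cmod_triangle|].
  rewrite Cmod_mult, !Cmod_R, Cmod_Ci, Rmult_1_r. lra.
Qed.

Lemma Rabs_fst_le_Cmod (z : C) : Rabs (fst z) <= Cmod z.
Proof. exact (re_le_Cmod z). Qed.

Lemma Rabs_snd_le_Cmod (z : C) : Rabs (snd z) <= Cmod z.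
Proof. pose proof (Rmax_Cmod z). pose proof (Rmax_r (Rabs (fst z)) (Rabs (snd z))). lra. Qed.

Lemma Cgeometric_limit (u : nat -> C) d :
  (forall n, Cmod (u (S n) - u n) <= d / 2 ^ n) ->
  exists l, forall n, Cmod (u n - l) <= 4 * (d / 2 ^ n).
Proof.
  intros H.
  destruct (geometric_limit (fun n => fst (u n)) d) as [x Hx].
  { intros n. eapply Rle_trans; [apply (Rabs_fst_le_Cmod (u (S n) - u n)%C)|apply H]. }
  destruct (geometric_limit (fun n => snd (u n)) d) as [y Hy].
  { intros n. eapply Rle_trans; [apply (Rabs_snd_le_Cmod (u (S n) - u n)%C)|apply H]. }
  exists (x, y). intros n. eapply Rle_trans; [apply Cmod_le_sum|].
  pose proof (Hx n) as A. pose proof (Hy n) as B. simpl. unfold Rdiv in *.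
  change (Rabs (fst (u n) - x) + Rabs (snd (u n) - y) <= 4 * (d * / 2 ^ n)). lra.
Qed.

(** Each side of the middle triangle is also a side of a corner triangle, run in the opposite
    direction, so these contributions cancel. *)
Lemma tri_subdivide K h a b c : convex K -> (forall z, K z -> continuous h z) ->
  K a -> K b -> K c ->
  let m x y := (x + RtoC (1 / 2) * (y - x))%C in
  tri h a b c = (tri h a (m a b) (m c a) + tri h (m a b) b (m b c) + tri h (m c a) (m b c) c
                 + tri h (m b c) (m c a) (m a b))%C.
Proof.
  intros HK Hh Ka Kb Kc m.
  assert (Hm : forall x y, K x -> K y -> K (m x y)) by (intros x y Kx Ky; apply HK; [assumption..|lra]).
  assert (Hs : forall x y, K x -> K y -> seg h x y = (seg h x (m x y) + seg h (m x y) y)%C).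
  { intros x y Kx Ky. apply (seg_split K HK); auto. lra. }
  assert (Hab := Hm a b Ka Kb). assert (Hbc := Hm b c Kb Kc). assert (Hca := Hm c a Kc Ka).
  unfold tri. rewrite (Hs a b), (Hs b c), (Hs c a) by assumption.
  rewrite (seg_rev K HK h (m a b) (m c a)), (seg_rev K HK h (m b c) (m a b)),
    (seg_rev K HK h (m c a) (m b c)) by assumption.
  ring.
Qed.

Definition tri3 (h : C -> C) (T : C * C * C) : C := tri h (fst (fst T)) (snd (fst T)) (snd T).

(* One of the four half-size triangles carries at least a quarter of the integral. *)
Lemma tri_step K h : convex K -> (forall z, K z -> continuous h z) ->
  exists step : C * C * C -> C * C * C, forall a b c d,
    K a -> K b -> K c -> Cmod (b - a) <= d -> Cmod (c - b) <= d -> Cmod (a - c) <= d ->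
    exists a' b' c', step (a, b, c) = (a', b', c') /\ K a' /\ K b' /\ K c' /\
      Cmod (b' - a') <= d / 2 /\ Cmod (c' - b') <= d / 2 /\ Cmod (a' - c') <= d / 2 /\
      Cmod (a' - a) <= d /\ Cmod (tri h a b c) <= 4 * Cmod (tri h a' b' c').
Proof.
  intros HK Hh.
  set (m := fun x y : C => (x + RtoC (1 / 2) * (y - x))%C).
  set (good := fun T S => Rle_dec (Cmod (tri3 h T)) (4 * Cmod (tri3 h S))).
  (* The choice is a function of the triangle alone, made by deciding three inequalities, so that it
     can be iterated. *)
  exists (fun T => let '(a, b, c) := T in
    if good T (a, m a b, m c a) then (a, m a b, m c a)
    else if good T (m a b, b, m b c) then (m a b, b, m b c)
    else if good T (m c a, m b c, c) then (m c a, m b c, c)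
    else (m b c, m c a, m a b)).
  intros a b c d Ka Kb Kc Dab Dbc Dca.
  assert (Hm : forall x y, K x -> K y -> K (m x y)) by (intros x y Kx Ky; apply HK; [assumption..|lra]).
  assert (H2 : (RtoC (1 / 2) = 1 / 2)%C) by (apply RtoC_div; lra).
  assert (Hd0 : 0 <= d) by (pose proof (Cmod_ge_0 (b - a)); lra).
  assert (Hhalf : forall z w, (z = RtoC (1 / 2) * w)%C -> Cmod w <= d -> Cmod z <= d / 2).
  { intros z w -> Hw. rewrite Cmod_mult, Cmod_R, Rabs_pos_eq by lra. lra. }
  assert (Hopp : forall x y, Cmod (x - y) <= d -> Cmod (y - x) <= d).
  { intros x y H. replace (y - x)%C with (- (x - y))%C by ring. now rewrite Cmod_opp. }
  pose proof (tri_subdivide K h a b c HK Hh Ka Kb Kc) as E. cbv zeta in E. fold m in E.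
  unfold good, tri3; simpl.
  destruct (Rle_dec _ _) as [G1|G1]; [|destruct (Rle_dec _ _) as [G2|G2];
    [|destruct (Rle_dec _ _) as [G3|G3]]];
    do 3 eexists; (split; [reflexivity|]);
    (do 3 (split; [auto|])); unfold m; rewrite ?H2.
  - repeat split; [apply (Hhalf _ (b - a)%C)|apply (Hhalf _ (c - b)%C)|apply (Hhalf _ (a - c)%C)| |];
      rewrite ?H2; auto; try field.
    + replace (a - a)%C with (RtoC 0) by ring. rewrite Cmod_0. exact Hd0.
    + unfold m in G1. rewrite ?H2 in G1. exact G1.
  - repeat split; [apply (Hhalf _ (b - a)%C)|apply (Hhalf _ (c - b)%C)|apply (Hhalf _ (a - c)%C)| |];
      rewrite ?H2; auto; try field.
    + apply Rle_trans with (d / 2); [|lra]. apply (Hhalf _ (b - a)%C); rewrite ?H2; [field|auto].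
    + unfold m in G2. rewrite ?H2 in G2. exact G2.
  - repeat split; [apply (Hhalf _ (b - a)%C)|apply (Hhalf _ (c - b)%C)|apply (Hhalf _ (a - c)%C)| |];
      rewrite ?H2; auto; try field.
    + apply Rle_trans with (d / 2); [|lra]. apply (Hhalf _ (c - a)%C); rewrite ?H2; [field|auto].
    + unfold m in G3. rewrite ?H2 in G3. exact G3.
  - repeat split; [apply (Hhalf _ (a - b)%C)|apply (Hhalf _ (b - c)%C)|apply (Hhalf _ (c - a)%C)| |];
      rewrite ?H2; auto; try field.
    (* The first vertex of the middle triangle is the midpoint of [b] and [c]; its distance to [a]
       is at most the mean of two side lengths. *)
    + replace (b + 1 / 2 * (c - b) - a)%C with (RtoC (1 / 2) * ((b - a) + (c - a)))%C
        by (rewrite H2; field).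
      rewrite Cmod_mult, Cmod_R, Rabs_pos_eq by lra.
      pose proof (Cmod_triangle (b - a) (c - a)). pose proof (Hopp _ _ Dca). lra.
    (* If no corner triangle carries a quarter of the integral, the three together carry less than
       three quarters, and the middle one has the rest. *)
    + apply Rnot_le_lt in G1. apply Rnot_le_lt in G2. apply Rnot_le_lt in G3.
      assert (B : Cmod (tri h a b c) <= Cmod (tri h a (m a b) (m c a)) +
        Cmod (tri h (m a b) b (m b c)) + Cmod (tri h (m c a) (m b c) c) +
        Cmod (tri h (m b c) (m c a) (m a b))).
      { rewrite E at 1. eapply Rle_trans; [apply Cmod_triangle|]. apply Rplus_le_compat_r.
        eapply Rle_trans; [apply Cmod_triangle|]. apply Rplus_le_compat_r. apply Cmod_triangle. }
      unfold m in *. rewrite ?H2 in *. lra.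
Qed.

(** The triangles of [tri_step] shrink to a point [p], where [tri_small] makes the integral small
    compared with the squared size, while each step loses only a factor 4. The disk is closed so
    that [p] belongs to it. *)
Theorem Goursat h z r a b c : (forall s, Cmod (s - z) <= r -> cdiff h s) ->
  Cmod (a - z) <= r -> Cmod (b - z) <= r -> Cmod (c - z) <= r -> tri h a b c = 0%C.
Proof.
  intros Hh Ka Kb Kc.
  set (K := fun s => Cmod (s - z) <= r).
  assert (HK : convex K) by apply convex_cdisk.
  assert (Hc : forall s, K s -> continuous h s) by (intros s Hs; apply cdiff_continuous; auto).
  destruct (tri_step K h HK Hc) as [step Hstep].
  set (d := Cmod (b - a) + Cmod (c - b) + Cmod (a - c)).
  pose proof (Cmod_ge_0 (b - a)). pose proof (Cmod_ge_0 (c - b)). pose proof (Cmod_ge_0 (a - c)).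
  set (T := fun n => Nat.iter n step (a, b, c)).
  assert (Hp : forall n, 0 < 2 ^ n) by (intros n; apply pow_lt; lra).
  assert (HT : forall n, exists x y w, T n = (x, y, w) /\ K x /\ K y /\ K w /\
    Cmod (y - x) <= d / 2 ^ n /\ Cmod (w - y) <= d / 2 ^ n /\ Cmod (x - w) <= d / 2 ^ n /\
    Cmod (tri h a b c) <= 2 ^ n * 2 ^ n * Cmod (tri h x y w) /\
    Cmod (fst (fst (T (S n))) - x) <= d / 2 ^ n).
  { assert (Hnext : forall n x y w, T n = (x, y, w) -> K x -> K y -> K w ->
      Cmod (y - x) <= d / 2 ^ n -> Cmod (w - y) <= d / 2 ^ n -> Cmod (x - w) <= d / 2 ^ n ->
      Cmod (fst (fst (T (S n))) - x) <= d / 2 ^ n).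
    { intros n x y w E Kx Ky Kw D1 D2 D3. change (T (S n)) with (step (T n)). rewrite E.
      destruct (Hstep x y w _ Kx Ky Kw D1 D2 D3) as (x' & y' & w' & E' & _ & _ & _ & _ & _ & _ & Q & _). rewrite E'.
      exact Q. }
    intros n. induction n as [|n IH].
    - exists a, b, c. assert (T 0%nat = (a, b, c)) by reflexivity.
      assert (d / 2 ^ 0 = d) as E by (simpl; field). repeat split; try assumption;
        rewrite ?E; try (unfold d; lra).
      rewrite <- E. apply (Hnext 0%nat a b c); try assumption; rewrite E; unfold d; lra.
    - destruct IH as (x & y & w & E & Kx & Ky & Kw & D1 & D2 & D3 & B & _).
      destruct (Hstep x y w _ Kx Ky Kw D1 D2 D3)
        as (x' & y' & w' & E' & Kx' & Ky' & Kw' & D1' & D2' & D3' & _ & B').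
      assert (Q : d / 2 ^ n / 2 = d / 2 ^ S n) by (simpl; pose proof (Hp n); field; lra).
      rewrite Q in D1', D2', D3'.
      assert (E2 : T (S n) = (x', y', w')) by (change (T (S n)) with (step (T n)); now rewrite E).
      exists x', y', w'. repeat split; try assumption.
      + eapply Rle_trans; [exact B|]. simpl. pose proof (Hp n). nra.
      + now apply (Hnext (S n) x' y' w'). }
  destruct (Cgeometric_limit (fun n => fst (fst (T n))) d) as [p Hlim].
  { intros n. destruct (HT n) as (x & y & w & E & _ & _ & _ & _ & _ & _ & _ & Q).
    rewrite E. exact Q. }
  assert (Hsmall : forall e, 0 < e -> exists n, d / 2 ^ n < e).
  { intros e He. destruct (pow_lt_1_zero (1 / 2)) with (y := e / (d + 1)) as [n Hn].
    - rewrite Rabs_pos_eq; lra.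
    - apply Rdiv_lt_0_compat; unfold d; lra.
    - exists n. specialize (Hn n (Nat.le_refl n)).
      rewrite Rabs_pos_eq in Hn by (apply pow_le; lra).
      unfold Rdiv in Hn at 1. rewrite Rmult_1_l, pow_inv in Hn.
      apply Rlt_div_r in Hn; [|unfold d; lra].
      pose proof (Rinv_0_lt_compat _ (Hp n)). unfold Rdiv. lra. }
  assert (Kp : K p).
  { apply le_epsilon. intros e He. destruct (Hsmall (e / 4)) as [n Hn]; [lra|].
    destruct (HT n) as (x & y & w & E & Kx & _).
    pose proof (Hlim n) as L. rewrite E in L. simpl in L.
    replace (p - z)%C with (- (x - p) + (x - z))%C by ring.
    eapply Rle_trans; [apply Cmod_triangle|]. rewrite Cmod_opp. unfold K in Kx. lra. }
  destruct (Hh p Kp) as [l Hl].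
  (* First vertices lie within [4 * (d / 2 ^ n)] of [p] and sides are at most [d / 2 ^ n], so all
     vertices lie within five times that length. Then 150 is 6 times 25, and the factors 4^n
     cancel. *)
  assert (Hz : forall eps, 0 < eps -> Cmod (tri h a b c) <= 150 * eps * d * d).
  { intros eps He.
    destruct (tri_small h p l K HK Hc Hl eps He) as [e [He0 Hsm]].
    destruct (Hsmall (e / 5)) as [n Hn]; [lra|].
    destruct (HT n) as (x & y & w & E & Kx & Ky & Kw & D1 & D2 & D3 & B & _).
    pose proof (Hlim n) as L. rewrite E in L. simpl in L.
    assert (Q : Cmod (tri h x y w) <= 6 * eps * (5 * (d / 2 ^ n)) * (5 * (d / 2 ^ n))).
    { apply Hsm; try assumption; try lra.
      - pose proof (Cmod_ge_0 (x - p)). lra.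
      - replace (y - p)%C with ((y - x) + (x - p))%C by ring.
        eapply Rle_trans; [apply Cmod_triangle|]. lra.
      - replace (w - p)%C with (- (x - w) + (x - p))%C by ring.
        eapply Rle_trans; [apply Cmod_triangle|]. rewrite Cmod_opp. lra. }
    eapply Rle_trans; [exact B|].
    apply Rmult_le_compat_l with (r := 2 ^ n * 2 ^ n) in Q.
    - eapply Rle_trans; [exact Q|]. right. pose proof (Hp n). field. lra.
    - pose proof (Hp n). nra. }
  apply Cmod_eq_0. apply Rle_antisym; [|apply Cmod_ge_0].
  apply le_epsilon. intros e He. rewrite Rplus_0_l.
  assert (Hd : 0 <= d) by (unfold d; lra).
  eapply Rle_trans; [apply (Hz (e / (150 * (d * d + 1))))|].
  - apply Rdiv_lt_0_compat; nra.
  - replace (150 * (e / (150 * (d * d + 1))) * d * d) with (e * (d * d / (d * d + 1)))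
      by (field; nra).
    assert (d * d / (d * d + 1) <= 1); [|nra]. apply Rle_div_l; nra.
Qed.

(** * Primitives in a disk, and integrals along paths inside it *)

Section Disk.
Context (h : C -> C) (z : C) (rho : R) (Hh : forall s, disk z rho s -> cdiff h s).

Lemma disk_continuous s : disk z rho s -> continuous h s.
Proof. intros Hs. now apply cdiff_continuous, Hh. Qed.

Lemma disk_seg_rev a b : disk z rho a -> disk z rho b -> seg h b a = (- seg h a b)%C.
Proof. intros. apply (seg_rev _ (convex_disk z rho)); auto using disk_continuous. Qed.

(** Goursat's theorem in the closed disk that reaches to the farthest of the three points. *)
Lemma disk_seg_add a b c : disk z rho a -> disk z rho b -> disk z rho c ->
  (seg h a b + seg h b c)%C = seg h a c.
Proof.
  intros Ha Hb Hc.
  set (r := Rmax (Rmax (Cmod (a - z)) (Cmod (b - z))) (Cmod (c - z))).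
  assert (Hr : r < rho) by (unfold r; repeat apply Rmax_lub_lt; assumption).
  assert (Hra : Cmod (a - z) <= r) by (eapply Rle_trans; [|apply Rmax_l]; apply Rmax_l).
  assert (Hrb : Cmod (b - z) <= r) by (eapply Rle_trans; [|apply Rmax_l]; apply Rmax_r).
  assert (Hrc : Cmod (c - z) <= r) by apply Rmax_r.
  assert (E : tri h a b c = 0%C).
  { apply (Goursat h z r); try assumption. intros s Hs. apply Hh. unfold disk. lra. }
  unfold tri in E. rewrite (disk_seg_rev a c) in E by assumption.
  rewrite <- (Cplus_0_r (seg h a c)), <- E. ring.
Qed.

Lemma disk_seg_refl a : disk z rho a -> seg h a a = 0%C.
Proof.
  intros Ha. pose proof (disk_seg_add a a a Ha Ha Ha) as E.
  rewrite <- (Cplus_opp_r (seg h a a)). rewrite <- E at 2. ring.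
Qed.

Lemma disk_primitive a s : disk z rho a -> disk z rho s ->
  is_Cderive (fun w => seg h a w) s (h s).
Proof.
  intros Ha Hs. apply is_Cderive_eps. intros eps He.
  destruct (proj1 (locally_C_eps s _) (proj1 (continuous_C_eps h s) (disk_continuous s Hs) eps He))
    as [d [Hd0 Hd]].
  exists (Rmin d (rho - Cmod (s - z))). unfold disk in Hs.
  split; [apply Rmin_pos; lra|]. intros w Hw.
  assert (W1 := Rlt_le_trans _ _ _ Hw (Rmin_l _ _)).
  assert (W2 := Rlt_le_trans _ _ _ Hw (Rmin_r _ _)).
  assert (Dw : disk z rho w).
  { unfold disk. replace (w - z)%C with ((w - s) + (s - z))%C by ring.
    eapply Rle_lt_trans; [apply Cmod_triangle|]. lra. }
  rewrite <- (disk_seg_add a s w) by assumption.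
  assert (Hline : forall t, 0 <= t <= 1 -> disk z rho (s + RtoC t * (w - s))%C)
    by (intros t Ht; now apply convex_disk).
  set (g := fun _ : C => h s).
  (* Subtracting the constant [h s], whose integral is known exactly, leaves an integrand of modulus
     at most [eps] on the segment. *)
  assert (E : seg g s w = ((w - s) * h s)%C).
  { rewrite (seg_primitive _ (convex_disk z rho) (fun x => h s * x + 0 * ((x - s) * (x - s) / 2))%C);
      try assumption; try ring.
    - intros x _. pose proof (is_Cderive_affine s 0 (h s) x) as A.
      replace (h s + (x - s) * 0)%C with (h s) in A by ring. exact A.
    - intros x _. apply continuous_const. }
  replace (seg h a s + seg h s w - seg h a s - (w - s) * h s)%C with (seg h s w - seg g s w)%C
    by (rewrite E; ring).
  rewrite <- (seg_minus _ (convex_disk z rho)); try assumption;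
    try (intros; apply continuous_const); try apply disk_continuous.
  apply (seg_bound _ (convex_disk z rho)); try assumption.
  - intros x Hx. apply continuous_Cminus; [now apply disk_continuous|apply continuous_const].
  - intros t Ht. apply Rlt_le, Hd.
    replace (s + t * (w - s) - s)%C with (RtoC t * (w - s))%C by ring.
    rewrite Cmod_mult, Cmod_R, Rabs_pos_eq by lra. pose proof (Cmod_ge_0 (w - s)). nra.
Qed.

Lemma disk_path_integral (p dp : R -> C) s t l : s <= t ->
  (forall x, s <= x <= t -> disk z rho (p x) /\ is_Rderive p x (dp x)) ->
  is_CRInt (fun x => h (p x) * dp x)%C s t l ->
  (forall x, s <= x <= t -> continuous dp x) ->
  l = seg h (p s) (p t).
Proof.
  intros Hst Hp Hl Hdp.
  assert (Ds : disk z rho (p s)) by (apply Hp; lra).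
  assert (Dt : disk z rho (p t)) by (apply Hp; lra).
  apply (is_CRInt_inj _ _ _ _ _ Hl).
  replace (seg h (p s) (p t)) with (seg h (p s) (p t) - seg h (p s) (p s))%C
    by (rewrite disk_seg_refl by assumption; ring).
  apply (is_CRInt_deriv (fun x => seg h (p s) (p x))); [assumption| |].
  - intros x Hx. destruct (Hp x Hx) as [Dx Dpx].
    apply (is_Rderive_comp (fun w => seg h (p s) w)); [|assumption]. now apply disk_primitive.
  - intros x Hx. destruct (Hp x Hx) as [Dx Dpx].
    apply continuous_Cmult; [|auto].
    apply (continuous_Ccomp h); [now apply is_Rderive_continuous in Dpx|now apply disk_continuous].
Qed.

End Disk.

(** * Homotopy invariance of integrals *)

Definition square (p : R * R) : Prop := I01 (fst p) /\ I01 (snd p).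

(** Inside a disk contained in [U] a holomorphic function has a primitive, so segment integrals
    between points of [X] add up. [X] will be the image of a small piece of a path or of a
    homotopy. *)
Definition near_disk (U : C -> Prop) (X : C -> Prop) : Prop :=
  exists z rho, (forall w, disk z rho w -> U w) /\ (forall w, X w -> disk z rho w).

Lemma open_disk (U : C -> Prop) z : open U -> U z ->
  exists rho, 0 < rho /\ forall w, disk z rho w -> U w.
Proof.
  intros HU Hz. destruct (proj1 (locally_C_eps z U) (HU z Hz)) as [d [Hd0 Hd]].
  now exists d.
Qed.

(** Lebesgue's number lemma on the compact square, for the cover by preimages of disks contained in
    [U]. *)
Lemma square_lebesgue (U : C -> Prop) (H : R * R -> C) : open U ->
  continuous_on square H -> (forall p, square p -> U (H p)) ->
  exists d, 0 < d /\ forall s t, I01 s -> I01 t ->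
    near_disk U (fun w => exists s' t', I01 s' /\ I01 t' /\
      Rabs (s' - s) < d /\ Rabs (t' - t) < d /\ w = H (s', t')).
Proof.
  intros HU HH HHU.
  assert (Hloc : forall s t, exists d : posreal, I01 s -> I01 t ->
    exists rho, (forall w, disk (H (s, t)) rho w -> U w) /\
    forall s' t', I01 s' -> I01 t' -> Rabs (s' - s) < 2 * d -> Rabs (t' - t) < 2 * d ->
      disk (H (s, t)) rho (H (s', t'))).
  { intros s t. destruct (Classical_Prop.classic (I01 s /\ I01 t)) as [[Is It]|N].
    2: { exists (mkposreal 1 Rlt_0_1). intros; exfalso; tauto. }
    destruct (open_disk U (H (s, t)) HU (HHU (s, t) (conj Is It))) as [rho [Hrho Hdisk]].
    pose proof (HH (s, t) (conj Is It) (fun w => disk (H (s, t)) rho w)) as Hc.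
    destruct Hc as [d Hd].
    { apply locally_C_eps. exists rho. split; [assumption|]. intros w Hw; exact Hw. }
    (* Half of the local radius is recorded, so that two successive displacements smaller than it
       stay in the same disk. *)
    exists (pos_div_2 d). intros _ _. exists rho. split; [assumption|].
    intros s' t' Is' It' Ds Dt. apply (Hd (s', t')).
    - simpl in Ds, Dt. replace (2 * (d / 2)) with (pos d) in * by field. now split.
    - now split. }
  set (delta := fun s t => proj1_sig (constructive_indefinite_description _ (Hloc s t))).
  destruct (compactness_value_2d 0 1 0 1 delta) as [d Hd].
  exists d. split; [apply cond_pos|]. intros s t Is It.
  (* Compactness provides the nearby centre under a double negation. *)
  destruct (Classical_Prop.NNPP _ (Hd s t Is It)) as (u & v & Iu & Iv & Du & Dv & Dd).
  unfold delta in *. destruct (constructive_indefinite_description _ (Hloc u v)) as [e He].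
  simpl in *. destruct (He Iu Iv) as [rho [H1 H2]].
  exists (H (u, v)), rho. split; [assumption|].
  intros w (s' & t' & Is' & It' & Ds & Dt & ->). apply H2; try assumption.
  - replace (s' - u) with ((s' - s) + (s - u)) by ring.
    eapply Rle_lt_trans; [apply Rabs_triang|]. lra.
  - replace (t' - v) with ((t' - t) + (t - v)) by ring.
    eapply Rle_lt_trans; [apply Rabs_triang|]. lra.
Qed.

Lemma continuous_on_I01_eps (p : R -> C) : continuous_on I01 p <->
  forall t, I01 t -> forall eps, 0 < eps -> exists d, 0 < d /\
    forall s, I01 s -> Rabs (s - t) < d -> Cmod (p s - p t) < eps.
Proof.
  split.
  - intros H t It eps He. destruct (H t It (fun w => Cmod (w - p t) < eps)) as [d Hd].
    { apply locally_C_eps. exists eps. split; [assumption|]. tauto. }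
    exists d. split; [apply cond_pos|]. intros s Is Ds. now apply Hd.
  - intros H t It P HP. apply locally_C_eps in HP. destruct HP as [e [He Pe]].
    destruct (H t It e He) as [d [Hd0 Hd]].
    exists (mkposreal d Hd0). intros s Ds Is. apply Pe, Hd; assumption.
Qed.

Lemma path_lebesgue (U : C -> Prop) (p : R -> C) : open U ->
  continuous_on I01 p -> (forall t, I01 t -> U (p t)) ->
  exists d, 0 < d /\ forall t, I01 t ->
    near_disk U (fun w => exists t', I01 t' /\ Rabs (t' - t) < d /\ w = p t').
Proof.
  intros HU Hp HpU.
  destruct (square_lebesgue U (fun q => p (snd q)) HU) as [d [Hd0 Hd]].
  - intros [s t] [Is It] P HP. destruct (Hp t It P HP) as [e He].
    exists e. intros [s' t'] [_ Dt] [_ It']. now apply He.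
  - intros [s t] [_ It]. now apply HpU.
  - exists d. split; [assumption|]. intros t It.
    destruct (Hd t t It It) as (z & rho & H1 & H2).
    exists z, rho. split; [assumption|]. intros w (t' & It' & Dt & ->).
    apply H2. exists t', t'. tauto.
Qed.

Section Lift.
Context (U : C -> Prop) (h : C -> C) (HU : open U) (Hh : forall z, U z -> cdiff h z).

(* [F] is the integral of [h] along the merely continuous path [p]. *)
Definition lift (p F : R -> C) : Prop :=
  continuous_on I01 p /\ (forall t, I01 t -> U (p t)) /\
  exists d, 0 < d /\ forall s t, I01 s -> I01 t -> Rabs (t - s) < d ->
    (F t - F s = seg h (p s) (p t))%C.

Lemma near_seg_add (X : C -> Prop) a b c : near_disk U X -> X a -> X b -> X c ->
  (seg h a b + seg h b c)%C = seg h a c.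
Proof.
  intros (z & rho & H1 & H2) Xa Xb Xc.
  apply (disk_seg_add h z rho); auto.
Qed.

Lemma seg_refl a : U a -> seg h a a = 0%C.
Proof.
  intros Ha. destruct (open_disk U a HU Ha) as [rho [Hrho Hd]].
  apply (disk_seg_refl h a rho); auto. unfold disk.
  replace (a - a)%C with (RtoC 0) by ring. now rewrite Cmod_0.
Qed.

Fixpoint csum (f : nat -> C) (n : nat) : C :=
  match n with O => 0%C | S m => (csum f m + f m)%C end.

Lemma csum_S f n : csum f (S n) = (csum f n + f n)%C.
Proof. reflexivity. Qed.

Lemma grid_pt N k : (k <= N)%nat -> (0 < N)%nat -> I01 (INR k / INR N).
Proof.
  intros Hk HN. apply le_INR in Hk. apply lt_INR in HN. simpl in HN.
  pose proof (pos_INR k). split.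
  - apply Rmult_le_pos; [assumption|]. apply Rlt_le, Rinv_0_lt_compat; assumption.
  - apply Rle_div_l; lra.
Qed.

Lemma grid_step N k d : (0 < N)%nat -> / INR N < d ->
  Rabs (INR (S k) / INR N - INR k / INR N) < d.
Proof.
  intros HN Hd. apply lt_INR in HN. simpl INR in HN.
  replace (INR (S k) / INR N - INR k / INR N) with (/ INR N).
  - rewrite Rabs_pos_eq; [assumption|]. apply Rlt_le, Rinv_0_lt_compat; assumption.
  - rewrite S_INR. field. lra.
Qed.

(** The increments of [F] telescope along a mesh finer than [d]. *)
Lemma lift_csum p F d N : (0 < N)%nat -> / INR N < d ->
  (forall s t, I01 s -> I01 t -> Rabs (t - s) < d -> (F t - F s = seg h (p s) (p t))%C) ->
  (F 1 - F 0 = csum (fun k => seg h (p (INR k / INR N)%R) (p (INR (S k) / INR N)%R)) N)%C.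
Proof.
  intros HN Hd HF.
  assert (Hk : forall k, (k <= N)%nat -> (F (INR k / INR N)%R - F 0 =
    csum (fun k => seg h (p (INR k / INR N)%R) (p (INR (S k) / INR N)%R)) k)%C).
  { induction k as [|k IH]; intros Hk.
    - simpl INR. replace (0 / INR N) with 0 by (unfold Rdiv; ring). simpl. ring.
    - rewrite csum_S, <- IH by lia. rewrite <- HF.
      + ring.
      + apply grid_pt; lia.
      + now apply grid_pt.
      + now apply grid_step. }
  pose proof (lt_INR _ _ HN) as HN'. simpl in HN'.
  rewrite <- (Hk N (Nat.le_refl N)). now replace (INR N / INR N) with 1 by (field; lra).
Qed.

(** On a grid so fine that every cell maps into a disk in [U], the two ways around a cell give the
    same integral. Adding up a row of cells compares consecutive grid loops; the contributions of
    the two ends of the row agree because each loop closes up. The base point may move with the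
    first parameter. *)
Theorem homotopy_invariance (H : R * R -> C) F0 F1 :
  continuous_on square H -> (forall p, square p -> U (H p)) ->
  (forall s, I01 s -> H (s, 0) = H (s, 1)) ->
  lift (fun t => H (0, t)) F0 -> lift (fun t => H (1, t)) F1 ->
  (F0 1 - F0 0 = F1 1 - F1 0)%C.
Proof.
  intros HH HHU Hloop (_ & _ & d0 & Hd0 & L0) (_ & _ & d1 & Hd1 & L1).
  destruct (square_lebesgue U H HU HH HHU) as [d [Hd Hdisk]].
  destruct (archimed_cor1 (Rmin d (Rmin d0 d1))) as [N [HN1 HN]];
    [repeat apply Rmin_pos; assumption|].
  assert (N0 : / INR N < d0).
  { eapply Rlt_le_trans; [exact HN1|]. eapply Rle_trans; [apply Rmin_r|]. apply Rmin_l. }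
  assert (N1 : / INR N < d1).
  { eapply Rlt_le_trans; [exact HN1|]. eapply Rle_trans; [apply Rmin_r|]. apply Rmin_r. }
  assert (Nd : / INR N < d) by (eapply Rlt_le_trans; [exact HN1|]; apply Rmin_l).
  rewrite (lift_csum _ _ _ N HN N0 L0), (lift_csum _ _ _ N HN N1 L1).
  set (P := fun j k : nat => H (INR j / INR N, INR k / INR N)).
  assert (Hsq : forall j k, (j < N)%nat -> (k < N)%nat ->
    (seg h (P j k) (P j (S k)) + seg h (P j (S k)) (P (S j) (S k)) =
     seg h (P j k) (P (S j) k) + seg h (P (S j) k) (P (S j) (S k)))%C).
  { intros j k Hj Hk.
    assert (Ij := grid_pt N j ltac:(lia) HN). assert (Ik := grid_pt N k ltac:(lia) HN).
    assert (Isj := grid_pt N (S j) Hj HN). assert (Isk := grid_pt N (S k) Hk HN).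
    assert (Dj := grid_step N j d HN Nd). assert (Dk := grid_step N k d HN Nd).
    assert (Rabs (INR j / INR N - INR j / INR N) < d) by (now rewrite Rminus_diag, Rabs_R0).
    assert (Rabs (INR k / INR N - INR k / INR N) < d) by (now rewrite Rminus_diag, Rabs_R0).
    pose proof (Hdisk _ _ Ij Ik) as HX.
    rewrite !(near_seg_add _ _ _ _ HX); try reflexivity; unfold P;
      refine (ex_intro _ _ (ex_intro _ _ (conj _ (conj _ (conj _ (conj _ eq_refl))))));
      eassumption. }
  assert (Hrow : forall j, (j < N)%nat -> forall n, (n <= N)%nat ->
    (csum (fun k => seg h (P j k) (P j (S k))) n + seg h (P j n) (P (S j) n) =
     seg h (P j 0%nat) (P (S j) 0%nat) + csum (fun k => seg h (P (S j) k) (P (S j) (S k))) n)%C).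
  { intros j Hj. induction n as [|n IH]; intros Hn.
    - simpl. ring.
    - rewrite !csum_S, <- Cplus_assoc, Hsq by lia. rewrite Cplus_assoc, IH by lia. ring. }
  assert (N' : 0 < INR N) by (apply lt_INR in HN; exact HN).
  assert (Hside : forall j, (j <= N)%nat -> P j N = P j 0%nat).
  { intros j Hj. unfold P. replace (INR N / INR N) with 1 by (field; lra).
    replace (INR 0 / INR N) with 0 by (simpl; field; lra).
    symmetry. apply Hloop. now apply grid_pt. }
  assert (Hall : forall j, (j <= N)%nat ->
    csum (fun k => seg h (P 0%nat k) (P 0%nat (S k))) N =
    csum (fun k => seg h (P j k) (P j (S k))) N).
  { induction j as [|j IH]; intros Hj; [reflexivity|]. rewrite IH by lia.
    pose proof (Hrow j Hj N (Nat.le_refl N)) as E.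
    rewrite (Hside j), (Hside (S j)) in E by lia.
    apply (f_equal (fun x => x - seg h (P j 0%nat) (P (S j) 0%nat))%C) in E.
    ring_simplify in E. exact E. }
  pose proof (Hall N (Nat.le_refl N)) as E. unfold P in E.
  replace (INR N / INR N) with 1 in E by (field; lra).
  replace (INR 0 / INR N) with 0 in E by (simpl; field; lra). exact E.
Qed.

Lemma C1_continuous_on p dp x y : C1_path U x y p dp -> continuous_on I01 p.
Proof.
  intros [Hp _] t It P HP.
  destruct (Hp t It) as (_ & Hd & _). apply is_Rderive_continuous in Hd.
  destruct (Hd P HP) as [e He]. exists e. intros s Hs _. now apply He.
Qed.

Lemma C1_integrand_continuous p dp x y : C1_path U x y p dp ->
  forall t, I01 t -> continuous (fun t => h (p t) * dp t)%C t.
Proof.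
  intros [Hp _] t It. destruct (Hp t It) as (Ut & Hd & Hc).
  apply continuous_Cmult; [|assumption].
  apply (continuous_Ccomp h); [now apply is_Rderive_continuous in Hd|].
  now apply cdiff_continuous, Hh.
Qed.

(** The integral up to time t is a lift: a short piece of the path stays in a disk in [U], where the
    integral depends on the end points only. *)
Lemma C1_lift p dp x y J : C1_path U x y p dp ->
  is_CRInt (fun t => h (p t) * dp t)%C 0 1 J ->
  exists F, lift p F /\ F 0 = 0%C /\ F 1 = J.
Proof.
  intros Hp HJ. exists (fun t => CRInt (fun t => h (p t) * dp t)%C 0 t).
  pose proof (C1_integrand_continuous p dp x y Hp) as Hc.
  assert (Hex : forall s t, I01 s -> I01 t -> s <= t -> ex_CRInt (fun t => h (p t) * dp t)%C s t).
  { intros s t Is It Hst. apply ex_CRInt_continuous; [assumption|].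
    intros r Hr. apply Hc. unfold I01 in *. lra. }
  repeat split.
  - exact (C1_continuous_on p dp x y Hp).
  - intros t It. now apply (proj1 Hp).
  - destruct (path_lebesgue U p HU (C1_continuous_on p dp x y Hp)) as [d [Hd0 Hd]].
    { intros t It. now apply (proj1 Hp). }
    exists d. split; [assumption|].
    assert (Hle : forall s t, I01 s -> I01 t -> s <= t -> Rabs (t - s) < d ->
      (CRInt (fun t => h (p t) * dp t)%C 0 t - CRInt (fun t => h (p t) * dp t)%C 0 s
       = seg h (p s) (p t))%C).
    { intros s t Is It Hst Dst.
      assert (Is0 := Hex 0 s ltac:(unfold I01; lra) Is ltac:(unfold I01 in *; lra)).
      assert (Ist := Hex s t Is It Hst).
      rewrite <- (RInt_Chasles (V := C_R_CompleteNormedModule) _ 0 s t Is0 Ist).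
      destruct (Hd s Is) as (z & rho & H1 & H2).
      transitivity (CRInt (fun t => h (p t) * dp t)%C s t).
      - change plus with Cplus. ring.
      - apply (disk_path_integral h z rho) with (dp := dp); auto.
        + intros r Hr. assert (Ir : I01 r) by (unfold I01 in *; lra). split.
          * apply H2. exists r. repeat split; try apply Ir.
            rewrite Rabs_pos_eq in * by lra. lra.
          * now apply (proj1 Hp).
        + now apply CRInt_correct.
        + intros r Hr. apply (proj1 Hp). unfold I01 in *; lra. }
    (* For [t < s] both sides change sign; the segment is reversed within one disk. *)
    intros s t Is It Dst. destruct (Rle_dec s t) as [L|L]; [now apply Hle|].
    apply Rnot_le_lt in L.
    destruct (Hd s Is) as (z & rho & H1 & H2).
    rewrite (disk_seg_rev h z rho (fun w Hw => Hh w (H1 w Hw)) (p t) (p s)).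
    + rewrite <- (Hle t s It Is) by (try lra; rewrite Rabs_minus_sym; assumption). ring.
    + apply H2. exists t. tauto.
    + apply H2. exists s. rewrite Rminus_diag, Rabs_R0. tauto.
  - apply is_CRInt_unique. apply (is_RInt_point (V := C_R_NormedModule)).
  - now apply is_CRInt_unique.
Qed.

Lemma lift_const x : U x -> lift (fun _ => x) (fun _ => 0%C).
Proof.
  intros Ux. split; [|split].
  - apply continuous_on_I01_eps. intros t _ eps He. exists 1. split; [lra|]. intros s _ _.
    replace (x - x)%C with (RtoC 0) by ring. now rewrite Cmod_0.
  - auto.
  - exists 1. split; [lra|]. intros s t _ _ _. rewrite seg_refl by assumption. ring.
Qed.

(** The constant [c] is left free so that the reversed lift can be made to start at 0, as
    [lift_concat] asks. *)
Lemma lift_reverse p F c : lift p F -> lift (fun t => p (1 - t)%R) (fun t => F (1 - t)%R - c)%C.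
Proof.
  intros (Hp & HpU & d & Hd0 & Hd).
  assert (I : forall t, I01 t -> I01 (1 - t)) by (unfold I01; intros; lra).
  assert (D : forall s t, Rabs (1 - t - (1 - s)) = Rabs (t - s)).
  { intros s t. replace (1 - t - (1 - s)) with (s - t) by ring. apply Rabs_minus_sym. }
  split; [|split].
  - apply continuous_on_I01_eps. intros t It eps He.
    destruct (proj1 (continuous_on_I01_eps p) Hp (1 - t) (I t It) eps He) as [e [He0 Hee]].
    exists e. split; [assumption|]. intros s Is Ds. apply Hee; [auto|]. now rewrite D.
  - auto.
  - exists d. split; [assumption|]. intros s t Is It Dst. rewrite <- Hd; auto.
    + ring.
    + now rewrite D.
Qed.

(** The clamped parameters write the concatenation as one formula, continuous as a sum: on the first
    half [r t = 0] and [q 0] cancels [p 1], on the second half [l t = 1] and [q] remains. *)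
Lemma lift_concat p F q G : lift p F -> lift q G -> p 1 = q 0 -> G 0 = 0%C ->
  let l t := Rmin (2 * t) 1 in let r t := Rmax (2 * t - 1) 0 in
  lift (fun t => p (l t) + q (r t) - p 1)%C (fun t => F (l t) + G (r t))%C.
Proof.
  intros (Hp & HpU & d & Hd0 & Hd) (Hq & HqU & e & He0 & He) Hpq HG l r.
  assert (Il : forall t, I01 t -> I01 (l t)).
  { unfold I01, l. intros t It. split; [apply Rmin_glb; lra|apply Rmin_r]. }
  assert (Ir : forall t, I01 t -> I01 (r t)).
  { unfold I01, r. intros t It. split; [apply Rmax_r|apply Rmax_lub; lra]. }
  assert (Dl : forall s t, Rabs (l t - l s) <= 2 * Rabs (t - s)).
  { intros s t. unfold l, Rmin. destruct (Rle_dec _ _), (Rle_dec _ _);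
      unfold Rabs; repeat destruct (Rcase_abs _); lra. }
  assert (Dr : forall s t, Rabs (r t - r s) <= 2 * Rabs (t - s)).
  { intros s t. unfold r, Rmax. destruct (Rle_dec _ _), (Rle_dec _ _);
      unfold Rabs; repeat destruct (Rcase_abs _); lra. }
  assert (L : forall t, t <= 1 / 2 -> l t = 2 * t /\ r t = 0).
  { intros t Ht. unfold l, r. rewrite Rmin_left, Rmax_right by lra. tauto. }
  assert (M : forall t, 1 / 2 <= t -> l t = 1 /\ r t = 2 * t - 1).
  { intros t Ht. unfold l, r. rewrite Rmin_right, Rmax_left by lra. tauto. }
  set (pq := fun t => (p (l t) + q (r t) - p 1)%C).
  assert (pqL : forall t, t <= 1 / 2 -> pq t = p (2 * t)).
  { intros t Ht. unfold pq. destruct (L t Ht) as [-> ->]. rewrite Hpq. ring. }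
  assert (pqM : forall t, 1 / 2 <= t -> pq t = q (2 * t - 1)).
  { intros t Ht. unfold pq. destruct (M t Ht) as [-> ->]. ring. }
  assert (Hc : continuous_on I01 pq).
  { apply continuous_on_I01_eps. intros t It eps Heps.
    destruct (proj1 (continuous_on_I01_eps p) Hp (l t) (Il t It) (eps / 2)) as [d1 [Hd1 K1]]; [lra|].
    destruct (proj1 (continuous_on_I01_eps q) Hq (r t) (Ir t It) (eps / 2)) as [d2 [Hd2 K2]]; [lra|].
    exists (Rmin (d1 / 2) (d2 / 2)). split; [apply Rmin_pos; lra|]. intros s Is Ds.
    assert (A1 := Rlt_le_trans _ _ _ Ds (Rmin_l _ _)).
    assert (A2 := Rlt_le_trans _ _ _ Ds (Rmin_r _ _)).
    pose proof (Dl t s). pose proof (Dr t s).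
    assert (B1 := K1 (l s) (Il s Is) ltac:(lra)).
    assert (B2 := K2 (r s) (Ir s Is) ltac:(lra)).
    unfold pq.
    replace (p (l s) + q (r s) - p 1 - (p (l t) + q (r t) - p 1))%C with
      ((p (l s) - p (l t)) + (q (r s) - q (r t)))%C by ring.
    eapply Rle_lt_trans; [apply Cmod_triangle|]. lra. }
  assert (HpqU : forall t, I01 t -> U (pq t)).
  { intros t It. destruct (Rle_dec t (1 / 2)) as [A|A].
    - rewrite pqL by assumption. apply HpU. unfold I01 in *. lra.
    - rewrite pqM by lra. apply HqU. unfold I01 in *. lra. }
  destruct (path_lebesgue U pq HU Hc HpqU) as [b [Hb0 Hb]].
  split; [exact Hc|split; [exact HpqU|]].
  change (fun t => p (l t) + q (r t) - p 1)%C with pq.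
  (* Concatenation doubles the speed, hence the halves of [d] and [e]. A step across 1/2 is cut
     there, and [b] keeps its three points in one disk. *)
  exists (Rmin b (Rmin (d / 2) (e / 2))). split; [repeat apply Rmin_pos; lra|].
  intros s t Is It Dst.
  assert (D1 := Rlt_le_trans _ _ _ Dst (Rmin_l _ _)).
  assert (D2 := Rlt_le_trans _ _ _ (Rlt_le_trans _ _ _ Dst (Rmin_r _ _)) (Rmin_l _ _)).
  assert (D3 := Rlt_le_trans _ _ _ (Rlt_le_trans _ _ _ Dst (Rmin_r _ _)) (Rmin_r _ _)).
  assert (HL : forall s t, I01 s -> I01 t -> s <= 1 / 2 -> t <= 1 / 2 -> Rabs (t - s) < d / 2 ->
    (F (l t) + G (r t) - (F (l s) + G (r s)) = seg h (pq s) (pq t))%C).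
  { clear s t Is It Dst D1 D2 D3. intros s t Is It As At D.
    rewrite !pqL by assumption. destruct (L s As) as [-> ->]. destruct (L t At) as [-> ->].
    rewrite <- Hd; [ring|unfold I01 in *; lra..|].
    pose proof (Dl s t) as K. destruct (L s As) as [E' _]. destruct (L t At) as [E _].
    rewrite E, E' in K. lra. }
  assert (HM : forall s t, I01 s -> I01 t -> 1 / 2 <= s -> 1 / 2 <= t -> Rabs (t - s) < e / 2 ->
    (F (l t) + G (r t) - (F (l s) + G (r s)) = seg h (pq s) (pq t))%C).
  { clear s t Is It Dst D1 D2 D3 HL. intros s t Is It As At D.
    rewrite !pqM by assumption. destruct (M s As) as [-> ->]. destruct (M t At) as [-> ->].
    rewrite <- He; [ring|unfold I01 in *; lra..|].
    pose proof (Dr s t) as K. destruct (M s As) as [_ E']. destruct (M t At) as [_ E].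
    rewrite E, E' in K. lra. }
  assert (Ih : I01 (1 / 2)) by (unfold I01; lra).
  destruct (Rle_dec s (1 / 2)) as [As|As]; destruct (Rle_dec t (1 / 2)) as [At|At];
    [now apply HL| | |apply HM; auto; lra].
  - assert (E : Rabs (1 / 2 - s) < Rabs (t - s) /\ Rabs (t - 1 / 2) <= Rabs (t - s)).
    { rewrite !Rabs_pos_eq by lra. lra. }
    transitivity (seg h (pq s) (pq (1 / 2)%R) + seg h (pq (1 / 2)%R) (pq t))%C.
    + rewrite <- HL, <- HM by (auto; lra). ring.
    + apply (near_seg_add _ _ _ _ (Hb s Is)).
      * exists s. rewrite Rminus_diag, Rabs_R0. tauto.
      * exists (1 / 2). split; [assumption|]. split; [lra|reflexivity].
      * exists t. tauto.
  - assert (E : Rabs (1 / 2 - s) <= Rabs (t - s) /\ Rabs (t - 1 / 2) <= Rabs (t - s)).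
    { rewrite !(Rabs_left1 _) by lra. lra. }
    transitivity (seg h (pq s) (pq (1 / 2)%R) + seg h (pq (1 / 2)%R) (pq t))%C.
    + rewrite <- HM, <- HL by (auto; lra). ring.
    + apply (near_seg_add _ _ _ _ (Hb s Is)).
      * exists s. rewrite Rminus_diag, Rabs_R0. tauto.
      * exists (1 / 2). split; [assumption|]. split; [lra|reflexivity].
      * exists t. tauto.
Qed.

(** A finite chain of C^1 paths becomes one continuous path, for which corners do not matter; this
    is the kind of path that [simply_connected] speaks about. *)
Lemma contour_lift x y I : is_contour_int U h x y I ->
  exists p F, lift p F /\ p 0 = x /\ p 1 = y /\ F 0 = 0%C /\ F 1 = I.
Proof.
  induction 1 as [x Ux|x y z q dq I J _ IH Hq HJ].
  - exists (fun _ => x), (fun _ => 0%C). split; [now apply lift_const|tauto].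
  - destruct IH as (p & F & HF & p0 & p1 & F0 & F1).
    destruct (C1_lift q dq y z J Hq HJ) as (G & HG & G0 & G1).
    destruct Hq as (_ & q0 & q1).
    do 2 eexists. split; [apply (lift_concat p F q G HF HG); congruence|]. cbv beta zeta.
    replace (Rmin (2 * 0) 1) with 0 by (rewrite Rmin_left; lra).
    replace (Rmin (2 * 1) 1) with 1 by (rewrite Rmin_right; lra).
    replace (Rmax (2 * 0 - 1) 0) with 0 by (rewrite Rmax_right; lra).
    replace (Rmax (2 * 1 - 1) 0) with 1 by (rewrite Rmax_left; lra).
    rewrite p0, p1, F0, F1, G0, G1, q0, q1. repeat split; ring.
Qed.

(** The first path followed by the reverse of the second is a loop whose lift has total increment
    [I - J]. A null homotopy deforms it into a constant path, with increment 0. *)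
Lemma contour_unique x y I J : simply_connected U ->
  is_contour_int U h x y I -> is_contour_int U h x y J -> I = J.
Proof.
  intros HS HI HJ.
  destruct (contour_lift x y I HI) as (p & F & HF & p0 & p1 & F0 & F1).
  destruct (contour_lift x y J HJ) as (q & G & HG & q0 & q1 & G0 & G1).
  pose proof (lift_reverse q G (G 1) HG) as HG'.
  pose proof (lift_concat p F _ _ HF HG') as HL. cbv beta zeta in HL.
  replace (1 - 0) with 1 in HL by ring.
  specialize (HL ltac:(congruence) ltac:(ring)).
  match type of HL with lift ?a ?b => set (w := a) in HL; set (W := b) in HL end.
  destruct HL as (Hc & HwU & HL).
  assert (w0 : w 0 = x).
  { unfold w. replace (Rmin (2 * 0) 1) with 0 by (rewrite Rmin_left; lra).
    replace (Rmax (2 * 0 - 1) 0) with 0 by (rewrite Rmax_right; lra).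
    replace (1 - 0) with 1 by ring. rewrite p0, p1, q1. ring. }
  assert (w1 : w 1 = x).
  { unfold w. replace (Rmin (2 * 1) 1) with 1 by (rewrite Rmin_right; lra).
    replace (Rmax (2 * 1 - 1) 0) with 1 by (rewrite Rmax_left; lra).
    replace (1 - 1) with 0 by ring. rewrite p1, q0. ring. }
  destruct (HS w Hc HwU) as (H & HHc & HHU & H0 & H1 & Hside); [congruence|].
  assert (E : (W 1 - W 0 = 0 - 0)%C).
  { apply (homotopy_invariance H W (fun _ => 0%C)).
    - exact HHc.
    - intros [s t] [Is It]. now apply HHU.
    - intros s Is. destruct (Hside s Is). congruence.
    - split; [|split].
      + apply continuous_on_I01_eps. intros t It eps He.
        destruct (proj1 (continuous_on_I01_eps w) Hc t It eps He) as [d [Hd0 Hd]].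
        exists d. split; [assumption|]. intros s Is Ds. rewrite !H0 by assumption. auto.
      + intros t It. apply HHU; [unfold I01; lra|assumption].
      + destruct HL as [d [Hd0 Hd]]. exists d. split; [assumption|].
        intros s t Is It Dst. rewrite !H0 by assumption. auto.
    - assert (Ux : U x). { rewrite <- w0. apply HwU. unfold I01; lra. }
      destruct (lift_const x Ux) as (Kc & KU & d & Hd0 & Hd).
      split; [|split].
      + apply continuous_on_I01_eps. intros t It eps He. exists 1. split; [lra|].
        intros s Is Ds. rewrite !H1, w0 by assumption.
        replace (x - x)%C with (RtoC 0) by ring. now rewrite Cmod_0.
      + intros t It. apply HHU; [unfold I01; lra|assumption].
      + exists d. split; [assumption|].
        intros s t Is It Dst. rewrite !H1, w0 by assumption. now apply (Hd s t). }
  unfold W in E.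
  replace (Rmin (2 * 0) 1) with 0 in E by (rewrite Rmin_left; lra).
  replace (Rmax (2 * 0 - 1) 0) with 0 in E by (rewrite Rmax_right; lra).
  replace (Rmin (2 * 1) 1) with 1 in E by (rewrite Rmin_right; lra).
  replace (Rmax (2 * 1 - 1) 0) with 1 in E by (rewrite Rmax_left; lra).
  replace (1 - 0) with 1 in E by ring. replace (1 - 1) with 0 in E by ring.
  rewrite F0, F1, G0, G1 in E.
  replace I with (I + (0 - J) - (0 + (J - J)) + J)%C by ring. rewrite E. ring.
Qed.

Lemma contour_segment x y z c rho I : is_contour_int U h x y I ->
  (forall w, disk c rho w -> U w) -> disk c rho y -> disk c rho z ->
  is_contour_int U h x z (I + seg h y z)%C.
Proof.
  intros HI HD Hy Hz.
  assert (Hl : forall t, I01 t -> U (y + RtoC t * (z - y))%C)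
    by (intros t It; now apply HD, convex_disk).
  apply contour_cons with (y := y) (gamma := fun t => (y + RtoC t * (z - y))%C)
    (dgamma := fun _ => (z - y)%C); [assumption| |].
  - split; [|split; ring]. intros t It. split; [now apply Hl|]. split.
    + apply is_Rderive_line.
    + apply continuous_const.
  - apply seg_correct. intros t It. now apply cdiff_continuous, Hh, Hl.
Qed.

(** The points of [U] that can be reached from [u] form an open set, and so do the other points of
    [U], because a segment in a small disk joins a point to its neighbours in both directions. *)
Lemma contour_exists u x : connected_set U -> U u -> U x -> exists I, is_contour_int U h u x I.
Proof.
  intros HC Hu Hx. apply Classical_Prop.NNPP. intros N.
  assert (Hnbr : forall z, U z -> exists rho, 0 < rho /\ forall w, disk z rho w -> U w /\
    ((exists I, is_contour_int U h u z I) <-> (exists I, is_contour_int U h u w I))).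
  { intros z Uz. destruct (open_disk U z HU Uz) as [rho [Hrho Hd]].
    exists rho. split; [assumption|]. intros w Hw. split; [auto|].
    assert (Hz : disk z rho z)
      by (unfold disk; replace (z - z)%C with (RtoC 0) by ring; now rewrite Cmod_0).
    split; intros [I HI]; eexists; eapply contour_segment; eauto. }
  destruct (HC (fun z => U z /\ exists I, is_contour_int U h u z I)
    (fun z => U z /\ ~ exists I, is_contour_int U h u z I)) as (z & _ & [_ P] & [_ Q]).
  - intros z [Uz Pz]. destruct (Hnbr z Uz) as [rho [Hrho Hd]].
    apply locally_C_eps. exists rho. split; [assumption|]. intros w Hw.
    destruct (Hd w Hw). tauto.
  - intros z [Uz Pz]. destruct (Hnbr z Uz) as [rho [Hrho Hd]].
    apply locally_C_eps. exists rho. split; [assumption|]. intros w Hw.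
    destruct (Hd w Hw). tauto.
  - intros z Uz. destruct (Classical_Prop.classic (exists I, is_contour_int U h u z I)); tauto.
  - exists u. repeat split; try assumption. exists 0%C. now constructor.
  - exists x. tauto.
  - tauto.
Qed.

(** Uniqueness lets [iota] select the integral. Near [x] a path can be prolonged by a segment in a
    disk, so [contour_int] differs from a local primitive by a constant. *)
Theorem contour_int_primitive u : connected_set U -> simply_connected U -> U u ->
  contour_int U h u u = 0%C /\
  forall x, U x -> is_Cderive (contour_int U h u) x (h x).
Proof.
  intros HC HS Hu.
  assert (HG : forall x I, is_contour_int U h u x I -> contour_int U h u x = I).
  { intros x I HI. apply (iota_unique (V := C_R_CompleteNormedModule)); [|exact HI].
    intros J HJ. exact (contour_unique u x J I HS HJ HI). }
  split.
  - apply HG. now constructor.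
  - intros x Ux. destruct (open_disk U x HU Ux) as [rho [Hrho Hd]].
    destruct (contour_exists u x HC Hu Ux) as [I HI].
    assert (Hx : disk x rho x)
      by (unfold disk; replace (x - x)%C with (RtoC 0) by ring; now rewrite Cmod_0).
    pose proof (disk_primitive h x rho (fun s Hs => Hh s (Hd s Hs)) x x Hx Hx) as HP.
    apply is_Cderive_eps. intros eps He.
    destruct (proj1 (is_Cderive_eps _ _ _) HP eps He) as [d [Hd0 Hdd]].
    exists (Rmin d rho). split; [now apply Rmin_pos|]. intros w Hw.
    assert (W1 := Rlt_le_trans _ _ _ Hw (Rmin_l _ _)).
    assert (W2 := Rlt_le_trans _ _ _ Hw (Rmin_r _ _)).
    rewrite (HG x I HI), (HG w (I + seg h x w)%C).
    + replace (I + seg h x w - I)%C with (seg h x w - seg h x x)%C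
        by (rewrite (seg_refl x Ux); ring).
      now apply Hdd.
    + now apply (contour_segment u x w x rho).
Qed.

End Lift.

(** * Algebra of complex derivatives *)

(* [C_NormedModule] and the module of [C_AbsRing] over itself are distinct
   normed modules with the same norm. *)
Lemma is_Cderive_alg (h : C -> C) (z l : C) :
  is_Cderive h z l <-> is_derive (K := C_AbsRing) (V := AbsRing_NormedModule C_AbsRing) h z l.
Proof.
  split; intros H; split; try exact (proj2 H).
  - exact (is_linear_scal_l (K := C_AbsRing) (V := AbsRing_NormedModule C_AbsRing) l).
  - exact (is_linear_scal_l (K := C_AbsRing) (V := C_NormedModule) l).
Qed.

Lemma is_Cderive_const (c z : C) : is_Cderive (fun _ => c) z (RtoC 0).
Proof. exact (is_derive_const (K := C_AbsRing) (V := C_NormedModule) c z). Qed.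

Lemma is_Cderive_id (z : C) : is_Cderive (fun s : C => s) z (RtoC 1).
Proof. apply is_Cderive_alg. exact (is_derive_id (K := C_AbsRing) z). Qed.

Lemma is_Cderive_plus (f g : C -> C) (z a b : C) : is_Cderive f z a -> is_Cderive g z b ->
  is_Cderive (fun s => f s + g s)%C z (a + b)%C.
Proof. exact (is_derive_plus (K := C_AbsRing) (V := C_NormedModule) f g z a b). Qed.

Lemma is_Cderive_minus (f g : C -> C) (z a b : C) : is_Cderive f z a -> is_Cderive g z b ->
  is_Cderive (fun s => f s - g s)%C z (a - b)%C.
Proof. exact (is_derive_minus (K := C_AbsRing) (V := C_NormedModule) f g z a b). Qed.

Lemma is_Cderive_mult (f g : C -> C) (z a b : C) : is_Cderive f z a -> is_Cderive g z b ->
  is_Cderive (fun s => f s * g s)%C z (a * g z + f z * b)%C.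
Proof.
  rewrite !is_Cderive_alg. intros Hf Hg.
  exact (is_derive_mult (K := C_AbsRing) f g z a b Hf Hg Cmult_comm).
Qed.

Lemma is_Cderive_eq (f : C -> C) (z a b : C) : is_Cderive f z a -> a = b -> is_Cderive f z b.
Proof. now intros H <-. Qed.

Lemma is_Cderive_comp (f g : C -> C) (z a b : C) : is_Cderive f (g z) a -> is_Cderive g z b ->
  is_Cderive (fun s => f (g s)) z (b * a)%C.
Proof.
  intros Hf Hg. apply is_Cderive_alg in Hg. exact (is_derive_comp (K := C_AbsRing) (V := C_NormedModule) f g z a b Hf Hg).
Qed.

Lemma is_Cderive_uniq (f : C -> C) (z a b : C) : is_Cderive f z a -> is_Cderive f z b -> a = b.
Proof.
  intros Ha Hb. rewrite <- (is_C_derive_unique f z a Ha). now apply is_C_derive_unique.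
Qed.

Lemma is_Cderive_inv (z : C) : z <> 0%C -> is_Cderive Cinv z (- / (z * z))%C.
Proof.
  intros Hz. apply is_Cderive_eps. intros eps He.
  assert (Hm : 0 < Cmod z) by (now apply Cmod_gt_0).
  set (m := Cmod z) in *.
  exists (Rmin (m / 2) (eps * (m * m * m) / 2)). split.
  { apply Rmin_pos; [lra|]. apply Rdiv_lt_0_compat; [|lra].
    repeat apply Rmult_lt_0_compat; assumption. }
  intros w Hw.
  assert (W1 := Rlt_le_trans _ _ _ Hw (Rmin_l _ _)).
  assert (W2 := Rlt_le_trans _ _ _ Hw (Rmin_r _ _)).
  assert (Hwm : m / 2 < Cmod w).
  { assert (m <= Cmod w + Cmod (w - z)); [|lra]. unfold m.
    replace z with (w + - (w - z))%C at 1 by ring.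
    eapply Rle_trans; [apply Cmod_triangle|]. rewrite Cmod_opp. lra. }
  assert (Hw0 : w <> 0%C) by (apply Cmod_gt_0; lra).
  (* The remainder is quadratic in [w - z]; [Hwm] keeps its denominator away from 0. *)
  replace (/ w - / z - (w - z) * - / (z * z))%C with ((w - z) * (w - z) / (w * (z * z)))%C
    by (field; now split).
  rewrite Cmod_div by (repeat apply Cmult_neq_0; assumption).
  rewrite !Cmod_mult. fold m. apply Rle_div_l.
  { repeat apply Rmult_lt_0_compat; lra. }
  pose proof (Cmod_ge_0 (w - z)) as H0.
  replace (eps * Cmod (w - z) * (Cmod w * (m * m))) with
    (Cmod (w - z) * (eps * (m * m) * Cmod w)) by ring.
  apply Rmult_le_compat_l; [assumption|].
  apply Rlt_le. apply Rlt_le_trans with (1 := W2).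
  assert (0 < eps * (m * m)) by (repeat apply Rmult_lt_0_compat; assumption). nra.
Qed.

Lemma is_Cderive_pow (f : C -> C) (z a : C) n : is_Cderive f z a ->
  is_Cderive (fun s => f s ^ S n)%C z (INR (S n) * (a * f z ^ n))%C.
Proof.
  intros Hf. induction n as [|n IH].
  - apply is_Cderive_eq with (a * 1 + f z * 0)%C; [|simpl; ring].
    apply (is_Cderive_mult f (fun _ => 1%C)); [assumption|apply is_Cderive_const].
  - eapply is_Cderive_eq; [exact (is_Cderive_mult f (fun s => f s ^ S n)%C _ _ _ Hf IH)|].
    rewrite (S_INR (S n)), RtoC_plus. simpl Cpow. ring.
Qed.

Lemma cdiff_mult f g z : cdiff f z -> cdiff g z -> cdiff (fun s => f s * g s)%C z.
Proof. intros [a Ha] [b Hb]. eexists. exact (is_Cderive_mult f g z a b Ha Hb). Qed.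

Lemma is_Cderive_sub_const (w z : C) : is_Cderive (fun s : C => s - w)%C z (RtoC 1).
Proof.
  apply is_Cderive_eq with (1 - 0)%C; [|ring].
  apply is_Cderive_minus; [apply is_Cderive_id|apply is_Cderive_const].
Qed.

Lemma is_Cderive_inv_sub (w z : C) : z <> w ->
  is_Cderive (fun s => / (s - w))%C z (- / ((z - w) * (z - w)))%C.
Proof.
  intros Hz. apply is_Cderive_eq with (1 * - / ((z - w) * (z - w)))%C; [|ring].
  apply (is_Cderive_comp Cinv (fun s => s - w)%C).
  - apply is_Cderive_inv. intros E. apply Hz. now apply Ceq_minus.
  - apply is_Cderive_sub_const.
Qed.

(** * Cauchy's formula and Taylor expansion *)

Definition cis (t : R) : C := (cos t, sin t).

Lemma Cmod_cis t : Cmod (cis t) = 1.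
Proof.
  unfold Cmod, cis; simpl fst; simpl snd. rewrite <- sqrt_1. f_equal.
  pose proof (sin2_cos2 t) as H. unfold Rsqr in H. lra.
Qed.

Lemma is_Rderive_cis c t : is_Rderive (fun t => cis (c * t)) t (RtoC c * Ci * cis (c * t))%C.
Proof.
  assert (E : (RtoC c * Ci * cis (c * t))%C = (c * - sin (c * t), c * cos (c * t))%R).
  { unfold cis. apply injective_projections; simpl; ring. }
  rewrite E.
  assert (Hc : is_derive (fun t => cos (c * t)) t (c * - sin (c * t))) by (auto_derive; [trivial|ring]).
  assert (Hs : is_derive (fun t => sin (c * t)) t (c * cos (c * t))) by (auto_derive; [trivial|ring]).
  apply is_Rderive_eps. intros eps He.
  destruct Hc as [_ Hc]. destruct Hs as [_ Hs].
  assert (He2 : 0 < eps / 2) by lra.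
  destruct (Hc t (fun P HP => HP) (mkposreal _ He2)) as [d1 Hd1].
  destruct (Hs t (fun P HP => HP) (mkposreal _ He2)) as [d2 Hd2].
  exists (Rmin d1 d2). split; [apply Rmin_pos; apply cond_pos|]. intros s Ds.
  assert (K1 := Hd1 s (Rlt_le_trans _ _ _ Ds (Rmin_l _ _))).
  assert (K2 := Hd2 s (Rlt_le_trans _ _ _ Ds (Rmin_r _ _))).
  eapply Rle_trans; [apply Cmod_le_sum|].
  change (Rabs (cos (c * s) - cos (c * t) - (s - t) * (c * - sin (c * t))) <= eps / 2 * Rabs (s - t)) in K1.
  change (Rabs (sin (c * s) - sin (c * t) - (s - t) * (c * cos (c * t))) <= eps / 2 * Rabs (s - t)) in K2.
  unfold cis. simpl fst. simpl snd.
  match goal with |- Rabs ?a + Rabs ?b <= _ =>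
    replace a with (cos (c * s) - cos (c * t) - (s - t) * (c * - sin (c * t))) by ring;
    replace b with (sin (c * s) - sin (c * t) - (s - t) * (c * cos (c * t))) by ring end.
  lra.
Qed.

Definition circ (r t : R) : C := (RtoC r * cis (2 * PI * t))%C.

Definition twopii : C := (RtoC (2 * PI) * Ci)%C.

Lemma Cmod_circ r t : 0 < r -> Cmod (circ r t) = r.
Proof. intros Hr. unfold circ. rewrite Cmod_mult, Cmod_cis, Cmod_R, Rabs_pos_eq; lra. Qed.

Lemma circ_neq_0 r t : 0 < r -> circ r t <> 0%C.
Proof. intros Hr. apply Cmod_gt_0. now rewrite Cmod_circ. Qed.

Lemma twopii_neq_0 : twopii <> 0%C.
Proof.
  unfold twopii. apply Cmod_gt_0. rewrite Cmod_mult, Cmod_Ci, Cmod_R.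
  pose proof PI_RGT_0. rewrite Rabs_pos_eq; lra.
Qed.

Lemma circ_loop r : circ r 0 = circ r 1.
Proof.
  unfold circ, cis. rewrite Rmult_0_r, Rmult_1_r, cos_0, sin_0, cos_2PI, sin_2PI. reflexivity.
Qed.

Lemma is_Rderive_affine_circ (a b : C) r t :
  is_Rderive (fun t => a + b * circ r t)%C t (b * (twopii * circ r t))%C.
Proof.
  assert (H : is_Cderive (fun s => a + b * (r * s))%C (cis (2 * PI * t)) (b * r)%C).
  { apply is_Cderive_eq with (0 + (0 * (r * cis (2 * PI * t)) + b * (0 * cis (2 * PI * t) + r * 1)))%C;
      [|ring].
    apply is_Cderive_plus; [apply is_Cderive_const|].
    apply (is_Cderive_mult (fun _ => b)); [apply is_Cderive_const|].
    apply (is_Cderive_mult (fun _ => RtoC r)); [apply is_Cderive_const|apply is_Cderive_id]. }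
  pose proof (is_Rderive_comp _ (fun t => cis (2 * PI * t)) t _ _ H (is_Rderive_cis (2 * PI) t)) as K.
  unfold circ, twopii.
  replace (b * (RtoC (2 * PI) * Ci * (r * cis (2 * PI * t))))%C with
    (b * r * (RtoC (2 * PI) * Ci * cis (2 * PI * t)))%C by ring.
  exact K.
Qed.

Lemma is_Rderive_circ z r t : is_Rderive (fun t => z + circ r t)%C t (twopii * circ r t)%C.
Proof.
  pose proof (is_Rderive_affine_circ z 1 r t) as H. rewrite Cmult_1_l in H.
  apply (is_derive_ext (V := C_R_NormedModule)) with (2 := H). intros s. simpl. ring.
Qed.

Lemma continuous_circ z r t : continuous (fun t => z + circ r t)%C t.
Proof. exact (is_Rderive_continuous _ _ _ (is_Rderive_circ z r t)). Qed.

Lemma continuous_inv_circ r t : 0 < r -> continuous (fun t => / circ r t)%C t.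
Proof.
  intros Hr. apply (continuous_Ccomp Cinv).
  - apply (continuous_ext (fun t => 0 + circ r t)%C); [intros s; apply Cplus_0_l|apply continuous_circ].
  - exact (is_Cderive_continuous _ _ _ (is_Cderive_inv _ (circ_neq_0 r t Hr))).
Qed.

Lemma continuous_Cpow {T : UniformSpace} (f : T -> C) x n : continuous f x ->
  continuous (fun y => f y ^ n)%C x.
Proof.
  intros Hf. induction n as [|n IH]; simpl; [apply continuous_const|].
  now apply continuous_Cmult.
Qed.

(** The Cauchy integral of f(s) / (s - z)^(k+1), divided by 2 pi i, along s = z + [circ r t]: the
    factor ds = 2 pi i [circ r t] dt cancels 2 pi i and one power. *)
Definition coef (f : C -> C) (z : C) (r : R) (k : nat) : C :=
  CRInt (fun t => f (z + circ r t) * (/ circ r t) ^ k)%C 0 1.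

Definition circ_continuous (f : C -> C) (z : C) (r : R) : Prop :=
  forall t, 0 <= t <= 1 -> continuous f (z + circ r t)%C.

Lemma coef_correct f z r k : 0 < r -> circ_continuous f z r ->
  is_CRInt (fun t => f (z + circ r t) * (/ circ r t) ^ k)%C 0 1 (coef f z r k).
Proof.
  intros Hr Hf. apply CRInt_correct, ex_CRInt_continuous; [lra|]. intros t Ht.
  apply continuous_Cmult.
  - apply (continuous_Ccomp f); [apply continuous_circ|auto].
  - now apply continuous_Cpow, continuous_inv_circ.
Qed.

(** Cauchy's estimate: the integrand has modulus at most [M / r ^ k] and the parameter interval has
    length 1. *)
Lemma coef_bound f z r k M : 0 < r -> circ_continuous f z r ->
  (forall t, 0 <= t <= 1 -> Cmod (f (z + circ r t)%C) <= M) ->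
  Cmod (coef f z r k) <= M / r ^ k.
Proof.
  intros Hr Hf HM. replace (M / r ^ k) with ((1 - 0) * (M / r ^ k)) by ring.
  apply (is_CRInt_bound _ 0 1 _ _ ltac:(lra)) with (2 := coef_correct f z r k Hr Hf).
  intros t Ht. rewrite Cmod_mult, Cmod_pow, Cmod_inv, Cmod_circ, pow_inv
    by (assumption || now apply circ_neq_0).
  apply Rmult_le_compat_r; [|auto].
  apply Rlt_le, Rinv_0_lt_compat, pow_lt, Hr.
Qed.

Lemma coef_plus f g z r k : 0 < r -> circ_continuous f z r -> circ_continuous g z r ->
  coef (fun s => f s + g s)%C z r k = (coef f z r k + coef g z r k)%C.
Proof.
  intros Hr Hf Hg. apply is_CRInt_unique.
  generalize (is_CRInt_plus _ _ _ _ _ _ (coef_correct f z r k Hr Hf) (coef_correct g z r k Hr Hg)).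
  apply is_CRInt_ext; [lra|]. intros t _. ring.
Qed.

Lemma coef_ext f g z r k : (forall t, 0 <= t <= 1 -> f (z + circ r t)%C = g (z + circ r t)%C) ->
  coef f z r k = coef g z r k.
Proof.
  intros H. apply (RInt_ext (V := C_R_CompleteNormedModule)).
  intros t Ht. rewrite Rmin_left, Rmax_right in Ht by lra.
  rewrite H by lra. reflexivity.
Qed.

(* Integration by parts along the circle: [f (z + s) / s ^ (k + 1)] is periodic. *)
Lemma coef_deriv (f df : C -> C) z r k : 0 < r ->
  (forall t, 0 <= t <= 1 -> is_Cderive f (z + circ r t)%C (df (z + circ r t)%C)) ->
  circ_continuous df z r ->
  coef df z r k = (INR (S k) * coef f z r (S k))%C.
Proof.
  intros Hr Hf Hdf.
  assert (Hfc : circ_continuous f z r).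
  { intros t Ht. exact (is_Cderive_continuous _ _ _ (Hf t Ht)). }
  set (F := fun s : C => (f s * (/ (s - z)) ^ S k)%C).
  set (dF := fun s => (df s * (/ (s - z)) ^ S k - INR (S k) * (f s * (/ (s - z)) ^ S (S k)))%C).
  assert (Hsub : forall t, (z + circ r t - z = circ r t)%C) by (intros; ring).
  assert (HF : is_CRInt (fun t => dF (z + circ r t) * (twopii * circ r t))%C 0 1 (RtoC 0)).
  { replace (RtoC 0) with (F (z + circ r 1) - F (z + circ r 0))%C
      by (rewrite (circ_loop r); ring).
    apply (is_CRInt_deriv (fun t => F (z + circ r t))%C); [lra| |].
    - intros t Ht. apply (is_Rderive_comp F (fun t => z + circ r t)%C).
      + assert (Hz : (z + circ r t)%C <> z).
        { intros E. apply (circ_neq_0 r t Hr). rewrite <- Hsub, E. ring. }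
        eapply is_Cderive_eq.
        * apply is_Cderive_mult; [now apply Hf|].
          apply is_Cderive_pow. now apply is_Cderive_inv_sub.
        * unfold dF. rewrite Hsub. pose proof (circ_neq_0 r t Hr). simpl Cpow.
          generalize ((/ circ r t) ^ k)%C. intros X. field. assumption.
      + apply is_Rderive_circ.
    - intros t Ht.
      apply (continuous_ext (fun t => (df (z + circ r t) * (/ circ r t) ^ S k
        - INR (S k) * (f (z + circ r t) * (/ circ r t) ^ S (S k))) * (twopii * (0 + circ r t)))%C).
      { intros s. unfold dF. rewrite Hsub. now rewrite Cplus_0_l. }
      apply continuous_Cmult; [apply continuous_Cminus|].
      + apply continuous_Cmult.
        * apply (continuous_Ccomp df); [apply continuous_circ|auto].
        * now apply continuous_Cpow, continuous_inv_circ.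
      + apply continuous_Cmult; [apply continuous_const|].
        apply continuous_Cmult.
        * apply (continuous_Ccomp f); [apply continuous_circ|auto].
        * now apply continuous_Cpow, continuous_inv_circ.
      + apply continuous_Cmult; [apply continuous_const|apply continuous_circ]. }
  pose proof (is_CRInt_Cmult twopii _ _ _ _ (is_CRInt_minus _ _ _ _ _ _ (coef_correct df z r k Hr Hdf)
    (is_CRInt_Cmult (INR (S k)) _ _ _ _ (coef_correct f z r (S k) Hr Hfc)))) as K.
  assert (E : (twopii * (coef df z r k - INR (S k) * coef f z r (S k)) = 0)%C).
  { apply (is_CRInt_inj _ _ _ _ _ K). revert HF. apply is_CRInt_ext; [lra|].
    intros t Ht. unfold dF. rewrite Hsub. pose proof (circ_neq_0 r t Hr).
    simpl Cpow. generalize ((/ circ r t) ^ k)%C. intros X. field. assumption. }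
  apply Ceq_minus.
  match goal with |- ?x = _ => replace x with (/ twopii * (twopii * x))%C end.
  - rewrite E. ring.
  - rewrite Cmult_assoc, Cinv_l by apply twopii_neq_0. apply Cmult_1_l.
Qed.

Lemma csum_ext f g n : (forall k, (k < n)%nat -> f k = g k) -> csum f n = csum g n.
Proof.
  induction n as [|n IH]; intros H; [reflexivity|].
  rewrite !csum_S, IH, H by auto with arith. reflexivity.
Qed.

Lemma is_CRInt_csum (f : nat -> R -> C) (l : nat -> C) a b n :
  (forall k, is_CRInt (f k) a b (l k)) ->
  is_CRInt (fun t => csum (fun k => f k t) n) a b (csum l n).
Proof.
  intros H. induction n as [|n IH].
  - replace (csum l 0) with (RtoC (b - a) * 0)%C by (simpl; ring). apply is_CRInt_const.
  - apply is_CRInt_plus; [exact IH|apply H].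
Qed.

Lemma geometric_csum (q : C) n : ((1 - q) * csum (fun k => q ^ k) n = 1 - q ^ n)%C.
Proof.
  induction n as [|n IH]; [simpl; ring|].
  rewrite csum_S, Cmult_plus_distr_l, IH. simpl. ring.
Qed.

(** Stands in for a passage to the limit. The exponent starts at 1 because the partial sums in
    [ckernel_integral] must contain their constant term. *)
Lemma le_geometric_0 x c q : 0 <= q < 1 -> (forall n, x <= c * q ^ S n) -> x <= 0.
Proof.
  intros Hq H. apply le_epsilon. intros e He.
  rewrite Rplus_0_l.
  destruct (pow_lt_1_zero q) with (y := e / (1 + Rabs c)) as [N HN].
  - rewrite Rabs_pos_eq; lra.
  - apply Rdiv_lt_0_compat; [assumption|]. pose proof (Rabs_pos c). lra.
  - eapply Rle_trans; [apply (H N)|].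
    specialize (HN (S N) ltac:(lia)).
    rewrite Rabs_pos_eq in HN by (apply pow_le; lra).
    apply Rlt_div_r in HN; [|pose proof (Rabs_pos c); lra].
    pose proof (Rle_abs c). pose proof (pow_le q (S N) ltac:(lra)). nra.
Qed.

Section Cauchy.
Context (z w : C) (r : R) (Hr : 0 < r) (Hw : Cmod (w - z) < r).

(** The form ds / (2 pi i (s - w)) in the parameter of the circle, so that its integral is the
    winding number of the circle around [w]. *)
Definition ckernel (t : R) : C := (circ r t / (z + circ r t - w))%C.

Lemma circ_sub_bound t : r - Cmod (w - z) <= Cmod (z + circ r t - w).
Proof.
  assert (r <= Cmod (z + circ r t - w) + Cmod (w - z)); [|lra].
  rewrite <- (Cmod_circ r t Hr) at 1.
  replace (circ r t) with ((z + circ r t - w) + (w - z))%C at 1 by ring.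
  apply Cmod_triangle.
Qed.

Lemma circ_sub_neq_0 t : (z + circ r t - w)%C <> 0%C.
Proof. apply Cmod_gt_0. pose proof (circ_sub_bound t). lra. Qed.

Lemma ckernel_bound t : Cmod (ckernel t) <= r / (r - Cmod (w - z)).
Proof.
  unfold ckernel. rewrite Cmod_div by apply circ_sub_neq_0. rewrite Cmod_circ by assumption.
  apply Rmult_le_compat_l; [lra|]. apply Rinv_le_contravar; [lra|apply circ_sub_bound].
Qed.

Lemma continuous_ckernel t : continuous ckernel t.
Proof.
  apply (continuous_ext (fun t => (0 + circ r t) * / (z + circ r t - w))%C).
  { intros s. unfold ckernel. now rewrite Cplus_0_l. }
  apply continuous_Cmult; [apply continuous_circ|].
  apply (continuous_Ccomp Cinv).
  - apply continuous_Cminus; [apply continuous_circ|apply continuous_const].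
  - exact (is_Cderive_continuous _ _ _ (is_Cderive_inv _ (circ_sub_neq_0 t))).
Qed.

(** Homothetic images of the circle with centre [w], not [z]: they avoid [w] for [c > 0] and
    collapse to it at [c = 0]. *)
Definition shrink (c t : R) : C := (w + RtoC c * (z + circ r t - w))%C.

Lemma continuous_shrink c t : continuous (shrink c) t.
Proof.
  apply continuous_Cplus; [apply continuous_const|].
  apply continuous_Cmult; [apply continuous_const|].
  apply continuous_Cminus; [apply continuous_circ|apply continuous_const].
Qed.

Section Holomorphic.
Context (rho : R) (Hrho : r < rho) (f : C -> C) (Hf : forall s, disk z rho s -> cdiff f s).

Let punctured (s : C) : Prop := disk z rho s /\ s <> w.
Let quot (s : C) : C := (f s * / (s - w))%C.

Lemma disk_shrink c t : 0 <= c <= 1 -> disk z rho (shrink c t).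
Proof.
  intros Hc. apply convex_disk; try assumption.
  - unfold disk. lra.
  - unfold disk. replace (z + circ r t - z)%C with (circ r t) by ring.
    rewrite Cmod_circ; assumption.
Qed.

Lemma open_punctured : open punctured.
Proof.
  intros s [Hs Hsw]. apply locally_C_eps. unfold disk in Hs.
  assert (Hm : 0 < Cmod (s - w)) by (apply Cmod_gt_0, Cminus_eq_contra, Hsw).
  exists (Rmin (rho - Cmod (s - z)) (Cmod (s - w))). split; [apply Rmin_pos; lra|].
  intros x Hx.
  assert (X1 := Rlt_le_trans _ _ _ Hx (Rmin_l _ _)).
  assert (X2 := Rlt_le_trans _ _ _ Hx (Rmin_r _ _)). split.
  - unfold disk. replace (x - z)%C with ((x - s) + (s - z))%C by ring.
    eapply Rle_lt_trans; [apply Cmod_triangle|]. lra.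
  - intros ->. replace (w - s)%C with (- (s - w))%C in X2 by ring. rewrite Cmod_opp in X2. lra.
Qed.

Lemma cdiff_quot s : punctured s -> cdiff quot s.
Proof.
  intros [Hs Hsw]. apply cdiff_mult; [auto|]. eexists. now apply is_Cderive_inv_sub.
Qed.

(** For [c > 0] this is the integral of f(s) / (s - w), divided by 2 pi i, over the contracted
    circle. Both ds and s - w scale by [c], so the kernel stays the same and only the argument of
    [f] moves. *)
Definition cint (c : R) : C := CRInt (fun t => f (shrink c t) * ckernel t)%C 0 1.

Lemma cint_correct c : 0 <= c <= 1 ->
  is_CRInt (fun t => f (shrink c t) * ckernel t)%C 0 1 (cint c).
Proof.
  intros Hc. apply CRInt_correct, ex_CRInt_continuous; [lra|]. intros t Ht.
  apply continuous_Cmult; [|apply continuous_ckernel].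
  apply (continuous_Ccomp f); [apply continuous_shrink|].
  now apply cdiff_continuous, Hf, disk_shrink.
Qed.

Lemma shrink_lift c : 0 < c <= 1 ->
  exists F, lift punctured quot (shrink c) F /\ F 0 = 0%C /\ F 1 = (twopii * cint c)%C.
Proof.
  intros Hc.
  assert (Hc0 : RtoC c <> 0%C) by (intros E; apply RtoC_inj in E; lra).
  apply (C1_lift punctured quot open_punctured cdiff_quot (shrink c)
    (fun t => c * (twopii * circ r t))%C (shrink c 0) (shrink c 1)).
  - split; [|tauto]. intros t _. split; [split|split].
    + apply disk_shrink. lra.
    + unfold shrink. intros E.
      assert (E' : (c * (z + circ r t - w))%C = 0%C).
      { replace (c * (z + circ r t - w))%C with (w + c * (z + circ r t - w) - w)%C by ring.
        rewrite E. ring. }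
      revert E'. apply Cmult_neq_0; [assumption|apply circ_sub_neq_0].
    + apply (is_derive_ext (V := C_R_NormedModule)
        (fun t => (w + c * (z - w)) + c * circ r t)%C); [|apply is_Rderive_affine_circ].
      intros s. unfold shrink.
      change ((w + c * (z - w) + c * circ r s)%C = (w + c * (z + circ r s - w))%C). ring.
    + apply (continuous_ext (fun t => c * (twopii * (0 + circ r t)))%C).
      { intros s. now rewrite Cplus_0_l. }
      apply continuous_Cmult; [apply continuous_const|].
      apply continuous_Cmult; [apply continuous_const|apply continuous_circ].
  - generalize (is_CRInt_Cmult twopii _ _ _ _ (cint_correct c ltac:(lra))).
    apply is_CRInt_ext; [lra|]. intros t _. unfold quot, ckernel.
    replace (shrink c t - w)%C with (c * (z + circ r t - w))%C by (unfold shrink; ring).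
    pose proof (circ_sub_neq_0 t). field. split; assumption.
Qed.

(** The contracted circles are homotopic as closed loops in the punctured disk, where f(s) / (s - w)
    is holomorphic. *)
Lemma cint_shrink e : 0 < e <= 1 -> cint e = cint 1.
Proof.
  intros He.
  (* The ratios [e] and 1 are written in the form in which they occur in the first and last rows of
     the homotopy. *)
  destruct (shrink_lift (e + (1 - e) * 0)) as (F0 & L0 & A0 & B0); [lra|].
  destruct (shrink_lift (e + (1 - e) * 1)) as (F1 & L1 & A1 & B1); [lra|].
  pose proof (homotopy_invariance punctured quot open_punctured cdiff_quot
    (fun p => shrink (e + (1 - e) * fst p) (snd p)) F0 F1) as E.
  rewrite A0, A1, B0, B1 in E.
  replace (e + (1 - e) * 0) with e in E by ring. replace (e + (1 - e) * 1) with 1 in E by ring.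
  assert (E' : (twopii * cint e - 0 = twopii * cint 1 - 0)%C).
  { apply E.
    - intros [s t] _. apply (filterlim_filter_le_1 (F := locally (s, t))).
      { intros P [d Hd]. exists d. intros y Hy _. now apply Hd. }
      apply (continuous_Cplus (T := prod_UniformSpace R_UniformSpace R_UniformSpace)
        (fun _ => w)); [apply continuous_const|].
      apply (continuous_Cmult (T := prod_UniformSpace R_UniformSpace R_UniformSpace)
        (fun p => RtoC (e + (1 - e) * fst p))).
      + apply continuous_RtoC.
        apply (continuous_comp fst (fun s => e + (1 - e) * s)).
        * apply continuous_fst.
        * apply (ex_derive_continuous (V := R_NormedModule)). auto_derive. trivial.
      + apply continuous_Cminus; [|apply continuous_const].
        apply (continuous_comp snd (fun t => z + circ r t)%C).
        * apply continuous_snd.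
        * apply continuous_circ.
    - intros [s t] [Is It]. unfold I01 in *. simpl in *.
      destruct (shrink_lift (e + (1 - e) * s)) as (F & (_ & K & _) & _); [nra|]. now apply K.
    - intros s _. simpl. unfold shrink. now rewrite circ_loop.
    - replace (e + (1 - e) * 0) with e in L0 by ring.
      replace e with (e + (1 - e) * 0) in L0 by ring. exact L0.
    - replace (e + (1 - e) * 1) with 1 in L1 by ring.
      replace 1 with (e + (1 - e) * 1) in L1 at 1 by ring. exact L1. }
  replace (cint e) with (/ twopii * (twopii * cint e - 0))%C by (field; apply twopii_neq_0).
  rewrite E'. field. apply twopii_neq_0.
Qed.

(** As the ratio tends to 0, [f (shrink e t)] tends to [f w] uniformly in [t] while the kernel stays
    bounded; the integral does not depend on the ratio, so it equals the limit. The integral of the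
    kernel is kept as a factor still to be determined. *)
Lemma cint_eq : cint 1 = (f w * CRInt ckernel 0 1)%C.
Proof.
  assert (Hk : is_CRInt ckernel 0 1 (CRInt ckernel 0 1)).
  { apply CRInt_correct, ex_CRInt_continuous; [lra|]. intros t _. apply continuous_ckernel. }
  apply Ceq_minus, Cmod_eq_0. apply Rle_antisym; [|apply Cmod_ge_0].
  apply le_epsilon. intros eps Heps. rewrite Rplus_0_l.
  set (B := r / (r - Cmod (w - z))).
  assert (HB : 0 < B) by (apply Rdiv_lt_0_compat; lra).
  assert (Hwd : disk z rho w) by (unfold disk; lra).
  destruct (proj1 (locally_C_eps w _) (proj1 (continuous_C_eps f w)
    (cdiff_continuous f w (Hf w Hwd)) (eps / B) (Rdiv_lt_0_compat _ _ Heps HB))) as [d [Hd0 Hd]].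
  (* The circle lies within [2 * r] of [w]; the 3 places its contracted image strictly within
     [d]. *)
  set (e := Rmin 1 (d / (3 * r))).
  assert (He : 0 < e <= 1).
  { unfold e. split; [apply Rmin_pos; [lra|apply Rdiv_lt_0_compat; lra]|apply Rmin_l]. }
  assert (He2 : e * (2 * r) < d).
  { assert (e <= d / (3 * r)) as K by apply Rmin_r. apply Rle_div_r in K; nra. }
  rewrite <- (cint_shrink e He).
  pose proof (is_CRInt_minus _ _ _ _ _ _ (cint_correct e ltac:(lra))
    (is_CRInt_Cmult (f w) _ _ _ _ Hk)) as K.
  replace eps with ((1 - 0) * eps) by ring.
  apply (is_CRInt_bound _ 0 1 _ _ ltac:(lra)) with (2 := K). intros t _.
  replace (f (shrink e t) * ckernel t - f w * ckernel t)%C with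
    ((f (shrink e t) - f w) * ckernel t)%C by ring.
  rewrite Cmod_mult. replace eps with (eps / B * B) by (field; lra).
  apply Rmult_le_compat; try apply Cmod_ge_0; [|apply ckernel_bound].
  apply Rlt_le, Hd. replace (shrink e t - w)%C with (e * (z + circ r t - w))%C
    by (unfold shrink; ring).
  rewrite Cmod_mult, Cmod_R, Rabs_pos_eq by lra.
  assert (Cmod (z + circ r t - w) <= 2 * r); [|nra].
  replace (z + circ r t - w)%C with (circ r t + - (w - z))%C by ring.
  eapply Rle_trans; [apply Cmod_triangle|]. rewrite Cmod_opp, Cmod_circ by assumption. lra.
Qed.

(** The kernel is 1 / (1 - q) with q = (w - z) / [circ r t]. The first [n] terms of its geometric
    series integrate to the Taylor polynomial, and the rest is q^n times the kernel. *)
Lemma cint_taylor n M : (forall t, 0 <= t <= 1 -> Cmod (f (z + circ r t)%C) <= M) ->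
  Cmod (cint 1 - csum (fun k => coef f z r k * (w - z) ^ k)%C n) <=
  M * (r / (r - Cmod (w - z))) * (Cmod (w - z) / r) ^ n.
Proof.
  intros HM.
  assert (Hc : circ_continuous f z r).
  { intros t Ht. apply cdiff_continuous, Hf. unfold disk.
    replace (z + circ r t - z)%C with (circ r t) by ring. now rewrite Cmod_circ. }
  assert (Hs : is_CRInt (fun t => csum (fun k =>
      (w - z) ^ k * (f (z + circ r t) * (/ circ r t) ^ k))%C n) 0 1
      (csum (fun k => (w - z) ^ k * coef f z r k)%C n)).
  { apply (is_CRInt_csum (fun k t => (w - z) ^ k * (f (z + circ r t) * (/ circ r t) ^ k))%C).
    intros k. now apply is_CRInt_Cmult, coef_correct. }
  rewrite (csum_ext _ (fun k => (w - z) ^ k * coef f z r k)%C) by (intros; ring).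
  pose proof (is_CRInt_minus _ _ _ _ _ _ (cint_correct 1 ltac:(lra)) Hs) as K.
  match goal with |- _ <= ?b => replace b with ((1 - 0) * b) by ring end.
  apply (is_CRInt_bound _ 0 1 _ _ ltac:(lra)) with (2 := K). intros t Ht.
  replace (shrink 1 t) with (z + circ r t)%C by (unfold shrink; ring).
  set (q := ((w - z) * / circ r t)%C).
  pose proof (circ_neq_0 r t Hr) as Hp. pose proof (circ_sub_neq_0 t) as Hq.
  assert (Hk : (ckernel t = csum (fun k => q ^ k) n + q ^ n * ckernel t)%C).
  { assert (E : ((1 - q) * ckernel t = 1)%C) by (unfold q, ckernel; field; split; assumption).
    replace (csum (fun k => q ^ k)%C n) with
      (ckernel t * ((1 - q) * csum (fun k => q ^ k) n))%C.
    - rewrite geometric_csum. ring.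
    - rewrite Cmult_assoc, (Cmult_comm (ckernel t)), E. ring. }
  assert (Hsum : csum (fun k => (w - z) ^ k * (f (z + circ r t) * (/ circ r t) ^ k))%C n =
    (f (z + circ r t) * csum (fun k => q ^ k) n)%C).
  { clear -q. induction n as [|n IH]; [simpl; ring|]. rewrite !csum_S, IH.
    unfold q at 3. rewrite Cpow_mult_l. ring. }
  rewrite Hsum. rewrite Hk at 1.
  replace (f (z + circ r t) * (csum (fun k => q ^ k) n + q ^ n * ckernel t) -
    f (z + circ r t) * csum (fun k => q ^ k) n)%C with
    (f (z + circ r t) * ckernel t * q ^ n)%C by ring.
  rewrite !Cmod_mult, Cmod_pow. unfold q. rewrite Cmod_mult, Cmod_inv by assumption.
  rewrite Cmod_circ by assumption.
  apply Rmult_le_compat_r.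
  - apply pow_le. apply Rmult_le_pos; [apply Cmod_ge_0|]. apply Rlt_le, Rinv_0_lt_compat, Hr.
  - apply Rmult_le_compat; try apply Cmod_ge_0; [now apply HM|apply ckernel_bound].
Qed.

End Holomorphic.

(** Positive orders vanish by [coef_deriv], the derivative being 0. *)
Lemma coef_const (c : C) k : coef (fun _ => c) z r k = match k with O => c | _ => 0%C end.
Proof.
  assert (H0 : forall k, coef (fun _ => 0%C) z r k = 0%C).
  { intros j. apply is_CRInt_unique. pose proof (is_CRInt_const 0 1 0%C) as H.
    rewrite Cmult_0_r in H. revert H. apply is_CRInt_ext; [lra|]. intros. now rewrite Cmult_0_l. }
  destruct k as [|k].
  - apply is_CRInt_unique. pose proof (is_CRInt_const 0 1 c) as H.
    replace (RtoC (1 - 0) * c)%C with c in H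
      by (rewrite Rminus_0_r; ring).
    revert H. apply is_CRInt_ext; [lra|]. intros. simpl. ring.
  - pose proof (coef_deriv (fun _ => c) (fun _ => 0%C) z r k Hr) as E. rewrite H0 in E.
    assert (Hn : RtoC (INR (S k)) <> 0%C).
    { intros F. apply RtoC_inj in F. pose proof (pos_INR k). rewrite S_INR in F. lra. }
    replace (coef (fun _ => c) z r (S k)) with
      (/ INR (S k) * (INR (S k) * coef (fun _ => c) z r (S k)))%C by (field; assumption).
    rewrite <- E; [ring| |].
    + intros t _. apply is_Cderive_const.
    + intros t _. apply continuous_const.
Qed.

(** For f = 1, [cint_eq] identifies the integral of the kernel with [cint 1], and [cint_taylor]
    identifies [cint 1] with 1, since every non-empty Taylor polynomial is 1. No logarithm or angle
    enters. *)
Lemma ckernel_integral : CRInt ckernel 0 1 = RtoC 1.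
Proof.
  assert (H1 : forall s, disk z (r + 1) s -> cdiff (fun _ => 1%C) s)
    by (intros s _; eexists; apply is_Cderive_const).
  pose proof (cint_eq (r + 1) ltac:(lra) (fun _ => 1%C) H1) as E.
  rewrite Cmult_1_l in E. rewrite <- E.
  apply Ceq_minus, Cmod_eq_0, Rle_antisym; [|apply Cmod_ge_0].
  pose proof (Cmod_ge_0 (w - z)) as Hv.
  apply (le_geometric_0 _ (1 * (r / (r - Cmod (w - z)))) (Cmod (w - z) / r)).
  - split; [apply Rmult_le_pos; [assumption|apply Rlt_le, Rinv_0_lt_compat, Hr]|].
    apply Rlt_div_l; lra.
  - intros n.
    assert (Es : csum (fun k => coef (fun _ => RtoC 1) z r k * (w - z) ^ k)%C (S n) = RtoC 1).
    { clear -Hr. induction n as [|n IH].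
      - rewrite csum_S, coef_const. simpl. ring.
      - rewrite csum_S, IH, coef_const. ring. }
    pose proof (cint_taylor (r + 1) ltac:(lra) _ H1 (S n) 1) as K. rewrite Es in K. apply K.
    intros t _. rewrite Cmod_1. lra.
Qed.

End Cauchy.

Theorem taylor_remainder (f : C -> C) z r rho v n M : 0 < r < rho ->
  (forall s, disk z rho s -> cdiff f s) ->
  (forall t, 0 <= t <= 1 -> Cmod (f (z + circ r t)%C) <= M) -> Cmod v < r ->
  Cmod (f (z + v)%C - csum (fun k => coef f z r k * v ^ k)%C n) <=
  M * (r / (r - Cmod v)) * (Cmod v / r) ^ n.
Proof.
  intros Hr Hf HM Hv.
  assert (E : (z + v - z = v)%C) by ring.
  assert (Hw : Cmod (z + v - z) < r) by now rewrite E.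
  pose proof (cint_taylor z (z + v)%C r ltac:(lra) Hw rho ltac:(lra) f Hf n M HM) as K.
  rewrite (cint_eq z (z + v)%C r ltac:(lra) Hw rho ltac:(lra) f Hf) in K.
  rewrite ckernel_integral in K by (lra || assumption).
  rewrite Cmult_1_r, E in K. exact K.
Qed.

Lemma circ_bounded f z r : circ_continuous f z r ->
  exists M, forall t, 0 <= t <= 1 -> Cmod (f (z + circ r t)%C) <= M.
Proof.
  intros Hf.
  assert (Hc : forall t, 0 <= t <= 1 -> continuity_pt (fun t => Cmod (f (z + circ r t)%C)) t).
  { intros t Ht. apply continuity_pt_filterlim. apply filterlim_locally. intros eps.
    assert (K : continuous (fun t => f (z + circ r t)%C) t)
      by (apply (continuous_Ccomp f); [apply continuous_circ|auto]).
    generalize (proj1 (continuous_C_eps _ t) K eps (cond_pos eps)).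
    apply filter_imp. intros s Hs.
    change (Rabs (Cmod (f (z + circ r s)%C) - Cmod (f (z + circ r t)%C)) < eps).
    eapply Rle_lt_trans; [|exact Hs].
    assert (Htri : forall a b : C, Cmod a <= Cmod (a - b) + Cmod b).
    { intros a b. replace a with ((a - b) + b)%C at 1 by ring. apply Cmod_triangle. }
    apply Rabs_le.
    pose proof (Htri (f (z + circ r s)%C) (f (z + circ r t)%C)).
    pose proof (Htri (f (z + circ r t)%C) (f (z + circ r s)%C)) as H2.
    replace (f (z + circ r t) - f (z + circ r s))%C with
      (- (f (z + circ r s) - f (z + circ r t)))%C in H2 by ring.
    rewrite Cmod_opp in H2. lra. }
  destruct (continuity_ab_maj _ 0 1 ltac:(lra) Hc) as [m [Hm _]].
  eexists. exact Hm.
Qed.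

Lemma disk_circ_continuous f z r rho : 0 < r < rho ->
  (forall s, disk z rho s -> cdiff f s) -> circ_continuous f z r.
Proof.
  intros Hr Hf t _. apply cdiff_continuous, Hf. unfold disk.
  replace (z + circ r t - z)%C with (circ r t) by ring. rewrite Cmod_circ; lra.
Qed.

(** At v = 0 and with one term, the remainder bound contains the factor 0^1 and vanishes. *)
Lemma coef_0 f z r rho : 0 < r < rho -> (forall s, disk z rho s -> cdiff f s) ->
  coef f z r 0 = f z.
Proof.
  intros Hr Hf.
  destruct (circ_bounded f z r (disk_circ_continuous f z r rho Hr Hf)) as [M HM].
  pose proof (taylor_remainder f z r rho 0 1 M Hr Hf HM) as K.
  rewrite Cmod_0 in K. specialize (K ltac:(lra)).
  replace (0 / r) with 0 in K by (field; lra).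
  replace (M * (r / (r - 0)) * 0 ^ 1) with 0 in K by (simpl; ring).
  symmetry. apply Ceq_minus, Cmod_eq_0, Rle_antisym; [|apply Cmod_ge_0].
  rewrite csum_S in K. simpl in K.
  replace (f z - coef f z r 0)%C with (f (z + 0) - (0 + coef f z r 0 * 1))%C; [exact K|].
  rewrite Cplus_0_r. ring.
Qed.

(** The remainder after two terms is quadratic, so [coef f z r 1] is itself a derivative of [f] at
    [z], and derivatives are unique. *)
Lemma coef_1 (f : C -> C) (z l : C) r rho : 0 < r < rho ->
  (forall s, disk z rho s -> cdiff f s) -> is_Cderive f z l -> coef f z r 1 = l.
Proof.
  intros Hr Hf Hl. apply (is_Cderive_uniq f z); [|assumption].
  destruct (circ_bounded f z r (disk_circ_continuous f z r rho Hr Hf)) as [M HM].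
  assert (HM0 : 0 <= M) by (eapply Rle_trans; [apply Cmod_ge_0|apply (HM 0); lra]).
  apply is_Cderive_eps. intros eps He.
  set (B := M * 2 / (r * r) + 1).
  assert (HB : 0 < B).
  { unfold B. assert (0 <= M * 2 / (r * r)); [|lra].
    apply Rmult_le_pos; [lra|]. apply Rlt_le, Rinv_0_lt_compat. nra. }
  exists (Rmin (r / 2) (eps / B)). split; [apply Rmin_pos; apply Rdiv_lt_0_compat; lra|].
  intros w Hw.
  assert (W1 := Rlt_le_trans _ _ _ Hw (Rmin_l _ _)).
  assert (W2 := Rlt_le_trans _ _ _ Hw (Rmin_r _ _)).
  apply Rlt_div_r in W2; [|lra].
  pose proof (taylor_remainder f z r rho (w - z) 2 M Hr Hf HM ltac:(lra)) as K.
  replace (z + (w - z))%C with w in K by ring.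
  rewrite !csum_S, (coef_0 f z r rho Hr Hf) in K. simpl csum in K.
  replace (f w - (0 + f z * (w - z) ^ 0 + coef f z r 1 * (w - z) ^ 1))%C with
    (f w - f z - (w - z) * coef f z r 1)%C in K by (simpl; ring).
  eapply Rle_trans; [exact K|].
  pose proof (Cmod_ge_0 (w - z)) as Hm. set (m := Cmod (w - z)) in *.
  assert (r / (r - m) <= 2) by (apply Rle_div_l; lra).
  apply Rle_trans with (M * 2 * (m / r) ^ 2).
  - apply Rmult_le_compat_r; [apply pow2_ge_0|]. apply Rmult_le_compat_l; lra.
  - replace (M * 2 * (m / r) ^ 2) with (M * 2 / (r * r) * m * m) by (field; lra).
    assert (M * 2 / (r * r) = B - 1) as -> by (unfold B; ring). nra.
Qed.

(** * Holomorphic functions of two variables *)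

(** Joint differentiability with the partial derivatives named and with the sum norm, a form
    symmetric in the two variables and ready for substituting curves. *)
Definition is_diff2 (f : C -> C -> C) (x y a b : C) : Prop :=
  forall eps, 0 < eps -> exists d, 0 < d /\ forall x' y', Cmod (x' - x) < d -> Cmod (y' - y) < d ->
    Cmod (f x' y' - f x y - ((x' - x) * a + (y' - y) * b)) <= eps * (Cmod (x' - x) + Cmod (y' - y)).

Definition hol2 (U V : C -> Prop) (f : C -> C -> C) : Prop :=
  forall x y, U x -> V y -> exists a b, is_diff2 f x y a b.

Definition swap (f : C -> C -> C) : C -> C -> C := fun y x => f x y.

Lemma Cmod_pair_norm_le (h k : C) :
  norm (V := prod_NormedModule C_AbsRing C_NormedModule C_NormedModule) (h, k) <= Cmod h + Cmod k.
Proof.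
  change (sqrt (Cmod h ^ 2 + Cmod k ^ 2) <= Cmod h + Cmod k).
  pose proof (Cmod_ge_0 h). pose proof (Cmod_ge_0 k).
  rewrite <- (sqrt_pow2 (Cmod h + Cmod k)) by lra.
  apply sqrt_le_1_alt. nra.
Qed.

Lemma holomorphic2_hol2 U V f : holomorphic2_on U V f -> hol2 U V f.
Proof.
  intros H x y Ux Vy. destruct (H x y Ux Vy) as [l [Hl Hd]].
  exists (l (RtoC 1, RtoC 0)), (l (RtoC 0, RtoC 1)). intros eps He.
  destruct (Hd (x, y) (fun P HP => HP) (mkposreal eps He)) as [d K].
  exists (d / 2). split; [pose proof (cond_pos d); lra|].
  intros x' y' Hx Hy.
  assert (E : l (x' - x, y' - y)%C = ((x' - x) * l (RtoC 1, RtoC 0) + (y' - y) * l (RtoC 0, RtoC 1))%C).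
  { change Cmult with (scal (K := C_AbsRing) (V := C_NormedModule)).
    change Cplus with (plus (G := C_NormedModule)).
    rewrite <- !(linear_scal l Hl), <- (linear_plus l Hl). f_equal.
    apply injective_projections; simpl; unfold scal, plus; simpl; unfold mult; simpl.
    - change (x' - x = (x' - x) * 1 + (y' - y) * 0)%C. ring.
    - change (y' - y = (x' - x) * 0 + (y' - y) * 1)%C. ring. }
  rewrite <- E.
  assert (B : ball (M := prod_UniformSpace C_UniformSpace C_UniformSpace) (x, y) d (x', y')).
  { split; apply C_NormedModule_mixin_compat1; pose proof (cond_pos d).
    - change (Cmod (x' - x) < d). lra.
    - change (Cmod (y' - y) < d). lra. }
  eapply Rle_trans; [exact (K (x', y') B)|]. apply Rmult_le_compat_l; [simpl; lra|].
  apply Cmod_pair_norm_le.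
Qed.

Lemma is_diff2_swap f x y a b : is_diff2 f x y a b -> is_diff2 (swap f) y x b a.
Proof.
  intros H eps He. destruct (H eps He) as [d [Hd0 Hd]]. exists d. split; [assumption|].
  intros y' x' Hy Hx. rewrite (Cplus_comm ((y' - y) * b)), (Rplus_comm (Cmod (y' - y))).
  now apply Hd.
Qed.

Lemma hol2_swap U V f : hol2 U V f -> hol2 V U (swap f).
Proof.
  intros H y x Vy Ux. destruct (H x y Ux Vy) as (a & b & K).
  exists b, a. now apply is_diff2_swap.
Qed.

Lemma is_diff2_continuous f x y a b : is_diff2 f x y a b -> forall eps, 0 < eps ->
  exists d, 0 < d /\ forall x' y', Cmod (x' - x) < d -> Cmod (y' - y) < d ->
    Cmod (f x' y' - f x y) < eps.
Proof.
  intros H eps He. destruct (H 1 Rlt_0_1) as [d [Hd0 Hd]].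
  pose proof (Cmod_ge_0 a) as Ha. pose proof (Cmod_ge_0 b) as Hb.
  set (B := 2 + Cmod a + Cmod b).
  exists (Rmin d (eps / (2 * B))). split.
  { apply Rmin_pos; [assumption|]. apply Rdiv_lt_0_compat; unfold B; lra. }
  intros x' y' Hx Hy.
  assert (X1 := Rlt_le_trans _ _ _ Hx (Rmin_l _ _)).
  assert (X2 := Rlt_le_trans _ _ _ Hx (Rmin_r _ _)).
  assert (Y1 := Rlt_le_trans _ _ _ Hy (Rmin_l _ _)).
  assert (Y2 := Rlt_le_trans _ _ _ Hy (Rmin_r _ _)).
  apply Rlt_div_r in X2; [|unfold B; lra]. apply Rlt_div_r in Y2; [|unfold B; lra].
  specialize (Hd x' y' X1 Y1).
  replace (f x' y' - f x y)%C with
    ((f x' y' - f x y - ((x' - x) * a + (y' - y) * b)) + ((x' - x) * a + (y' - y) * b))%C by ring.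
  eapply Rle_lt_trans; [apply Cmod_triangle|].
  assert (Cmod ((x' - x) * a + (y' - y) * b) <= Cmod (x' - x) * Cmod a + Cmod (y' - y) * Cmod b).
  { eapply Rle_trans; [apply Cmod_triangle|]. rewrite !Cmod_mult. lra. }
  pose proof (Cmod_ge_0 (x' - x)). pose proof (Cmod_ge_0 (y' - y)). unfold B in *. nra.
Qed.

Lemma Cderive_lipschitz (p : C -> C) (s p' : C) : is_Cderive p s p' -> forall e, 0 < e ->
  exists d, 0 < d /\ forall w, Cmod (w - s) < d ->
    Cmod (p w - p s) < e /\ Cmod (p w - p s) <= (1 + Cmod p') * Cmod (w - s).
Proof.
  intros Hp e He.
  destruct (proj1 (is_Cderive_eps _ _ _) Hp 1 Rlt_0_1) as [d [Hd0 Hd]].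
  pose proof (Cmod_ge_0 p') as H0.
  exists (Rmin d (e / (1 + Cmod p'))). split.
  { apply Rmin_pos; [assumption|apply Rdiv_lt_0_compat; lra]. }
  intros w Hw.
  assert (W1 := Rlt_le_trans _ _ _ Hw (Rmin_l _ _)).
  assert (W2 := Rlt_le_trans _ _ _ Hw (Rmin_r _ _)).
  apply Rlt_div_r in W2; [|lra].
  assert (K : Cmod (p w - p s) <= (1 + Cmod p') * Cmod (w - s)); [|split; lra].
  replace (p w - p s)%C with ((p w - p s - (w - s) * p') + (w - s) * p')%C by ring.
  eapply Rle_trans; [apply Cmod_triangle|]. rewrite Cmod_mult. specialize (Hd w W1). lra.
Qed.

Lemma is_Cderive_comp2 (f : C -> C -> C) (p q : C -> C) (s a b p' q' : C) :
  is_diff2 f (p s) (q s) a b -> is_Cderive p s p' -> is_Cderive q s q' ->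
  is_Cderive (fun s => f (p s) (q s)) s (p' * a + q' * b)%C.
Proof.
  intros Hf Hp Hq. apply is_Cderive_eps. intros eps He.
  pose proof (Cmod_ge_0 p') as P0. pose proof (Cmod_ge_0 q') as Q0.
  pose proof (Cmod_ge_0 a) as A0. pose proof (Cmod_ge_0 b) as B0.
  set (L := 2 + Cmod p' + Cmod q').
  set (e1 := eps / (2 * L)). assert (He1 : 0 < e1) by (apply Rdiv_lt_0_compat; unfold L; lra).
  set (e2 := eps / (2 * (1 + Cmod a + Cmod b))).
  assert (He2 : 0 < e2) by (apply Rdiv_lt_0_compat; lra).
  destruct (Hf e1 He1) as [d [Hd0 Hd]].
  destruct (Cderive_lipschitz p s p' Hp d Hd0) as [d1 [Hd1 K1]].
  destruct (Cderive_lipschitz q s q' Hq d Hd0) as [d2 [Hd2 K2]].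
  destruct (proj1 (is_Cderive_eps _ _ _) Hp e2 He2) as [d3 [Hd3 K3]].
  destruct (proj1 (is_Cderive_eps _ _ _) Hq e2 He2) as [d4 [Hd4 K4]].
  exists (Rmin (Rmin d1 d2) (Rmin d3 d4)). split; [repeat apply Rmin_pos; assumption|].
  intros w Hw.
  assert (W12 := Rlt_le_trans _ _ _ Hw (Rmin_l _ _)).
  assert (W34 := Rlt_le_trans _ _ _ Hw (Rmin_r _ _)).
  destruct (K1 w (Rlt_le_trans _ _ _ W12 (Rmin_l _ _))) as [P1 P2].
  destruct (K2 w (Rlt_le_trans _ _ _ W12 (Rmin_r _ _))) as [Q1 Q2].
  assert (P3 := K3 w (Rlt_le_trans _ _ _ W34 (Rmin_l _ _))).
  assert (Q3 := K4 w (Rlt_le_trans _ _ _ W34 (Rmin_r _ _))).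
  specialize (Hd _ _ P1 Q1).
  replace (f (p w) (q w) - f (p s) (q s) - (w - s) * (p' * a + q' * b))%C with
    ((f (p w) (q w) - f (p s) (q s) - ((p w - p s) * a + (q w - q s) * b))
     + ((p w - p s - (w - s) * p') * a + (q w - q s - (w - s) * q') * b))%C by ring.
  eapply Rle_trans; [apply Cmod_triangle|].
  assert (T : Cmod ((p w - p s - (w - s) * p') * a + (q w - q s - (w - s) * q') * b) <=
    eps / 2 * Cmod (w - s)).
  { eapply Rle_trans; [apply Cmod_triangle|]. rewrite !Cmod_mult.
    replace (eps / 2 * Cmod (w - s)) with (e2 * Cmod (w - s) * (1 + Cmod a + Cmod b))
      by (unfold e2; field; lra).
    pose proof (Rmult_le_compat_r (Cmod a) _ _ A0 P3).
    pose proof (Rmult_le_compat_r (Cmod b) _ _ B0 Q3).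
    pose proof (Rmult_le_pos e2 (Cmod (w - s)) (Rlt_le _ _ He2) (Cmod_ge_0 _)). lra. }
  assert (S : e1 * (Cmod (p w - p s) + Cmod (q w - q s)) <= eps / 2 * Cmod (w - s)).
  { replace (eps / 2 * Cmod (w - s)) with (e1 * (L * Cmod (w - s)))
      by (unfold e1; field; unfold L; lra).
    apply Rmult_le_compat_l; [lra|]. unfold L. lra. }
  lra.
Qed.

Lemma is_diff2_partial1 f x y a b : is_diff2 f x y a b -> is_Cderive (fun t => f t y) x a.
Proof.
  intros H. apply is_Cderive_eq with (1 * a + 0 * b)%C; [|ring].
  apply (is_Cderive_comp2 f (fun t => t) (fun _ => y)); [assumption| |].
  - apply is_Cderive_id.
  - apply is_Cderive_const.
Qed.

Lemma is_diff2_partial2 f x y a b : is_diff2 f x y a b -> is_Cderive (fun t => f x t) y b.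
Proof. intros H. exact (is_diff2_partial1 (swap f) y x b a (is_diff2_swap _ _ _ _ _ H)). Qed.

Lemma is_diff2_D1 f x y a b : is_diff2 f x y a b -> D1 f x y = a.
Proof. intros H. apply is_C_derive_unique. exact (is_diff2_partial1 _ _ _ _ _ H). Qed.

Lemma is_diff2_D2 f x y a b : is_diff2 f x y a b -> D2 f x y = b.
Proof. intros H. apply is_C_derive_unique. exact (is_diff2_partial2 _ _ _ _ _ H). Qed.

Lemma hol2_diff U V f x y : hol2 U V f -> U x -> V y -> is_diff2 f x y (D1 f x y) (D2 f x y).
Proof.
  intros H Ux Vy. destruct (H x y Ux Vy) as (a & b & K).
  now rewrite (is_diff2_D1 _ _ _ _ _ K), (is_diff2_D2 _ _ _ _ _ K).
Qed.

(** A bound on a whole bidisk passes to smaller bidisks around nearby points with the same [M],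
    which makes the later estimates uniform in the point. *)
Definition bounded_hol2 (f : C -> C -> C) (x y : C) (s M : R) : Prop :=
  forall x' y', Cmod (x' - x) < s -> Cmod (y' - y) < s ->
    is_diff2 f x' y' (D1 f x' y') (D2 f x' y') /\ Cmod (f x' y') <= M.

Lemma hol2_locally_bounded U V f x y : open U -> open V -> hol2 U V f -> U x -> V y ->
  exists s M, 0 < s /\ bounded_hol2 f x y s M.
Proof.
  intros HU HV Hf Ux Vy.
  destruct (open_disk U x HU Ux) as [d1 [Hd1 K1]]. destruct (open_disk V y HV Vy) as [d2 [Hd2 K2]].
  destruct (is_diff2_continuous _ _ _ _ _ (hol2_diff U V f x y Hf Ux Vy) 1 Rlt_0_1) as [d3 [Hd3 K3]].
  exists (Rmin d3 (Rmin d1 d2)), (Cmod (f x y) + 1). split; [repeat apply Rmin_pos; assumption|].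
  intros x' y' Hx Hy.
  assert (X3 := Rlt_le_trans _ _ _ Hx (Rmin_l _ _)).
  assert (Y3 := Rlt_le_trans _ _ _ Hy (Rmin_l _ _)).
  assert (X1 := Rlt_le_trans _ _ _ (Rlt_le_trans _ _ _ Hx (Rmin_r _ _)) (Rmin_l _ _)).
  assert (Y2 := Rlt_le_trans _ _ _ (Rlt_le_trans _ _ _ Hy (Rmin_r _ _)) (Rmin_r _ _)).
  split; [apply (hol2_diff U V); auto|].
  replace (f x' y') with (f x y + (f x' y' - f x y))%C by ring.
  eapply Rle_trans; [apply Cmod_triangle|]. specialize (K3 x' y' X3 Y3). lra.
Qed.

Lemma bounded_hol2_shift f x y s M x' y' s' : bounded_hol2 f x y s M ->
  Cmod (x' - x) + s' <= s -> Cmod (y' - y) + s' <= s -> bounded_hol2 f x' y' s' M.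
Proof.
  intros H Hx Hy x1 y1 H1 H2. apply H.
  - replace (x1 - x)%C with ((x1 - x') + (x' - x))%C by ring.
    eapply Rle_lt_trans; [apply Cmod_triangle|]. lra.
  - replace (y1 - y)%C with ((y1 - y') + (y' - y))%C by ring.
    eapply Rle_lt_trans; [apply Cmod_triangle|]. lra.
Qed.

(* Taylor's formula for [t |-> f (x + t h) (y + t k)]; the point is that the
   remainder depends on [f] only through the bound [M]. *)
Lemma quadratic_remainder f x y s M h k : 0 < s -> bounded_hol2 f x y s M ->
  Cmod h + Cmod k <= s / 4 ->
  Cmod (f (x + h)%C (y + k)%C - f x y - (h * D1 f x y + k * D2 f x y)) <=
  8 * M / (s * s) * (Cmod h + Cmod k) ^ 2.
Proof.
  intros Hs Hf Hhk. set (N := Cmod h + Cmod k) in *.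
  pose proof (Cmod_ge_0 h) as H0. pose proof (Cmod_ge_0 k) as K0.
  assert (Hz : forall z : C, Cmod (z - z) = 0).
  { intros z. replace (z - z)%C with (RtoC 0) by ring. apply Cmod_0. }
  destruct (Rle_lt_or_eq_dec 0 N) as [HN|HN]; [unfold N; lra| |].
  2: { assert (Eh : h = RtoC 0) by (apply Cmod_eq_0; unfold N in HN; lra).
       assert (Ek : k = RtoC 0) by (apply Cmod_eq_0; unfold N in HN; lra).
       rewrite <- HN, Eh, Ek, !Cplus_0_r.
       replace (f x y - f x y - (0 * D1 f x y + 0 * D2 f x y))%C with (RtoC 0) by ring.
       rewrite Cmod_0. simpl. lra. }
  set (psi := fun t : C => f (x + t * h)%C (y + t * k)%C).
  assert (Hin : forall (z u : C) (t : C), Cmod u <= N -> Cmod t < s / N -> Cmod (z + t * u - z) < s).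
  { intros z u t Hu Ht. replace (z + t * u - z)%C with (t * u)%C by ring. rewrite Cmod_mult.
    apply Rlt_div_r in Ht; [|assumption]. pose proof (Cmod_ge_0 t). nra. }
  assert (Hlin : forall (z u : C) (t : C), is_Cderive (fun t : C => z + t * u)%C t u).
  { intros z u t. apply is_Cderive_eq with (0 + (1 * u + t * 0))%C; [|ring].
    apply is_Cderive_plus; [apply is_Cderive_const|].
    apply (is_Cderive_mult (fun t => t) (fun _ => u)); [apply is_Cderive_id|apply is_Cderive_const]. }
  assert (Hpsi : forall t, Cmod t < s / N ->
    is_Cderive psi t (h * D1 f (x + t * h)%C (y + t * k)%C + k * D2 f (x + t * h)%C (y + t * k)%C)%C
    /\ Cmod (psi t) <= M).
  { intros t Ht. destruct (Hf (x + t * h)%C (y + t * k)%C) as [A B];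
      try (apply Hin; unfold N in *; lra).
    split; [|exact B].
    apply (is_Cderive_comp2 f (fun t => x + t * h)%C (fun t => y + t * k)%C); auto. }
  assert (Hsub0 : forall t : C, (t - 0 = t)%C) by (intros; ring).
  (* The line stays in the bidisk for |t| < s / N. Half of this radius is at least 2 since N <= s /
     4, so r / (r - 1) <= 2 and the remainder at t = 1 is at most 2 M / r^2 = 8 M N^2 / s^2. *)
  set (r := s / (2 * N)).
  assert (Hr2 : 2 <= r) by (apply Rle_div_r; lra).
  assert (Hrs : r < s / N).
  { unfold r. apply (proj1 (Rlt_div_r _ _ _ HN)). replace (s / (2 * N) * N) with (s / 2) by (field; lra). lra. }
  assert (Hdisk : forall t, disk 0 (s / N) t -> cdiff psi t).
  { intros t Ht. unfold disk in Ht. rewrite Hsub0 in Ht. eexists. now apply Hpsi. }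
  pose proof (taylor_remainder psi 0 r (s / N) 1 2 M ltac:(lra) Hdisk) as T.
  rewrite Cmod_1 in T. rewrite !csum_S in T. simpl csum in T.
  rewrite (coef_0 psi 0 r (s / N) ltac:(lra) Hdisk) in T.
  assert (N0 : Cmod 0 < s / N) by (rewrite Cmod_0; apply Rdiv_lt_0_compat; assumption).
  rewrite (coef_1 psi 0 _ r (s / N) ltac:(lra) Hdisk (proj1 (Hpsi 0%C N0))) in T.
  unfold psi in T. rewrite !Cmult_0_l, !Cplus_0_r, !Cplus_0_l, !Cmult_1_l in T.
  replace (f (x + h) (y + k) - (f x y * 1 ^ 0 + (h * D1 f x y + k * D2 f x y) * 1 ^ 1))%C with
    (f (x + h)%C (y + k)%C - f x y - (h * D1 f x y + k * D2 f x y))%C in T by (simpl; ring).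
  eapply Rle_trans; [apply T; [|lra]|].
  - intros t _. rewrite Cplus_0_l. apply Hpsi. rewrite Cmod_circ; lra.
  - assert (HM : 0 <= M) by (eapply Rle_trans; [apply Cmod_ge_0|apply (Hpsi 0%C N0)]).
    assert (r / (r - 1) <= 2) by (apply Rle_div_l; lra).
    apply Rle_trans with (M * 2 * (1 / r) ^ 2).
    + apply Rmult_le_compat_r; [apply pow2_ge_0|]. apply Rmult_le_compat_l; assumption.
    + right. unfold r. field. lra.
Qed.

(** By [quadratic_remainder] the partial derivative is a difference quotient with a fixed step, up
    to an error uniform in the point, and such a difference quotient is continuous. *)
Lemma D1_continuous f x y s M : 0 < s -> bounded_hol2 f x y s M -> forall eps, 0 < eps ->
  exists d, 0 < d /\ forall x' y', Cmod (x' - x) < d -> Cmod (y' - y) < d ->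
    Cmod (D1 f x' y' - D1 f x y) < eps.
Proof.
  intros Hs Hf eps He.
  assert (Hz : forall z : C, Cmod (z - z) = 0).
  { intros z. replace (z - z)%C with (RtoC 0) by ring. apply Cmod_0. }
  assert (HM : 0 <= M).
  { eapply Rle_trans; [apply Cmod_ge_0|apply (Hf x y); rewrite Hz; assumption]. }
  set (Q := 8 * M / (s / 2 * (s / 2))).
  assert (HQ : 0 <= Q).
  { unfold Q. apply Rmult_le_pos; [lra|]. apply Rlt_le, Rinv_0_lt_compat. nra. }
  (* The step is at most s / 8 as [quadratic_remainder] with radius s / 2 demands. The second bound
     holds each of two remainders to a quarter of [eps * h]; the two increments of [f] take the
     other quarters. *)
  set (h := Rmin (s / 8) (eps / (4 * (Q + 1)))).
  assert (Hh : 0 < h) by (apply Rmin_pos; apply Rdiv_lt_0_compat; lra).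
  assert (Hh1 : h <= s / 8) by apply Rmin_l.
  assert (Hh2 : Q * h <= eps / 4).
  { assert (K : h <= eps / (4 * (Q + 1))) by apply Rmin_r. apply Rle_div_r in K; [|lra]. nra. }
  assert (Hq : forall x' y', Cmod (x' - x) < s / 2 -> Cmod (y' - y) < s / 2 ->
    Cmod (f (x' + h)%C y' - f x' y' - h * D1 f x' y') <= Q * h ^ 2).
  { intros x' y' Hx Hy.
    pose proof (quadratic_remainder f x' y' (s / 2) M h 0) as K.
    rewrite Cmod_R, Cmod_0, Rabs_pos_eq, Rplus_0_r, Cplus_0_r in K by lra.
    replace (h * D1 f x' y')%C with (h * D1 f x' y' + 0 * D2 f x' y')%C by ring.
    apply K; try lra. apply (bounded_hol2_shift f x y s M); try assumption; lra. }
  assert (Hc : forall x1, Cmod (x1 - x) < s -> exists d, 0 < d /\ forall x' y',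
    Cmod (x' - x1) < d -> Cmod (y' - y) < d -> Cmod (f x' y' - f x1 y) < eps * h / 4).
  { intros x1 Hx1. destruct (Hf x1 y Hx1) as [K _]; [rewrite Hz; assumption|].
    apply (is_diff2_continuous _ _ _ _ _ K). apply Rdiv_lt_0_compat; nra. }
  destruct (Hc x) as [d1 [Hd1 K1]]; [rewrite Hz; assumption|].
  destruct (Hc (x + h)%C) as [d2 [Hd2 K2]].
  { replace (x + h - x)%C with (RtoC h) by ring. rewrite Cmod_R, Rabs_pos_eq; lra. }
  exists (Rmin (s / 2) (Rmin d1 d2)). split; [repeat apply Rmin_pos; lra|].
  intros x' y' Hx Hy.
  assert (X1 := Rlt_le_trans _ _ _ Hx (Rmin_l _ _)).
  assert (Y1 := Rlt_le_trans _ _ _ Hy (Rmin_l _ _)).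
  assert (X2 := Rlt_le_trans _ _ _ (Rlt_le_trans _ _ _ Hx (Rmin_r _ _)) (Rmin_l _ _)).
  assert (Y2 := Rlt_le_trans _ _ _ (Rlt_le_trans _ _ _ Hy (Rmin_r _ _)) (Rmin_l _ _)).
  assert (X3 := Rlt_le_trans _ _ _ (Rlt_le_trans _ _ _ Hx (Rmin_r _ _)) (Rmin_r _ _)).
  assert (Y3 := Rlt_le_trans _ _ _ (Rlt_le_trans _ _ _ Hy (Rmin_r _ _)) (Rmin_r _ _)).
  assert (A1 := Hq x' y' X1 Y1). assert (A0 := Hq x y ltac:(rewrite Hz; lra) ltac:(rewrite Hz; lra)).
  assert (B1 := K1 x' y' X2 Y2).
  assert (B2 := K2 (x' + h)%C y').
  replace (x' + h - (x + h))%C with (x' - x)%C in B2 by ring. specialize (B2 X3 Y3).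
  apply (Rmult_lt_reg_l h); [assumption|].
  rewrite <- (Rabs_pos_eq h) at 1 by lra. rewrite <- Cmod_R, <- Cmod_mult.
  replace (h * (D1 f x' y' - D1 f x y))%C with
    ((f (x' + h) y' - f (x + h) y) + - (f x' y' - f x y)
     + - (f (x' + h) y' - f x' y' - h * D1 f x' y') + (f (x + h) y - f x y - h * D1 f x y))%C by ring.
  eapply Rle_lt_trans; [apply Cmod_triangle|].
  eapply Rle_lt_trans; [apply Rplus_le_compat_r, Cmod_triangle|].
  eapply Rle_lt_trans; [apply Rplus_le_compat_r, Rplus_le_compat_r, Cmod_triangle|].
  rewrite !Cmod_opp. simpl in A0, A1. nra.
Qed.

Section TwoVariables.
Context (U V : C -> Prop) (HU : open U) (HV : open V).

Lemma hol2_D1_continuous f x y : hol2 U V f -> U x -> V y ->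
  continuous (fun t => D1 f t y) x /\ continuous (D1 f x) y.
Proof.
  intros Hf Ux Vy. destruct (hol2_locally_bounded U V f x y HU HV Hf Ux Vy) as (s & M & Hs & K).
  assert (Hz : forall (z : C) d, 0 < d -> Cmod (z - z) < d).
  { intros z d Hd. replace (z - z)%C with (RtoC 0) by ring. now rewrite Cmod_0. }
  split; apply continuous_C_eps; intros eps He;
    destruct (D1_continuous f x y s M Hs K eps He) as [d [Hd0 Hd]];
    apply locally_C_eps; exists d; (split; [assumption|]); intros w Hw; apply Hd; auto.
Qed.

Lemma hol2_partial1 f y x : hol2 U V f -> U x -> V y -> is_Cderive (fun t => f t y) x (D1 f x y).
Proof. intros Hf Ux Vy. exact (is_diff2_partial1 _ _ _ _ _ (hol2_diff U V f x y Hf Ux Vy)). Qed.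

End TwoVariables.

(* [D1 f x y] is the mean over [t] of [f (x + circ r t) y / circ r t], with [r]
   independent of [(x, y)]; differentiate under the integral sign. *)
Lemma D1_diff U V f x y : open U -> open V -> hol2 U V f -> U x -> V y ->
  exists r rho, 0 < r < rho /\ (forall w, disk x rho w -> U w) /\
    is_diff2 (D1 f) x y (coef (fun t => D1 f t y) x r 1) (coef (fun t => D2 f t y) x r 1).
Proof.
  intros HU HV Hf Ux Vy.
  destruct (hol2_locally_bounded U V f x y HU HV Hf Ux Vy) as (s0 & M & Hs0 & K0).
  destruct (open_disk U x HU Ux) as [d1 [Hd1 K1]].
  set (s := Rmin s0 d1). assert (Hs : 0 < s) by (now apply Rmin_pos).
  assert (Hz : forall (z : C), Cmod (z - z) = 0).
  { intros z. replace (z - z)%C with (RtoC 0) by ring. apply Cmod_0. }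
  assert (K : bounded_hol2 f x y s M).
  { apply (bounded_hol2_shift f x y s0 M); try assumption; rewrite Hz, Rplus_0_l; apply Rmin_l. }
  assert (HsU : forall w, disk x s w -> U w).
  { intros w Hw. apply K1. eapply Rlt_le_trans; [exact Hw|apply Rmin_r]. }
  set (r := s / 4). assert (Hr : 0 < r < s) by (unfold r; lra).
  exists r, s. split; [assumption|]. split; [assumption|].
  assert (HcU : forall t, U (x + circ r t)%C).
  { intros t. apply HsU. unfold disk. replace (x + circ r t - x)%C with (circ r t) by ring.
    rewrite Cmod_circ; lra. }
  assert (C1 : circ_continuous (fun t => D1 f t y) x r).
  { intros t _. apply (hol2_D1_continuous U V); auto. }
  assert (C2 : circ_continuous (fun t => D2 f t y) x r).
  { intros t _. apply (hol2_D1_continuous V U HV HU (swap f)); auto. now apply hol2_swap. }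
  assert (HM : 0 <= M).
  { eapply Rle_trans; [apply Cmod_ge_0|apply (K x y); rewrite Hz; assumption]. }
  set (Q := 8 * M / (s / 2 * (s / 2))).
  assert (HQ : 0 <= Q).
  { unfold Q. apply Rmult_le_pos; [lra|]. apply Rlt_le, Rinv_0_lt_compat. nra. }
  (* The bound s / 16 keeps [N] below (s / 2) / 4, for [quadratic_remainder] around points of the
     circle. The other bound pays for the division by [c] of modulus [r]: then Q N^2 / r <= eps
     N. *)
  intros eps He. set (d := Rmin (s / 16) (eps * r / (2 * (Q + 1)))).
  assert (Hd : 0 < d).
  { apply Rmin_pos; apply Rdiv_lt_0_compat; nra. }
  exists d. split; [assumption|]. intros x' y' Hx Hy.
  assert (X1 : Cmod (x' - x) < s / 16) by (eapply Rlt_le_trans; [exact Hx|apply Rmin_l]).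
  assert (Y1 : Cmod (y' - y) < s / 16) by (eapply Rlt_le_trans; [exact Hy|apply Rmin_l]).
  set (N := Cmod (x' - x) + Cmod (y' - y)).
  pose proof (Cmod_ge_0 (x' - x)) as X0. pose proof (Cmod_ge_0 (y' - y)) as Y0.
  assert (HN : Q * N <= eps * r).
  { assert (A : d <= eps * r / (2 * (Q + 1))) by apply Rmin_r.
    apply Rle_div_r in A; [|lra]. assert (N <= 2 * d) by (unfold N; lra). unfold N in *. nra. }
  (* The circle moves with its centre but keeps its radius, so both values of [D1 f] are averages
     over the same parameter and can be subtracted under the integral sign. *)
  assert (Hcoef : forall x1 y1, Cmod (x1 - x) < s / 16 -> Cmod (y1 - y) < s / 16 ->
    circ_continuous (fun t => f t y1) x1 r /\ D1 f x1 y1 = coef (fun t => f t y1) x1 r 1).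
  { intros x1 y1 Hx1 Hy1.
    assert (B : forall w, disk x1 (s / 2) w -> is_Cderive (fun t => f t y1) w (D1 f w y1)).
    { intros w Hw. unfold disk in Hw.
      destruct (bounded_hol2_shift f x y s M x1 y1 (s / 2) K ltac:(lra) ltac:(lra) w y1) as [P _];
        [assumption|rewrite Hz; lra|]. exact (is_diff2_partial1 _ _ _ _ _ P). }
    assert (B' : forall w, disk x1 (s / 2) w -> cdiff (fun t => f t y1) w).
    { intros w Hw. eexists. now apply B. }
    split.
    - apply (disk_circ_continuous _ _ _ (s / 2)); [unfold r; lra|assumption].
    - symmetry. apply (coef_1 _ x1 _ r (s / 2)); [unfold r; lra|assumption|].
      apply B. unfold disk. rewrite Hz. lra. }
  destruct (Hcoef x' y' X1 Y1) as [C3 ->].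
  destruct (Hcoef x y) as [C4 ->]; [rewrite Hz; lra..|].
  pose proof (is_CRInt_minus _ _ _ _ _ _
    (is_CRInt_minus _ _ _ _ _ _ (coef_correct _ x' r 1 (proj1 Hr) C3)
      (coef_correct _ x r 1 (proj1 Hr) C4))
    (is_CRInt_plus _ _ _ _ _ _ (is_CRInt_Cmult (x' - x) _ _ _ _ (coef_correct _ x r 1 (proj1 Hr) C1))
       (is_CRInt_Cmult (y' - y) _ _ _ _ (coef_correct _ x r 1 (proj1 Hr) C2)))) as I.
  cbv beta in I. fold N.
  replace (eps * N) with ((1 - 0) * (eps * N)) by ring.
  apply (is_CRInt_bound _ 0 1 _ _ ltac:(lra)) with (2 := I). intros t _.
  set (c := circ r t).
  pose proof (quadratic_remainder f (x + c)%C y (s / 2) M (x' - x) (y' - y) ltac:(lra)) as T.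
  assert (Hc : Cmod c = r) by (apply Cmod_circ; lra).
  replace (x + c + (x' - x))%C with (x' + c)%C in T by ring.
  replace (y + (y' - y))%C with y' in T by ring.
  fold N Q in T.
  match goal with |- Cmod ?e <= _ =>
    replace e with ((f (x' + c)%C y' - f (x + c)%C y -
      ((x' - x) * D1 f (x + c)%C y + (y' - y) * D2 f (x + c)%C y)) * (/ c) ^ 1)%C by ring end.
  rewrite Cmod_mult. simpl Cpow. rewrite Cmult_1_r, Cmod_inv by (apply circ_neq_0; lra).
  rewrite Hc. apply Rle_div_l; [lra|].
  eapply Rle_trans; [apply T|].
  - apply (bounded_hol2_shift f x y s M _ _ _ K).
    + replace (x + c - x)%C with c by ring. rewrite Hc. unfold r. lra.
    + rewrite Hz. lra.
  - unfold N. lra.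
  - assert (0 <= N) by (unfold N; lra). simpl. nra.
Qed.

Section Partial.
Context (U V : C -> Prop) (HU : open U) (HV : open V).

Lemma hol2_D1 f : hol2 U V f -> hol2 U V (D1 f).
Proof.
  intros Hf x y Ux Vy. destruct (D1_diff U V f x y HU HV Hf Ux Vy) as (r & rho & _ & _ & K).
  eexists _, _. exact K.
Qed.

(** Functions are total while identities between derivatives hold on U x V only; differentiating
    such an identity uses that a derivative is local and [U] is open. *)
Lemma D1_ext f g x y : (forall x y, U x -> V y -> f x y = g x y) -> hol2 U V f -> U x -> V y ->
  D1 f x y = D1 g x y.
Proof.
  intros E Hf Ux Vy. symmetry. apply is_C_derive_unique.
  destruct (open_disk U x HU Ux) as [d1 [Hd1 K1]].
  apply is_Cderive_eps. intros eps He.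
  destruct (proj1 (is_Cderive_eps _ _ _) (hol2_partial1 U V f y x Hf Ux Vy) eps He) as [d [Hd0 Hd]].
  exists (Rmin d d1). split; [now apply Rmin_pos|]. intros w Hw.
  rewrite <- !E; try assumption.
  - apply Hd. eapply Rlt_le_trans; [exact Hw|apply Rmin_l].
  - apply K1. eapply Rlt_le_trans; [exact Hw|apply Rmin_r].
Qed.

End Partial.

Section Mixed.
Context (U V : C -> Prop) (HU : open U) (HV : open V).

Lemma hol2_D2 f : hol2 U V f -> hol2 U V (D2 f).
Proof.
  intros Hf. apply (hol2_swap V U (swap (D2 f))).
  apply (hol2_D1 V U HV HU (swap f)). now apply hol2_swap.
Qed.

Lemma D2_ext f g x y : (forall x y, U x -> V y -> f x y = g x y) -> hol2 U V f -> U x -> V y ->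
  D2 f x y = D2 g x y.
Proof.
  intros E Hf Ux Vy. apply (D1_ext V U HV (swap f) (swap g) y x); auto.
  - intros; now apply E.
  - now apply hol2_swap.
Qed.

(** Differentiation under the integral sign in [D1_diff] gives the left side as the first
    coefficient of [D2 f] in the first variable, which is the right side by [coef_1]. *)
Lemma D2_D1 f x y : hol2 U V f -> U x -> V y -> D2 (D1 f) x y = D1 (D2 f) x y.
Proof.
  intros Hf Ux Vy. destruct (D1_diff U V f x y HU HV Hf Ux Vy) as (r & rho & Hr & HD & K).
  rewrite (is_diff2_D2 _ _ _ _ _ K). pose proof (hol2_D2 f Hf) as Hf2.
  apply (coef_1 (fun t => D2 f t y) x _ r rho Hr).
  - intros w Hw. eexists. apply (hol2_partial1 U V); auto.
  - apply (hol2_partial1 U V); auto.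
Qed.

Lemma hol2_iter_D2 f l : hol2 U V f -> hol2 U V (Nat.iter l D2 f).
Proof. intros Hf. induction l; simpl; [assumption|now apply hol2_D2]. Qed.

Lemma hol2_iter_D1 f k : hol2 U V f -> hol2 U V (Nat.iter k D1 f).
Proof. intros Hf. induction k; simpl; [assumption|now apply (hol2_D1 U V HU HV)]. Qed.

Lemma iter_D2_D1 f l : hol2 U V f -> forall x y, U x -> V y ->
  Nat.iter l D2 (D1 f) x y = D1 (Nat.iter l D2 f) x y.
Proof.
  intros Hf. induction l as [|l IH]; intros x y Ux Vy; [reflexivity|]. simpl.
  rewrite (D2_ext _ _ x y IH) by (try assumption; apply hol2_iter_D2, (hol2_D1 U V HU HV), Hf).
  apply D2_D1; auto. now apply hol2_iter_D2.
Qed.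

Lemma iter_D1_ext f g k : (forall x y, U x -> V y -> f x y = g x y) -> hol2 U V f ->
  forall x y, U x -> V y -> Nat.iter k D1 f x y = Nat.iter k D1 g x y.
Proof.
  intros E Hf. induction k as [|k IH]; intros x y Ux Vy; [now apply E|]. simpl.
  apply (D1_ext U V HU); auto. now apply hol2_iter_D1.
Qed.

(** [D12] applies the derivatives in the second variable first, so a [D1] placed inside must be
    commuted outwards past all of them. *)
Lemma D12_D1 f k l x y : hol2 U V f -> U x -> V y -> D12 k l (D1 f) x y = D12 (S k) l f x y.
Proof.
  intros Hf Ux Vy. unfold D12.
  rewrite (iter_D1_ext _ _ k (iter_D2_D1 f l Hf)) by
    (try assumption; apply hol2_iter_D2, (hol2_D1 U V HU HV), Hf).
  now rewrite Nat.iter_succ_r.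
Qed.

Lemma D12_D2 f k l : D12 k l (D2 f) = D12 k (S l) f.
Proof. unfold D12. now rewrite Nat.iter_succ_r. Qed.

End Mixed.

Lemma open_disk_set z rho : open (disk z rho).
Proof.
  intros s Hs. unfold disk in Hs. apply locally_C_eps. exists (rho - Cmod (s - z)).
  split; [lra|]. intros w Hw. unfold disk. replace (w - z)%C with ((w - s) + (s - z))%C by ring.
  eapply Rle_lt_trans; [apply Cmod_triangle|]. lra.
Qed.

Lemma is_Cderive_C_derive f z : cdiff f z -> is_Cderive f z (C_derive f z).
Proof. intros [l Hl]. now rewrite (is_C_derive_unique f z l Hl). Qed.

(** Read as a function of two variables that ignores the second one, [f] falls under [hol2_D1]. *)
Lemma cdiff_C_derive U f : open U -> (forall z, U z -> cdiff f z) ->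
  forall z, U z -> cdiff (C_derive f) z.
Proof.
  intros HU Hf z Uz.
  assert (H : hol2 U (fun _ => True) (fun x _ => f x)).
  { intros x y Ux _. destruct (Hf x Ux) as [l Hl]. exists l, 0%C. intros eps He.
    destruct (proj1 (is_Cderive_eps _ _ _) Hl eps He) as [d [Hd0 Hd]].
    exists d. split; [assumption|]. intros x' y' Hx _. rewrite Cmult_0_r, Cplus_0_r.
    eapply Rle_trans; [now apply Hd|]. pose proof (Cmod_ge_0 (y' - y)). nra. }
  assert (HT : open (fun _ : C => True)) by apply open_true.
  exists (D1 (D1 (fun x _ => f x)) z 0%C).
  exact (hol2_partial1 U _ _ 0%C z (hol2_D1 U _ HU HT _ H) Uz Logic.I).
Qed.

Lemma hol2_subset U V U' f : (forall x, U' x -> U x) -> hol2 U V f -> hol2 U' V f.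
Proof. intros H Hf x y Ux Vy. apply Hf; auto. Qed.

(** * Comparison of Taylor coefficients *)

Section Comparison.

(* Instantiated with [|a| <= b] for the domination and with [a = b] for the
   agreement of the approximations with the exact solution. *)
Context (rel : C -> C -> Prop).
Context (rel_plus : forall a b c d, rel a b -> rel c d -> rel (a + c)%C (b + d)%C).
Context (rel_mult : forall a b c d, rel a b -> rel c d -> rel (a * c)%C (b * d)%C).
Context (rel_scale : forall n a b, rel a b <-> rel (INR (S n) * a)%C (INR (S n) * b)%C).
Context (u : C) (r rho : R) (Hr : 0 < r < rho).

Definition hol (f : C -> C) : Prop := forall s, disk u rho s -> cdiff f s.

Definition rel_upto (n : nat) (f g : C -> C) : Prop :=
  forall k, (k <= n)%nat -> rel (coef f u r k) (coef g u r k).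

Lemma circ_in_disk t : disk u rho (u + circ r t)%C.
Proof. unfold disk. replace (u + circ r t - u)%C with (circ r t) by ring. rewrite Cmod_circ; lra. Qed.

Lemma hol_C_derive f : hol f -> hol (C_derive f).
Proof. intros Hf. exact (cdiff_C_derive _ f (open_disk_set u rho) Hf). Qed.

Lemma hol_mult f g : hol f -> hol g -> hol (fun s => f s * g s)%C.
Proof. intros Hf Hg s Hs. apply cdiff_mult; auto. Qed.

Lemma hol_circ_continuous f : hol f -> circ_continuous f u r.
Proof. intros Hf. now apply (disk_circ_continuous f u r rho). Qed.

Lemma coef_derivative f df k : hol f -> (forall s, disk u rho s -> is_Cderive f s (df s)) ->
  coef df u r k = (INR (S k) * coef f u r (S k))%C.
Proof.
  intros Hf Hd.
  assert (E : forall s, disk u rho s -> df s = C_derive f s).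
  { intros s Hs. symmetry. apply is_C_derive_unique, Hd, Hs. }
  rewrite (coef_ext df (C_derive f)) by (intros; apply E, circ_in_disk).
  apply coef_deriv; [lra| |now apply hol_circ_continuous, hol_C_derive].
  intros t _. apply is_Cderive_C_derive, Hf, circ_in_disk.
Qed.

(** Coefficient k of the derivative is k + 1 times coefficient k + 1 of the function, so one order
    is traded for one derivative. Both directions serve: one to differentiate the hypotheses of an
    induction, the other to conclude, where [rel_scale] divides by k + 1. *)
Lemma rel_upto_derivative n f g df dg : hol f -> hol g ->
  (forall s, disk u rho s -> is_Cderive f s (df s)) ->
  (forall s, disk u rho s -> is_Cderive g s (dg s)) ->
  rel_upto (S n) f g <-> rel (f u) (g u) /\ rel_upto n df dg.
Proof.
  intros Hf Hg Hdf Hdg. split.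
  - intros H. split.
    + rewrite <- (coef_0 f u r rho Hr Hf), <- (coef_0 g u r rho Hr Hg). apply H. lia.
    + intros k Hk. rewrite (coef_derivative f df), (coef_derivative g dg) by assumption.
      apply rel_scale, H. lia.
  - intros [H0 H] [|k] Hk.
    + now rewrite (coef_0 f u r rho Hr Hf), (coef_0 g u r rho Hr Hg).
    + apply (rel_scale k). rewrite <- (coef_derivative f df), <- (coef_derivative g dg) by assumption.
      apply H. lia.
Qed.

Lemma rel_upto_0 f g : hol f -> hol g -> rel_upto 0 f g <-> rel (f u) (g u).
Proof.
  intros Hf Hg. rewrite <- (coef_0 f u r rho Hr Hf), <- (coef_0 g u r rho Hr Hg). split.
  - intros H. apply H. lia.
  - intros H k Hk. now replace k with 0%nat by lia.
Qed.

Lemma rel_upto_le n m f g : (m <= n)%nat -> rel_upto n f g -> rel_upto m f g.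
Proof. intros Hmn H k Hk. apply H. lia. Qed.

Lemma rel_upto_plus n f1 f2 g1 g2 : hol f1 -> hol f2 -> hol g1 -> hol g2 ->
  rel_upto n f1 g1 -> rel_upto n f2 g2 ->
  rel_upto n (fun s => f1 s + f2 s)%C (fun s => g1 s + g2 s)%C.
Proof.
  intros F1 F2 G1 G2 H1 H2 k Hk.
  rewrite !coef_plus by (lra || now apply hol_circ_continuous). auto.
Qed.

(** The product rule replaces the convolution of coefficients; the factors are kept general because
    derivatives appear as new factors. *)
Lemma rel_upto_mult n : forall f1 f2 g1 g2, hol f1 -> hol f2 -> hol g1 -> hol g2 ->
  rel_upto n f1 g1 -> rel_upto n f2 g2 ->
  rel_upto n (fun s => f1 s * f2 s)%C (fun s => g1 s * g2 s)%C.
Proof.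
  induction n as [|n IH]; intros f1 f2 g1 g2 F1 F2 G1 G2 H1 H2.
  - apply rel_upto_0; try (now apply hol_mult). apply rel_upto_0 in H1, H2; auto.
  - assert (D : forall f, hol f -> forall s, disk u rho s -> is_Cderive f s (C_derive f s))
      by (intros f Hf s Hs; now apply is_Cderive_C_derive, Hf).
    assert (M1 := rel_upto_le (S n) n _ _ (Nat.le_succ_diag_r n) H1).
    assert (M2 := rel_upto_le (S n) n _ _ (Nat.le_succ_diag_r n) H2).
    apply (rel_upto_derivative n _ _ _ _ F1 G1 (D _ F1) (D _ G1)) in H1.
    apply (rel_upto_derivative n _ _ _ _ F2 G2 (D _ F2) (D _ G2)) in H2.
    destruct H1 as [A1 B1]. destruct H2 as [A2 B2].
    assert (F1' := hol_C_derive _ F1). assert (F2' := hol_C_derive _ F2).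
    assert (G1' := hol_C_derive _ G1). assert (G2' := hol_C_derive _ G2).
    apply (rel_upto_derivative n _ _ (fun s => C_derive f1 s * f2 s + f1 s * C_derive f2 s)%C
      (fun s => C_derive g1 s * g2 s + g1 s * C_derive g2 s)%C); try (now apply hol_mult).
    + intros s Hs. apply is_Cderive_mult; auto.
    + intros s Hs. apply is_Cderive_mult; auto.
    + split; [auto|]. apply rel_upto_plus; try (now apply hol_mult); apply IH; auto.
Qed.

Section Composition.
Context (V W : C -> Prop) (HV : open V) (HW : open W) (p q : C -> C).
Context (Hp : hol p) (Hq : hol q).
Context (HpV : forall s, disk u rho s -> V (p s)) (HqW : forall s, disk u rho s -> W (q s)).

Lemma is_Cderive_along X f c : hol2 (disk u rho) X f -> hol c ->
  (forall s, disk u rho s -> X (c s)) -> forall s, disk u rho s ->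
  is_Cderive (fun s => f s (c s)) s (D1 f s (c s) + D2 f s (c s) * C_derive c s)%C.
Proof.
  intros Hf Hc HX s Hs.
  apply is_Cderive_eq with (1 * D1 f s (c s) + C_derive c s * D2 f s (c s))%C; [|ring].
  apply (is_Cderive_comp2 f (fun s => s) c).
  - apply (hol2_diff (disk u rho) X); auto.
  - apply is_Cderive_id.
  - now apply is_Cderive_C_derive, Hc.
Qed.

Lemma hol_along X f c : hol2 (disk u rho) X f -> hol c ->
  (forall s, disk u rho s -> X (c s)) -> hol (fun s => f s (c s)).
Proof. intros Hf Hc HX s Hs. eexists. now apply (is_Cderive_along X). Qed.

(** The derivative of f(s, p(s)) is made of [D1 f] and [D2 f] along the same [p], the latter times
    p'. Both inherit the hypothesis on all derivatives at the base point, so an induction with [f]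
    and [g] general replaces the formula for higher derivatives of a composition. *)
Lemma rel_upto_along n : forall f g, hol2 (disk u rho) V f -> hol2 (disk u rho) W g ->
  (forall k l, rel (D12 k l f u (p u)) (D12 k l g u (q u))) ->
  rel_upto n p q -> rel_upto n (fun s => f s (p s)) (fun s => g s (q s)).
Proof.
  assert (HD := open_disk_set u rho).
  assert (Hu : disk u rho u).
  { unfold disk. replace (u - u)%C with (RtoC 0) by ring. rewrite Cmod_0. lra. }
  assert (Vp := HpV u Hu). assert (Wq := HqW u Hu).
  induction n as [|n IH]; intros f g Hf Hg Hrel Hpq.
  - apply rel_upto_0; [now apply (hol_along V)|now apply (hol_along W)|]. exact (Hrel 0%nat 0%nat).
  - assert (Hpq' := rel_upto_le (S n) n _ _ (Nat.le_succ_diag_r n) Hpq).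
    assert (Hf1 := hol2_D1 _ _ HD HV f Hf). assert (Hf2 := hol2_D2 _ _ HD HV f Hf).
    assert (Hg1 := hol2_D1 _ _ HD HW g Hg). assert (Hg2 := hol2_D2 _ _ HD HW g Hg).
    apply (rel_upto_derivative n _ _ _ _ (hol_along V f p Hf Hp HpV) (hol_along W g q Hg Hq HqW)
      (is_Cderive_along V f p Hf Hp HpV) (is_Cderive_along W g q Hg Hq HqW)).
    split; [exact (Hrel 0%nat 0%nat)|].
    assert (Hp' := hol_C_derive p Hp). assert (Hq' := hol_C_derive q Hq).
    assert (P1 := hol_along V _ p Hf1 Hp HpV). assert (P2 := hol_along V _ p Hf2 Hp HpV).
    assert (Q1 := hol_along W _ q Hg1 Hq HqW). assert (Q2 := hol_along W _ q Hg2 Hq HqW).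
    apply rel_upto_plus; try assumption; try (now apply hol_mult).
    + apply IH; try assumption. intros k l.
      rewrite (D12_D1 _ _ HD HV f), (D12_D1 _ _ HD HW g) by assumption. apply Hrel.
    + apply rel_upto_mult; try assumption.
      * apply IH; try assumption. intros k l. rewrite !D12_D2. apply Hrel.
      * apply (rel_upto_derivative n p q); try assumption;
          intros s Hs; apply is_Cderive_C_derive; auto.
Qed.

End Composition.

End Comparison.

(** * Approximation systems *)

Lemma rhs_hol2 A i : hol2 (dom A) (rhs_dom A i) (rhs A i).
Proof. exact (holomorphic2_hol2 _ _ _ (rhs_holomorphic A i)). Qed.

Lemma approx_rec_rhs_dom A m i x : proper A -> dom A x -> rhs_dom A i (approx_rec A m (S i) x).
Proof.
  (* [approx_rec A m (S i)] is g_{i+1}^{[n]} with n = m + i + 1. *)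
  intros HA Hx. pose proof (HA (m + S i)%nat i ltac:(lia) x Hx) as H. unfold approx in H.
  now replace (m + S i - S i)%nat with m in H by lia.
Qed.

Lemma cdiff_rhs_along A i p : (forall x, dom A x -> cdiff p x) ->
  (forall x, dom A x -> rhs_dom A i (p x)) ->
  forall t, dom A t -> cdiff (fun t => rhs A i t (p t)) t.
Proof.
  intros Hp HV t Ht. destruct (Hp t Ht) as [l Hl]. eexists.
  apply (is_Cderive_comp2 (rhs A i) (fun t => t)); [|apply is_Cderive_id|exact Hl].
  apply (hol2_diff (dom A) (rhs_dom A i)); [apply rhs_hol2|assumption|auto].
Qed.

Lemma is_Cderive_picard A i p : (forall x, dom A x -> cdiff p x) ->
  (forall x, dom A x -> rhs_dom A i (p x)) ->
  let F x := (cst A i + contour_int (dom A) (fun t => rhs A i t (p t)) (base A) x)%C in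
  F (base A) = cst A i /\ forall x, dom A x -> is_Cderive F x (rhs A i x (p x)).
Proof.
  intros Hp HV F.
  destruct (contour_int_primitive _ _ (dom_open A) (cdiff_rhs_along A i p Hp HV) (base A)
    (dom_connected A) (dom_simply_connected A) (base_dom A)) as [H0 H1].
  split.
  - unfold F. rewrite H0. ring.
  - intros x Hx. apply is_Cderive_eq with (0 + rhs A i x (p x))%C; [|ring].
    apply (is_Cderive_plus (fun _ => cst A i)); [apply is_Cderive_const|]. now apply H1.
Qed.

Lemma approx_rec_holomorphic A m i : proper A ->
  (forall x, dom A x -> cdiff (approx_rec A m i) x) /\ approx_rec A m i (base A) = cst A i.
Proof.
  intros HA. revert i. induction m as [|m IH]; intros i.
  - split; [|reflexivity]. intros x _. eexists. apply is_Cderive_const.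
  - destruct (is_Cderive_picard A i (approx_rec A m (S i)) (proj1 (IH (S i)))
      (fun x => approx_rec_rhs_dom A m i x HA)) as [H0 H1].
    split; [|exact H0]. intros x Hx. eexists. exact (H1 x Hx).
Qed.

Lemma approx_rec_derivative A m i x : proper A -> dom A x ->
  is_Cderive (approx_rec A (S m) i) x (rhs A i x (approx_rec A m (S i) x)).
Proof.
  intros HA Hx.
  exact (proj2 (is_Cderive_picard A i _ (proj1 (approx_rec_holomorphic A m (S i) HA))
    (fun x => approx_rec_rhs_dom A m i x HA)) x Hx).
Qed.

(** [Cle] forces [b] to be real, hence real and non-negative; this makes the relation stable under
    products. *)
Definition majorizes (a b : C) : Prop := Cle (Cmod a) b.

Lemma majorizes_iff a b : majorizes a b <-> exists x : R, b = RtoC x /\ Cmod a <= x.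
Proof.
  unfold majorizes, Cle. simpl. split.
  - intros [H1 H2]. exists (Re b). split; [|assumption].
    apply injective_projections; simpl; [reflexivity|now symmetry].
  - intros (x & -> & Hx). now split.
Qed.

Lemma majorizes_plus a b c d : majorizes a b -> majorizes c d -> majorizes (a + c)%C (b + d)%C.
Proof.
  rewrite !majorizes_iff. intros (x & -> & Hx) (y & -> & Hy). exists (x + y). split.
  - now rewrite RtoC_plus.
  - eapply Rle_trans; [apply Cmod_triangle|]. lra.
Qed.

Lemma majorizes_mult a b c d : majorizes a b -> majorizes c d -> majorizes (a * c)%C (b * d)%C.
Proof.
  rewrite !majorizes_iff. intros (x & -> & Hx) (y & -> & Hy). exists (x * y). split.
  - now rewrite RtoC_mult.
  - rewrite Cmod_mult. apply Rmult_le_compat; try apply Cmod_ge_0; assumption.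
Qed.

Lemma INR_S_pos n : 0 < INR (S n).
Proof. apply lt_0_INR. lia. Qed.

Lemma majorizes_scale n a b : majorizes a b <-> majorizes (INR (S n) * a)%C (INR (S n) * b)%C.
Proof.
  pose proof (INR_S_pos n) as Hn. rewrite !majorizes_iff. split.
  - intros (x & -> & Hx). exists (INR (S n) * x). split; [now rewrite RtoC_mult|].
    rewrite Cmod_mult, Cmod_R, Rabs_pos_eq by lra. nra.
  - intros (x & E & Hx). exists (x / INR (S n)).
    assert (Hn0 : RtoC (INR (S n)) <> 0%C) by (intros F; apply RtoC_inj in F; lra). split.
    + rewrite RtoC_div, <- E by lra. field. assumption.
    + apply Rle_div_r; [assumption|]. rewrite Cmod_mult, Cmod_R, Rabs_pos_eq in Hx by lra. lra.
Qed.

Lemma eq_scale n (a b : C) : a = b <-> (INR (S n) * a = INR (S n) * b)%C.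
Proof.
  pose proof (INR_S_pos n) as Hn.
  assert (Hn0 : RtoC (INR (S n)) <> 0%C) by (intros F; apply RtoC_inj in F; lra).
  split; [now intros ->|]. intros E.
  replace a with (/ INR (S n) * (INR (S n) * a))%C by (field; assumption).
  rewrite E. field. assumption.
Qed.

(** * Comparison of two approximation systems *)

Section Solutions.
Context (rel : C -> C -> Prop).
Context (rel_plus : forall a b c d, rel a b -> rel c d -> rel (a + c)%C (b + d)%C).
Context (rel_mult : forall a b c d, rel a b -> rel c d -> rel (a * c)%C (b * d)%C).
Context (rel_scale : forall n a b, rel a b <-> rel (INR (S n) * a)%C (INR (S n) * b)%C).
Context (A B : approx_system) (u : C) (r rho : R) (Hr : 0 < r < rho).
Context (HA : forall x, disk u rho x -> dom A x).
Context (HB : forall x, disk u rho x -> dom B x).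
Context (Hcst : forall i, rel (cst A i) (cst B i)).
Context (Hrhs : forall i k l,
  rel (D12 k l (rhs A i) u (cst A (S i))) (D12 k l (rhs B i) u (cst B (S i)))).

(** Each integration gains one order. [p] and [q] stand for the functions of index i + 1, so that
    exact solutions and approximations can both be inserted. *)
Lemma rel_upto_step n i f p g q :
  (forall x, dom A x -> cdiff p x) -> (forall x, dom B x -> cdiff q x) ->
  (forall x, dom A x -> rhs_dom A i (p x)) -> (forall x, dom B x -> rhs_dom B i (q x)) ->
  p u = cst A (S i) -> q u = cst B (S i) ->
  f u = cst A i -> g u = cst B i ->
  (forall x, dom A x -> is_Cderive f x (rhs A i x (p x))) ->
  (forall x, dom B x -> is_Cderive g x (rhs B i x (q x))) ->
  rel_upto rel u r n p q -> rel_upto rel u r (S n) f g.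
Proof.
  intros Hp Hq Vp Vq p0 q0 f0 g0 Hf Hg Hpq.
  apply (rel_upto_derivative rel rel_scale u r rho Hr n f g
    (fun x => rhs A i x (p x)) (fun x => rhs B i x (q x))).
  - intros s Hs. eexists. apply Hf; auto.
  - intros s Hs. eexists. apply Hg; auto.
  - auto.
  - auto.
  - split; [rewrite f0, g0; apply Hcst|].
    apply (rel_upto_along rel rel_plus rel_mult rel_scale u r rho Hr
      (rhs_dom A i) (rhs_dom B i)); try apply rhs_dom_open; try (intros s Hs; auto; fail).
    + apply (hol2_subset (dom A)); [assumption|apply rhs_hol2].
    + apply (hol2_subset (dom B)); [assumption|apply rhs_hol2].
    + intros k l. rewrite p0, q0. apply Hrhs.

Qed.

End Solutions.

Lemma AS_spec A g i : is_AS_for A g ->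
  (forall x, dom A x -> cdiff (g i) x) /\ (forall x, dom A x -> rhs_dom A i (g (S i) x)) /\
  g i (base A) = cst A i /\ (forall x, dom A x -> is_Cderive (g i) x (rhs A i x (g (S i) x))).
Proof.
  intros H. destruct (H i) as (H1 & H2 & H3 & H4).
  split; [exact H1|]. split; [exact H2|]. split; [exact H3|].
  intros x Hx. rewrite <- (H4 x Hx). apply is_Cderive_C_derive. now apply H1.
Qed.

(** * Error of the approximations of a dominated system *)

Section Domination.
Context (At A : approx_system) (gt g : nat -> C -> C).
Context (hAt : is_AS_for At gt) (hA : is_AS_for A g) (hproper : proper A)
  (hdominates : dominates At A) (hdom : forall x, dom At x <-> dom A x).
Context (r rho : R) (Hr : 0 < r < rho) (hdisk : forall x, disk (base A) rho x -> dom A x).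

Let base_eq : base At = base A.
Proof. apply hdominates. Qed.

Let disk_At x : disk (base A) rho x -> dom At x.
Proof. intros Hx. now apply hdom, hdisk. Qed.

(** Order n + 1 at index i rests on order n at index i + 1, and order 0 on the constants, so the
    induction is on the order with the index general. *)
Lemma solution_rel_upto rel (A' B : approx_system) (f h : nat -> C -> C) n :
  (forall a b c d, rel a b -> rel c d -> rel (a + c)%C (b + d)%C) ->
  (forall a b c d, rel a b -> rel c d -> rel (a * c)%C (b * d)%C) ->
  (forall n a b, rel a b <-> rel (INR (S n) * a)%C (INR (S n) * b)%C) ->
  base A' = base A -> base B = base A ->
  (forall x, disk (base A) rho x -> dom A' x) -> (forall x, disk (base A) rho x -> dom B x) ->
  (forall i, rel (cst A' i) (cst B i)) ->
  (forall i k l, rel (D12 k l (rhs A' i) (base A) (cst A' (S i)))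
                     (D12 k l (rhs B i) (base A) (cst B (S i)))) ->
  is_AS_for A' f -> is_AS_for B h ->
  forall i, rel_upto rel (base A) r n (f i) (h i).
Proof.
  intros rp rm rs EA EB HA HB Hc Hrhs Hf Hh. induction n as [|n IH]; intros i;
    destruct (AS_spec A' f i Hf) as (F1 & F2 & F3 & F4);
    destruct (AS_spec B h i Hh) as (G1 & G2 & G3 & G4); rewrite EA in F3; rewrite EB in G3.
  - apply (rel_upto_0 rel _ r rho Hr); [intros s Hs; auto..|]. rewrite F3, G3. apply Hc.
  - destruct (AS_spec A' f (S i) Hf) as (F1' & _ & F3' & _).
    destruct (AS_spec B h (S i) Hh) as (G1' & _ & G3' & _).
    rewrite EA in F3'. rewrite EB in G3'.
    apply (rel_upto_step rel rp rm rs A' B (base A) r rho Hr HA HB Hc Hrhs n i _ (f (S i)) _ (h (S i)));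
      auto.
Qed.

(** Comparing the dominating system with itself expresses that its solution has real, non-negative
    Taylor coefficients. *)
Lemma majorant_self k i : majorizes (coef (gt i) (base A) r k) (coef (gt i) (base A) r k).
Proof.
  pose proof hdominates as ((Hc & Hd) & _ & _).
  assert (Hself : forall a, Cle 0 a -> majorizes a a).
  { intros a [H1 H2]. apply majorizes_iff. exists (Re a). simpl in *.
    assert (E : a = RtoC (Re a)) by (apply injective_projections; simpl; auto).
    split; [exact E|]. rewrite E at 1. rewrite Cmod_R, Rabs_pos_eq; [apply Rle_refl|exact H1]. }
  apply (solution_rel_upto majorizes At At gt gt k majorizes_plus majorizes_mult majorizes_scale);
    auto.
  intros j p q. rewrite <- base_eq. auto.
Qed.

Lemma majorant_solution k i : majorizes (coef (g i) (base A) r k) (coef (gt i) (base A) r k).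
Proof.
  pose proof hdominates as (_ & _ & Hc & Hd).
  apply (solution_rel_upto majorizes A At g gt k majorizes_plus majorizes_mult majorizes_scale);
    auto.
  intros j p q. rewrite <- base_eq at 2. apply Hd.
Qed.

(** Induction on [m] for all indices and orders. For [m = 0] the approximation is constant, and its
    zero coefficients lie below the non-negative ones of [gt i] given by [majorant_self]. *)
Lemma majorant_approx k m i :
  majorizes (coef (approx_rec A m i) (base A) r k) (coef (gt i) (base A) r k).
Proof.
  pose proof hdominates as (_ & _ & Hc & Hd). revert i k. induction m as [|m IH]; intros i k.
  - simpl approx_rec. rewrite coef_const by lra. destruct k as [|k].
    + destruct (AS_spec At gt i hAt) as (F1 & _ & F3 & _).
      rewrite (coef_0 (gt i) (base A) r rho Hr) by auto. rewrite <- base_eq, F3. apply Hc.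
    + generalize (majorant_self (S k) i). rewrite !majorizes_iff. intros (x & -> & Hx).
      exists x. split; [reflexivity|]. rewrite Cmod_0.
      eapply Rle_trans; [apply Cmod_ge_0|exact Hx].
  - destruct (AS_spec At gt i hAt) as (F1 & F2 & F3 & F4).
    destruct (AS_spec At gt (S i) hAt) as (F1' & _ & F3' & _).
    rewrite base_eq in F3, F3'.
    apply (rel_upto_step majorizes majorizes_plus majorizes_mult majorizes_scale A At (base A) r rho Hr
      hdisk disk_At Hc) with (n := k) (i := i) (p := approx_rec A m (S i)) (q := gt (S i)); auto.
    + intros j p q. rewrite <- base_eq at 2. apply Hd.
    + apply approx_rec_holomorphic, hproper.
    + intros x Hx. now apply approx_rec_rhs_dom.
    + apply approx_rec_holomorphic, hproper.
    + apply (approx_rec_holomorphic A (S m) i hproper).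
    + intros x Hx. now apply approx_rec_derivative.
    + intros j _. apply IH.
Qed.

(** The same comparison with equality as the relation: the constant start agrees in order 0, and
    each of the [m] integrations gains one order. *)
Lemma coef_approx m i k : (k <= m)%nat ->
  coef (approx_rec A m i) (base A) r k = coef (g i) (base A) r k.
Proof.
  revert i k. induction m as [|m IH]; intros i k Hk.
  - replace k with 0%nat by lia. simpl approx_rec. rewrite coef_const by lra.
    destruct (AS_spec A g i hA) as (F1 & _ & F3 & _).
    rewrite (coef_0 (g i) (base A) r rho Hr) by auto. now symmetry.
  - destruct (AS_spec A g i hA) as (F1 & F2 & F3 & F4).
    destruct (AS_spec A g (S i) hA) as (F1' & _ & F3' & _).
    apply (rel_upto_step (@eq C)) with (A := A) (B := A) (rho := rho) (n := m) (i := i)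
      (p := approx_rec A m (S i)) (q := g (S i)); auto.
    + intros a b c d -> ->. reflexivity.
    + intros a b c d -> ->. reflexivity.
    + exact eq_scale.
    + apply approx_rec_holomorphic, hproper.
    + intros x Hx. now apply approx_rec_rhs_dom.
    + apply approx_rec_holomorphic, hproper.
    + apply (approx_rec_holomorphic A (S m) i hproper).
    + intros x Hx. now apply approx_rec_derivative.
    + intros j Hj. now apply IH.
Qed.

(** Coefficients of order below [n] cancel. The others are bounded by those of [gt 0], hence by M /
    r^k, for both functions, and the two tails add up to 2 M q^n / (1 - q) with q = |v| / r. *)
Lemma approx_error : exists M, forall n v, Cmod v < r ->
  Cmod (approx A n 0 (base A + v)%C - g 0%nat (base A + v)%C) <=
  2 * M / (1 - Cmod v / r) * (Cmod v / r) ^ n.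
Proof.
  destruct (AS_spec At gt 0%nat hAt) as (T1 & _ & _ & _).
  destruct (AS_spec A g 0%nat hA) as (F1 & _ & _ & _).
  assert (Hgt : forall s, disk (base A) rho s -> cdiff (gt 0%nat) s) by auto.
  assert (Hg : forall s, disk (base A) rho s -> cdiff (g 0%nat) s) by auto.
  destruct (circ_bounded _ _ _ (disk_circ_continuous _ _ _ _ Hr Hgt)) as [M HM].
  exists M. intros n v Hv.
  assert (Hap : forall s, disk (base A) rho s -> cdiff (approx A n 0) s).
  { intros s Hs. unfold approx. now apply approx_rec_holomorphic, hdisk. }
  (* [M1] and [M2] serve to let the length of the Taylor polynomials grow while [n] is fixed. [M2]
     may depend on [n], but neither enters the final bound. *)
  destruct (circ_bounded _ _ _ (disk_circ_continuous _ _ _ _ Hr Hg)) as [M1 HM1].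
  destruct (circ_bounded _ _ _ (disk_circ_continuous _ _ _ _ Hr Hap)) as [M2 HM2].
  set (q := Cmod v / r).
  pose proof (Cmod_ge_0 v) as Hv0.
  assert (Hq : 0 <= q < 1).
  { unfold q. split; [apply Rmult_le_pos; [lra|apply Rlt_le, Rinv_0_lt_compat; lra]|].
    apply Rlt_div_l; lra. }
  set (c := coef (g 0%nat) (base A) r). set (c' := coef (approx A n 0) (base A) r).
  assert (Hmaj : forall a k, majorizes a (coef (gt 0%nat) (base A) r k) ->
    Cmod (a * v ^ k) <= M * q ^ k).
  { intros a k Ha. apply majorizes_iff in Ha. destruct Ha as (x & E & Hx).
    pose proof (coef_bound (gt 0%nat) (base A) r k M ltac:(lra)
      (disk_circ_continuous _ _ _ _ Hr Hgt) HM) as Hb.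
    rewrite E, Cmod_R in Hb. pose proof (Rle_abs x) as Hxx.
    rewrite Cmod_mult, Cmod_pow. unfold q, Rdiv. rewrite Rpow_mult_distr, pow_inv.
    replace (M * (Cmod v ^ k * / r ^ k)) with (M / r ^ k * Cmod v ^ k) by (unfold Rdiv; ring).
    apply Rmult_le_compat_r; [now apply pow_le|lra]. }
  (* The right side is the geometric sum in closed form, so that passing from [j] to [S j] adds
     exactly 2 M q^(n+j). *)
  assert (Hsum : forall j, Cmod (csum (fun k => c' k * v ^ k)%C (n + j)
      - csum (fun k => c k * v ^ k)%C (n + j)) <= 2 * M / (1 - q) * (q ^ n - q ^ (n + j))).
  { induction j as [|j IH].
    - rewrite Nat.add_0_r. rewrite (csum_ext _ (fun k => c k * v ^ k)%C).
      + match goal with |- Cmod (?x - ?x) <= _ => replace (x - x)%C with (RtoC 0) by ring end.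
        rewrite Cmod_0. right. ring.
      + intros k Hk. unfold c', c, approx. rewrite coef_approx by lia. reflexivity.
    - rewrite Nat.add_succ_r, !csum_S.
      match goal with |- Cmod (?a + ?b - (?d + ?e)) <= _ =>
        replace (a + b - (d + e))%C with ((a - d) + (b + - e))%C by ring end.
      eapply Rle_trans; [apply Cmod_triangle|].
      apply Rle_trans with (2 * M / (1 - q) * (q ^ n - q ^ (n + j)) + 2 * (M * q ^ (n + j))).
      + apply Rplus_le_compat; [exact IH|].
        eapply Rle_trans; [apply Cmod_triangle|]. rewrite Cmod_opp.
        pose proof (Hmaj (c (n + j)%nat) (n + j)%nat (majorant_solution _ _)).
        pose proof (Hmaj (c' (n + j)%nat) (n + j)%nat (majorant_approx _ _ _)). lra.
      + right. simpl. field. lra. }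
  set (e := (base A + v)%C).
  set (x := Cmod (approx A n 0 e - g 0%nat e)).
  set (b := 2 * M / (1 - q) * q ^ n).
  assert (HM0 : 0 <= M) by (eapply Rle_trans; [apply Cmod_ge_0|apply (HM 0); lra]).
  assert (Hb : 0 <= 2 * M / (1 - q)).
  { apply Rmult_le_pos; [lra|]. apply Rlt_le, Rinv_0_lt_compat. lra. }
  assert (HM10 : 0 <= M1) by (eapply Rle_trans; [apply Cmod_ge_0|apply (HM1 0); lra]).
  assert (HM20 : 0 <= M2) by (eapply Rle_trans; [apply Cmod_ge_0|apply (HM2 0); lra]).
  assert (Hk : 0 < r / (r - Cmod v)) by (apply Rdiv_lt_0_compat; lra).
  enough (x - b <= 0) by lra.
  (* With [S j] further terms, both Taylor remainders together are at most a constant times q^(j+1),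
     and the difference of the polynomials is at most [b] for every [j]. *)
  apply (le_geometric_0 _ ((M1 + M2) * (r / (r - Cmod v))) q Hq).
  intros j.
  pose proof (taylor_remainder _ (base A) r rho v (n + S j) M1 Hr Hg HM1 Hv) as R1.
  pose proof (taylor_remainder _ (base A) r rho v (n + S j) M2 Hr Hap HM2 Hv) as R2.
  specialize (Hsum (S j)).
  fold q in R1, R2. fold c in R1. fold c' in R2. fold e in R1, R2.
  set (s1 := csum (fun k => c k * v ^ k)%C (n + S j)) in *.
  set (s2 := csum (fun k => c' k * v ^ k)%C (n + S j)) in *.
  assert (Hx : x <= Cmod (approx A n 0 e - s2) + Cmod (s2 - s1) + Cmod (g 0%nat e - s1)).
  { unfold x. replace (approx A n 0 e - g 0%nat e)%C with
      ((approx A n 0 e - s2) + (s2 - s1) + - (g 0%nat e - s1))%C by ring.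
    eapply Rle_trans; [apply Cmod_triangle|]. rewrite Cmod_opp.
    apply Rplus_le_compat_r, Cmod_triangle. }
  assert (Hqn : 0 <= q ^ (n + S j) <= q ^ S j).
  { split; [apply pow_le; lra|]. rewrite pow_add.
    assert (q ^ n <= 1) by (rewrite <- (pow1 n); apply pow_incr; lra).
    assert (0 <= q ^ S j) by (apply pow_le; lra). nra. }
  assert (H3 : 2 * M / (1 - q) * (q ^ n - q ^ (n + S j)) <= b).
  { unfold b. apply Rmult_le_compat_l; lra. }
  assert (H1 : M1 * (r / (r - Cmod v)) * q ^ (n + S j) <= M1 * (r / (r - Cmod v)) * q ^ S j).
  { apply Rmult_le_compat_l; [|lra]. apply Rmult_le_pos; lra. }
  assert (H2 : M2 * (r / (r - Cmod v)) * q ^ (n + S j) <= M2 * (r / (r - Cmod v)) * q ^ S j).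
  { apply Rmult_le_compat_l; [|lra]. apply Rmult_le_pos; lra. }
  lra.
Qed.

End Domination.

Theorem theorem5p11 (At A : approx_system) (gt g : nat -> C -> C)
  (hAt : is_AS_for At gt) (hA : is_AS_for A g)
  (hproper : proper A) (hdominates : dominates At A)
  (hdom : forall x, dom At x <-> dom A x)
  (rho : R) (hrho : 0 < rho) (hdisk : forall x, disk (base A) rho x -> dom A x) :
  forall r, 0 < r < rho ->
    converges_uniformly_on (disk (base A) r) (fun n => approx A n 0) (g 0%nat).
Proof.
  (* The auxiliary radius lies strictly between: below [rho], so that the dominating solution is
     bounded on its circle, and above [r], so that the ratio [r / r1] is less than 1. *)
  intros r Hr eps Heps. set (r1 := (r + rho) / 2).
  assert (Hr1 : 0 < r1 < rho) by (unfold r1; lra).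
  destruct (approx_error At A gt g hAt hA hproper hdominates hdom r1 rho Hr1 hdisk) as [M HM].
  set (q := r / r1).
  assert (Hq : 0 < q < 1).
  { unfold q. split; [apply Rdiv_lt_0_compat; lra|]. apply Rlt_div_l; unfold r1; lra. }
  (* The sign of [M] is read off the error estimate at n = 0 and v = 0, where the bound is
     [2 * M]. *)
  assert (HM0 : 0 <= M).
  { pose proof (HM 0%nat 0%C) as K. rewrite Cmod_0 in K. specialize (K ltac:(lra)).
    replace (2 * M / (1 - 0 / r1) * (0 / r1) ^ 0) with (2 * M) in K by (simpl; field; lra).
    pose proof (Cmod_ge_0 (approx A 0 0 (base A + 0)%C - g 0%nat (base A + 0)%C)). lra. }
  set (B := 2 * M / (1 - q)).
  assert (HB : 0 <= B).
  { unfold B. apply Rmult_le_pos; [lra|]. apply Rlt_le, Rinv_0_lt_compat. lra. }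
  (* The summand 1 keeps the divisor positive when [B] is 0. *)
  destruct (pow_lt_1_zero q) with (y := eps / (B + 1)) as [N HN].
  - rewrite Rabs_pos_eq; lra.
  - apply Rdiv_lt_0_compat; lra.
  - exists N. intros n Hn x Hx. unfold disk in Hx. specialize (HN n Hn).
    rewrite Rabs_pos_eq in HN by (apply pow_le; lra).
    apply Rlt_div_r in HN; [|lra].
    replace x with (base A + (x - base A))%C by ring.
    set (v := (x - base A)%C) in *. pose proof (Cmod_ge_0 v) as Hv.
    assert (Hvq : 0 <= Cmod v / r1 <= q).
    { split; [apply Rmult_le_pos; [assumption|apply Rlt_le, Rinv_0_lt_compat; lra]|].
      unfold q. apply Rmult_le_compat_r; [apply Rlt_le, Rinv_0_lt_compat; lra|lra]. }
    eapply Rle_lt_trans; [apply HM; unfold r1; lra|].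
    apply Rle_lt_trans with (B * q ^ n).
    + apply Rmult_le_compat.
      * apply Rmult_le_pos; [lra|]. apply Rlt_le, Rinv_0_lt_compat. lra.
      * apply pow_le. lra.
      * unfold B. apply Rmult_le_compat_l; [lra|]. apply Rinv_le_contravar; lra.
      * apply pow_incr. lra.
    + assert (0 <= q ^ n) by (apply pow_le; lra). nra.
Qed.
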